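(* Let $k$ be an algebraically closed field of characteristic $p>0$, let $e\ge 1$ with $p^e>2$, let $c\in k\setminus\{0\}$, and for $i=1,2$ let $L_i(T)=\alpha_{i,e}T^{p^e}+\alpha_{i,e-1}T^{p^{e-1}}+\cdots+\alpha_{i,0}T\in k[T]$ with $\alpha_{i,e}\alpha_{i,0}\neq 0$. Let $C\subset\mathbb{P}^2$ be the projective plane curve over $k$ defined in affine coordinates by $L_1(x)\cdot L_2(y)+c=0$. Let $r\ge 1$ be the integer defined by $$\mathbb{F}_{p^{r}}=\bigcap_{i>0,\ \alpha_{1,i}\neq 0}\mathbb{F}_{p^i}\ \cap\bigcap_{j>0,\ \alpha_{2,j}\neq 0}\mathbb{F}_{p^j}$$ (intersection of subfields of $k$). If $L_1=L_2$, then $$\delta'(C)=\delta_0'(C)=p^{r}-1,$$ where $\delta'(C)$ is the number of outer Galois points for $C$ and $\delta_0'(C)$ is the number of extendable outer Galois points for $C$.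
   Context: For a plane curve $C\subset\mathbb{P}^2$, a point $R\in\mathbb{P}^2\setminus C$ is an outer Galois point for $C$ if the function field extension $k(C)/\pi_R^*k(\mathbb{P}^1)$ induced by the projection $\pi_R: C\dashrightarrow\mathbb{P}^1$ from $R$ is Galois. An outer Galois point $R$ is extendable if each element of the Galois group of this extension, viewed as a birational self-map of $C$, is the restriction of some linear transformation of $\mathbb{P}^2$. $\mathbb{F}_{p^i}$ denotes the subfield of $k$ with $p^i$ elements. *)

(* Defs.v *)
From HB Require Import structures.
From mathcomp Require Import all_boot all_order all_algebra all_field.
From mathcomp.multinomials Require Import mpoly.
From mathcomp Require Import boolp classical_sets functions cardinality.

Set Implicit Arguments.
Unset Strict Implicit.
Unset Printing Implicit Defensive.
Import GRing.Theory.
Local Open Scope ring_scope.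
Local Open Scope quotient_scope.
Local Open Scope classical_set_scope.
Local Open Scope card_scope.

(* The forms of degree 1 in n variables attached to the columns of M, so that  *)
(* [lsubst M G] is the pullback of G under the linear map v |-> v *m M.        *)
Definition lsubst (k : fieldType) m n (M : 'M[k]_(m, n)) (G : {mpoly k[n]}) :
    {mpoly k[m]} :=
  G \mPo [tuple \sum_(i < m) M i j *: 'X_i | j < n].

Definition principal (k : fieldType) n (F : {mpoly k[n]}) : {pred {mpoly k[n]}} :=
  fun G => `[< exists H, G = H * F >].

(* Plane curves are integral: [curve_form_prime] says that the homogeneous     *)
(* ideal of C is prime, so that C has a function field.                        *)
Record plane_curve (k : fieldType) := PlaneCurve {
  curve_form : {mpoly k[3]};
  curve_form_homog : exists d, curve_form \is d.-homog;
  curve_form_neq0 : curve_form != 0;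
  curve_form_proper : 1 \notin principal curve_form;
  curve_form_prime : prime_idealr_closed (principal curve_form)
}.

Definition curve_ideal (k : fieldType) (C : plane_curve k) : {pred {mpoly k[3]}} :=
  principal (curve_form C).

Lemma curve_idealr_closed (k : fieldType) (C : plane_curve k) :
  idealr_closed (curve_ideal C).
Proof.
split; first by apply/asboolP; exists 0; rewrite mul0r.
  exact: curve_form_proper.
move=> a u v /asboolP[x ->] /asboolP[y ->]; apply/asboolP.
by exists (a * x + y); rewrite mulrDl mulrA.
Qed.

HB.instance Definition _ (k : fieldType) (C : plane_curve k) :=
  isIdealr.Build {mpoly k[3]} (curve_ideal C) (curve_idealr_closed C).
HB.instance Definition _ (k : fieldType) (C : plane_curve k) :=
  isPrimeIdealrClosed.Build {mpoly k[3]} (curve_ideal C) (@curve_form_prime k C).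

Definition coord_ring (k : fieldType) (C : plane_curve k) :=
  {ideal_quot (curve_ideal C)}.

HB.instance Definition _ (k : fieldType) (C : plane_curve k) :=
  GRing.ComNzRing.on (coord_ring C).

Definition coord_unit (k : fieldType) (C : plane_curve k) : pred (coord_ring C) :=
  fun x => `[< exists y, y * x = 1 >].

Definition coord_inv (k : fieldType) (C : plane_curve k) (x : coord_ring C) :
    coord_ring C :=
  if pselect (exists y, y * x = 1) is left xU then projT1 (cid xU) else x.

Lemma coord_mulVr (k : fieldType) (C : plane_curve k) :
  {in @coord_unit k C, left_inverse 1 (@coord_inv k C) *%R}.
Proof.
move=> x /asboolP xU; rewrite /coord_inv; case: pselect => // yU.
exact: (projT2 (cid yU)).
Qed.

Lemma coord_unitP (k : fieldType) (C : plane_curve k) (x y : coord_ring C) :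
  y * x = 1 -> x \in @coord_unit k C.
Proof. by move=> yx1; apply/asboolP; exists y. Qed.

Lemma coord_inv_out (k : fieldType) (C : plane_curve k) :
  {in [predC @coord_unit k C], @coord_inv k C =1 id}.
Proof.
move=> x /negP xNU; rewrite /coord_inv; case: pselect => // xU.
by case: xNU; apply/asboolP.
Qed.

HB.instance Definition _ (k : fieldType) (C : plane_curve k) :=
  GRing.ComNzRing_hasMulInverse.Build (coord_ring C)
    (@coord_mulVr k C) (@coord_unitP k C) (@coord_inv_out k C).

Lemma coord_mulf_eq0 (k : fieldType) (C : plane_curve k) (x y : coord_ring C) :
  x * y = 0 -> (x == 0) || (y == 0).
Proof. exact: (@Quotient.rquot_IdomainAxiom _ (curve_ideal C)). Qed.

HB.instance Definition _ (k : fieldType) (C : plane_curve k) :=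
  GRing.ComUnitRing_isIntegral.Build (coord_ring C) (@coord_mulf_eq0 k C).

Definition residue (k : fieldType) (C : plane_curve k) (G : {mpoly k[3]}) :
    coord_ring C := \pi_{ideal_quot (curve_ideal C)} G.

HB.instance Definition _ (k : fieldType) (C : plane_curve k) :=
  GRing.RMorphism.copy (residue C) (\pi_{ideal_quot (curve_ideal C)}).

Lemma residue_eq0 (k : fieldType) (C : plane_curve k) (G : {mpoly k[3]}) :
  (residue C G == 0) = (G \in curve_ideal C).
Proof. by rewrite -(rmorph0 (residue C)) -[in RHS](subr0 G) Quotient.idealrBE. Qed.

Definition frac_residue (k : fieldType) (C : plane_curve k) (G : {mpoly k[3]}) :
    {fraction coord_ring C} := tofrac (residue C G).

HB.instance Definition _ (k : fieldType) (C : plane_curve k) :=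
  GRing.RMorphism.copy (frac_residue C) (@tofrac (coord_ring C) \o residue C).

Lemma frac_residue_eq0 (k : fieldType) (C : plane_curve k) (G : {mpoly k[3]}) :
  (frac_residue C G == 0) = (G \in curve_ideal C).
Proof. by rewrite tofrac_eq0 residue_eq0. Qed.

Definition form_ratio (k : fieldType) (C : plane_curve k) (G H : {mpoly k[3]}) :
    {fraction coord_ring C} :=
  frac_residue C G / frac_residue C H.

Definition degree0 (k : fieldType) (C : plane_curve k) :
    {pred {fraction coord_ring C}} :=
  fun a => `[< exists d G H,
    [/\ G \is d.-homog, H \is d.-homog, H \notin curve_ideal C
      & a = form_ratio C G H] >].

Lemma homog_fractions_divring_closed (k L : fieldType) n
    (f : {rmorphism {mpoly k[n]} -> L}) :
  divring_closed (fun a : L => `[< exists d G H,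
    [/\ G \is d.-homog, H \is d.-homog, f H != 0 & a = f G / f H] >]).
Proof.
split.
- apply/asboolP; exists 0%N, 1, 1.
  by rewrite dhomog1 rmorph1 oner_neq0 divr1.
- move=> _ _ /asboolP[d [G [H [hG hH nH ->]]]] /asboolP[d' [G' [H' [hG' hH' nH' ->]]]].
  apply/asboolP; exists (d + d')%N, (G * H' - G' * H), (H * H').
  rewrite rmorphB !rmorphM mulf_neq0 //; split=> //; [|exact: dhomogM|].
    by apply: rpredB; [exact: dhomogM | rewrite addnC; exact: dhomogM].
  by rewrite -[in LHS]mulNr GRing.addf_div // mulNr.
- move=> _ _ /asboolP[d [G [H [hG hH nH ->]]]] /asboolP[d' [G' [H' [hG' hH' nH' ->]]]].
  have [G'0|nG'] := eqVneq (f G') 0.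
    apply/asboolP; exists d, 0, H.
    by rewrite dhomog0 G'0 rmorph0 !mul0r invr0 mulr0.
  apply/asboolP; exists (d + d')%N, (G * H'), (H * G').
  rewrite !rmorphM mulf_neq0 //; split=> //; [exact: dhomogM|exact: dhomogM|].
  by rewrite invf_div mulf_div.
Qed.

Lemma degree0_divring_closed (k : fieldType) (C : plane_curve k) :
  divring_closed (@degree0 k C).
Proof.
have := homog_fractions_divring_closed (frac_residue C).
congr (divring_closed _); apply/funext => a.
apply/asbool_equiv_eq; split=> -[d [G [H [hG hH nH ->]]]]; exists d, G, H.
  by rewrite frac_residue_eq0 in nH.
by rewrite frac_residue_eq0.
Qed.

HB.instance Definition _ (k : fieldType) (C : plane_curve k) :=
  GRing.isDivringClosed.Build {fraction coord_ring C} (@degree0 k C)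
    (degree0_divring_closed C).

Record subfield_of (L : fieldType) (S : divringClosed L) :=
  SubfieldOf { subfield_val : L; _ : subfield_val \in S }.

HB.instance Definition _ (L : fieldType) (S : divringClosed L) :=
  [isSub for @subfield_val L S].
HB.instance Definition _ (L : fieldType) (S : divringClosed L) :=
  [Choice of subfield_of S by <:].
HB.instance Definition _ (L : fieldType) (S : divringClosed L) :=
  [SubChoice_isSubIntegralDomain of subfield_of S by <:].
HB.instance Definition _ (L : fieldType) (S : divringClosed L) :=
  [SubIntegralDomain_isSubField of subfield_of S by <:].

(* The elements of degree 0 in the field of fractions of the homogeneous       *)
(* coordinate ring.                                                            *)
Definition funfield (k : fieldType) (C : plane_curve k) : fieldType :=
  subfield_of (@degree0 k C).

Definition funfield_val (k : fieldType) (C : plane_curve k) (a : funfield C) :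
    {fraction coord_ring C} := subfield_val a.

HB.instance Definition _ (k : fieldType) (C : plane_curve k) :=
  GRing.RMorphism.copy (@funfield_val k C)
    (val : subfield_of (@degree0 k C) -> {fraction coord_ring C}).

(* Points are lines through the origin of k^3.                                 *)
Definition P2 (k : fieldType) := {V : {vspace 'rV[k]_3} | \dim V == 1%N}.

Definition on_curve (k : fieldType) (C : plane_curve k) (R : P2 k) : Prop :=
  forall v : 'rV[k]_3, v \in val R -> (curve_form C).@[fun i => v 0 i] = 0.

(* v |-> v *m M induces a projection from R onto the projective line.          *)
Definition projection_from (k : fieldType) (R : P2 k) (M : 'M[k]_(3, 2)) : Prop :=
  forall v : 'rV[k]_3, v *m M = 0 <-> v \in val R.

(* The pullback of the function field of the projective line; two projections  *)
(* from R differ by an automorphism of the line, so M does not matter.         *)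
Definition proj_field (k : fieldType) (C : plane_curve k) (R : P2 k) :
    set (funfield C) :=
  [set a | exists M, projection_from R M /\
     exists d (g h : {mpoly k[2]}),
       [/\ g \is d.-homog, h \is d.-homog, lsubst M h \notin curve_ideal C
         & funfield_val a = form_ratio C (lsubst M g) (lsubst M h)]].
Arguments proj_field {k} C R.

(* The extension E / K is isomorphic to a finite Galois extension L / K0;      *)
(* splitting fields are normal, so [galois] amounts here to separability.      *)
Definition galois_over (E : fieldType) (K : set E) : Prop :=
  exists (K0 : fieldType) (L : splittingFieldType K0) (f : {rmorphism L -> E}),
    [/\ bijective f, range (fun a : K0 => f a%:A) = K & galois 1 {:L}].

Definition outer_galois_point (k : fieldType) (C : plane_curve k) (R : P2 k) :
    Prop :=
  ~ on_curve C R /\ galois_over (proj_field C R).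

(* s is the comorphism of the restriction to C of a linear transformation of   *)
(* the plane (the last clause forces that transformation to preserve C).       *)
Definition linear_on_curve (k : fieldType) (C : plane_curve k)
    (s : funfield C -> funfield C) : Prop :=
  exists2 A : 'M[k]_3, A \in unitmx &
    forall d (G H : {mpoly k[3]}) (a : funfield C),
      G \is d.-homog -> H \is d.-homog -> H \notin curve_ideal C ->
      funfield_val a = form_ratio C G H ->
      lsubst A H \notin curve_ideal C /\
      funfield_val (s a) = form_ratio C (lsubst A G) (lsubst A H).

(* The automorphisms s are the elements of the Galois group of k(C) / proj_field. *)
Definition extendable (k : fieldType) (C : plane_curve k) (R : P2 k) : Prop :=
  forall s : {rmorphism funfield C -> funfield C},
    bijective s -> (forall a, proj_field C R a -> s a = a) -> linear_on_curve s.

Definition extendable_outer_galois_point (k : fieldType) (C : plane_curve k)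
    (R : P2 k) : Prop :=
  outer_galois_point C R /\ extendable C R.

Definition additive_poly (k : fieldType) (p e : nat) (a : 'I_e.+1 -> k) : {poly k} :=
  \sum_(i < e.+1) a i *: 'X^(p ^ i).

(* Z^(deg L) L(T / Z) *)
Definition homog_poly (k : fieldType) (L : {poly k}) (T Z : {mpoly k[3]}) :
    {mpoly k[3]} :=
  \sum_(i < size L) L`_i *: (T ^+ i * Z ^+ ((size L).-1 - i)).

(* The homogenization of L1(x) L2(y) + c, in the chart Z = 1.                  *)
Definition product_form (k : fieldType) (L1 L2 : {poly k}) (c : k) : {mpoly k[3]} :=
  let X := 'X_0 in let Y := 'X_1 in let Z := 'X_2%:R in
  homog_poly L1 X Z * homog_poly L2 Y Z
    + c *: Z ^+ ((size L1).-1 + (size L2).-1).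

Lemma product_form_affine (k : fieldType) (L1 L2 : {poly k}) (c x y : k) :
  (product_form L1 L2 c).@[fun i => [tuple x; y; 1]`_i] = L1.[x] * L2.[y] + c.
Proof.
have hE L T : (homog_poly L T 'X_2%:R).@[fun i => [tuple x; y; 1]`_i]
    = L.[T.@[fun i => [tuple x; y; 1]`_i]].
  rewrite /homog_poly raddf_sum horner_coef /=; apply: eq_bigr => i _.
  by rewrite mevalZ mevalM !rmorphXn /= !mevalXU /= expr1n mulr1.
rewrite /product_form mevalD mevalM !hE mevalZ rmorphXn /= !mevalXU /=.
by rewrite expr1n mulr1.
Qed.

(* The subfield of order p ^ i, when 0 < i and k is algebraically closed of    *)
(* characteristic p; see the two lemmas below.                                 *)
Definition Fsub (k : fieldType) (p i : nat) : set k := [set x | x ^+ (p ^ i) = x].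
Arguments Fsub : clear implicits.

Lemma Fsub_divring_closed (k : fieldType) (p i : nat) : p \in [pchar k] ->
  divring_closed [pred x : k | x ^+ (p ^ i) == x].
Proof.
move=> pk; have qk : [pchar k].-nat (p ^ i)%N.
  by rewrite pnatX (pnatE _ (pcharf_prime pk)) pk.
split; rewrite ?inE ?expr1n // => x y; rewrite !inE => /eqP xq /eqP yq.
  by rewrite exprDn_pchar // exprNn_pchar // xq yq.
by rewrite expr_div_n xq yq.
Qed.

Lemma card_Fsub (k : closedFieldType) (p i : nat) : p \in [pchar k] -> (0 < i)%N ->
  Fsub k p i #= `I_(p ^ i).
Proof.
move=> pk i_gt0; set q := (p ^ i)%N; pose P : {poly k} := 'X^q - 'X.
have q_gt1 : (1 < q)%N by rewrite -(exp1n i) ltn_exp2r // prime_gt1 ?(pcharf_prime pk).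
have q0 : (q%:R : k) = 0 by rewrite /q natrX (pcharf0 pk) expr0n gtn_eqF.
have szP : size P = q.+1.
  by rewrite size_polyDl ?size_polyXn // size_polyN size_polyX ltnS.
have [s Ps] := closed_field_poly_normal P.
have lcP : lead_coef P = 1.
  by rewrite lead_coefDl ?lead_coefXn // size_polyXn size_polyN size_polyX ltnS.
move: Ps; rewrite lcP scale1r => Ps.
have us : uniq s.
  rewrite -separable_prod_XsubC -Ps unlock derivB derivXn derivX.
  by rewrite -mulr_natr -polyC_natr q0 mulr0 sub0r -scaleN1r coprimepZr ?oppr_eq0 ?oner_eq0
    ?coprimep1.
have szs : size s = q by apply: succn_inj; rewrite -szP Ps size_prod_XsubC.
have -> : Fsub k p i = [set` s].
  apply/seteqP; split=> x /=; rewrite /Fsub /= -root_prod_XsubC -Ps rootE.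
    by move=> xq; rewrite !hornerE xq subrr.
  by rewrite !hornerE subr_eq0 => /eqP.
apply/card_set_bijP; exists (index^~ s).
split=> [x /= xs|x y|j /= jq].
- by rewrite -szs index_mem.
- by rewrite !inE => xs ys /(congr1 (nth 0 s)); rewrite !nth_index.
by exists (nth 0 s j); rewrite /= ?mem_nth ?szs // index_uniq ?szs.
Qed.

(* Main.v *)
(* Let q = p ^ e and let x, y be the coordinate functions of the affine curve *)
(* L(x) L(y) + c = 0. The projection from an affine point (a, b) off C is t = *)
(* (y - b) / (x - a), the one from (1 : m : 0) is t = y - m x, and x has      *)
(* degree at least 2q over k(t) whenever the centre is not on C. If k(C) /    *)
(* k(t) is Galois with group G, then x has at least 2q conjugates.            *)
(*                                                                            *)
(* For s in G, the function z = s(x), multiplied by y when the centre is the  *)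
(* origin, is integral over the sections of O(1, 1) on the closure of C in    *)
(* P^1 x P^1, so that z is a combination of 1, x, y, xy. At an affine centre, *)
(* moved to the origin, composing two automorphisms leaves at most the four   *)
(* values x, -x, a / y, -a / y for s(x), fewer than 2q. At (1 : m : 0) one    *)
(* finds s(x) = x + a or s(x) = a - y / m with L(a) = L(m a) = 0; having 2q   *)
(* conjugates then forces m V = V for the group V of roots of L, that is m ^  *)
(* (p ^ i) = m whenever alpha_i != 0. Conversely, for such m these formulas   *)
(* do define 2q automorphisms, all of them linear. The points (1 : 0 : 0) and *)
(* (0 : 1 : 0) are on C, so the outer Galois points are the (1 : m : 0) with  *)
(* m a nonzero element of F_(p ^ r).                                          *)
Require Import Defs.
From HB Require Import structures.
From mathcomp Require Import all_boot all_order all_algebra all_field.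
From mathcomp.multinomials Require Import mpoly.
From mathcomp Require Import boolp classical_sets functions cardinality.
From mathcomp Require Import zify ring.
Set Implicit Arguments.
Unset Strict Implicit.
Unset Printing Implicit Defensive.
Import GRing.Theory.
Local Open Scope ring_scope.
Local Open Scope classical_set_scope.
Local Open Scope card_scope.

(** Put q = p ^ e and let E = k(x, y) be the function field of the curve. The argument weighs a
    lower bound for the number of conjugates of x over the field k(t) of a projection against an
    explicit list of the functions that can be conjugates of x.

    Lower bound. Restricting L(x) L(y) + c to a line of the pencil, y = t x or y = t + m x, gives a
    polynomial of degree 2q in x. Because the curve is irreducible, every equation of x over k(t) is
    a multiple of it ([degree_concurrent], [degree_parallel]). If k(t) is the fixed field of a
    finite group, the orbit of x therefore has at least 2q elements ([orbit_size]).

    Upper bound. In P^1 x P^1 the closure of the curve adds only the points (x0, inf) and (inf, y0)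
    over the roots of the two factors. A function integral with the poles of x y has no finite pole
    and lies in k[x, y]; its leading coefficients vanish at all those roots as soon as its degree
    exceeds 1, so it reduces modulo the curve to a combination of 1, x, y, x y
    ([integral_section_bilinear]). The equation of s(x) at an infinite centre, or of y s(x) when the
    centre is the origin, has exactly this integral form ([integral_parallel],
    [integral_concurrent]). Since q > 2, such combinations and their products are determined by
    their coefficients ([coef_eq0_deg2]), so the group law becomes a set of identities in k.

    At an affine centre these identities, the local study of the curve along its axes
    ([conjugate_axis]) and the rigidity of homotheties ([homothety_sqr]) leave at most four
    conjugates, fewer than 2q ([no_concurrent_group]). At (1 : m : 0) the conjugates are x + a and a
    - y / m with L(a) = L(m a) = 0, and 2q of them exist only if m preserves the roots of L, which
    forces m^(p^i) = m whenever alpha_i != 0 ([parallel_group_slope], [additive_scale_coef]).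
    Conversely such an m satisfies L(m z) = m L(z); the 2q functions are then the roots of one
    irreducible separable polynomial over k(t), and every automorphism over k(t) is affine
    ([parallel_galois_over], [parallel_automorphism]).

    The projective definitions reach this affine setting through [homogenization_divides], which
    makes the homogenized equation generate a prime ideal, and [proj_fieldP]. [outer_galois_pointP]
    then identifies the outer Galois points with the nonzero elements of F_(p^r), counted by
    [card_slope_points]. *)

(** * Polynomials in two variables *)

(* ['X] is the outer variable; it is evaluated at the last argument. *)
Definition bieval (k R : comNzRingType) (f : {rmorphism k -> R}) (x y : R) :
    {poly {poly k}} -> R :=
  horner_eval y \o map_poly (horner_eval x \o map_poly f).

HB.instance Definition _ (k R : comNzRingType) (f : {rmorphism k -> R}) (x y : R) :=
  GRing.RMorphism.copy (bieval f x y)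
    (horner_eval y \o map_poly (horner_eval x \o map_poly f)).

Section Bieval.
Context {k R : comNzRingType} (f : {rmorphism k -> R}).
Implicit Types (x y : R) (P : {poly {poly k}}) (g : {poly k}).

Lemma bieval0 x y : bieval f x y 0 = 0. Proof. exact: rmorph0. Qed.
Lemma bieval1 x y : bieval f x y 1 = 1. Proof. exact: rmorph1. Qed.
Lemma bievalD x y : {morph bieval f x y : P Q / P + Q}. Proof. exact: rmorphD. Qed.
Lemma bievalN x y : {morph bieval f x y : P / - P}. Proof. exact: rmorphN. Qed.
Lemma bievalB x y : {morph bieval f x y : P Q / P - Q}. Proof. exact: rmorphB. Qed.
Lemma bievalM x y : {morph bieval f x y : P Q / P * Q}. Proof. exact: rmorphM. Qed.
Lemma bievalXn x y n : {morph bieval f x y : P / P ^+ n}.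
Proof. exact: rmorphXn. Qed.
Lemma bieval_sum x y I (r : seq I) (p : pred I) (F : I -> {poly {poly k}}) :
  bieval f x y (\sum_(i <- r | p i) F i) = \sum_(i <- r | p i) bieval f x y (F i).
Proof. exact: rmorph_sum. Qed.

Lemma bievalC x y g : bieval f x y g%:P = (map_poly f g).[x].
Proof. by rewrite /bieval /= map_polyC /= /horner_eval hornerC. Qed.

Lemma bievalCC x y a : bieval f x y a%:P%:P = f a.
Proof. by rewrite bievalC map_polyC hornerC. Qed.

Lemma bievalX x y : bieval f x y 'X = y.
Proof. by rewrite /bieval /= map_polyX /horner_eval hornerX. Qed.

Lemma bievalZ x y g P : bieval f x y (g *: P) = (map_poly f g).[x] * bieval f x y P.
Proof. by rewrite -mul_polyC bievalM bievalC. Qed.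

Lemma bieval_map x y g : bieval f x y (map_poly polyC g) = (map_poly f g).[y].
Proof.
rewrite /bieval /= -map_poly_comp /horner_eval; congr (_.[_]).
by apply: eq_map_poly => a /=; rewrite map_polyC /= /horner_eval hornerC.
Qed.

Lemma bieval_swap x y P : bieval f x y (swapXY P) = bieval f y x P.
Proof.
elim/poly_ind: P => [|P a IH]; first by rewrite rmorph0 !bieval0.
rewrite rmorphD rmorphM /= !bievalD !bievalM IH swapXY_X swapXY_polyC bieval_map.
by rewrite !bievalC !bievalX map_polyX hornerX.
Qed.

Lemma bieval_coef x y P :
  bieval f x y P = \sum_(i < size P) (map_poly f P`_i).[x] * y ^+ i.
Proof.
rewrite -{1}[P]coefK poly_def bieval_sum; apply: eq_bigr => i _.
by rewrite bievalZ bievalXn bievalX.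
Qed.

End Bieval.

Lemma rmorph_bieval (k R S : comNzRingType) (f : {rmorphism k -> R})
    (h : {rmorphism R -> S}) (x y : R) (P : {poly {poly k}}) :
  h (bieval f x y P) = bieval (h \o f) (h x) (h y) P.
Proof.
rewrite !bieval_coef rmorph_sum; apply: eq_bigr => i _.
by rewrite rmorphM rmorphXn -horner_map /= -map_poly_comp.
Qed.

(** * Separable polynomials, content, and irreducibility of M(X) N(Y) + c *)

Section SeparablePoly.
Context {k : closedFieldType}.
Implicit Types (P Q : {poly k}).

(** A nonzero constant is coprime to [P], so [P] is separable and its roots are distinct. *)
Lemma constant_deriv_roots P (n : nat) (a : k) : a != 0 -> P^`() = a%:P ->
  size P = n.+1 ->
  {s : seq k | [/\ uniq s, size s = n & forall x, (x \in s) = root P x]}.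
Proof.
move=> a0 dP szP; have [s Ps] := closed_field_poly_normal P.
have lc0 : lead_coef P != 0 by rewrite lead_coef_eq0 -size_poly_eq0 szP.
exists s; split.
- rewrite -separable_prod_XsubC -(eqp_separable (eqp_scale _ lc0)) -Ps.
  by rewrite unlock dP -[a%:P]mul1r mulrC mul_polyC coprimepZr ?coprimep1.
- by apply: succn_inj; rewrite -szP Ps size_scale // size_prod_XsubC.
- by move=> x; rewrite Ps rootZ // root_prod_XsubC.
Qed.

Lemma poly_eq0_many_roots P (s : seq k) : uniq s -> (size P <= size s)%N ->
  {in s, forall x, P.[x] = 0} -> P = 0.
Proof.
move=> us szP Ps; apply: (roots_geq_poly_eq0 _ us szP).
by apply/allP => x /Ps /rootP.
Qed.

Lemma dvdp_many_roots P (s : seq k) Q : uniq s -> size P = (size s).+1 ->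
  {in s, forall x, P.[x] = 0} -> {in s, forall x, Q.[x] = 0} -> exists R, Q = R * P.
Proof.
move=> us szP Ps Qs.
have P0 : P != 0 by rewrite -size_poly_eq0 szP.
exists (Q %/ P); rewrite {1}(divp_eq Q P).
suff -> : Q %% P = 0 by rewrite addr0.
apply: (poly_eq0_many_roots us); first by rewrite -ltnS -szP ltn_modp.
by move=> x xs; have /Qs := xs; rewrite {1}(divp_eq Q P) !hornerE Ps // mulr0 add0r.
Qed.

End SeparablePoly.

Section Content.
Context {k : closedFieldType}.
Implicit Types (F G P Q : {poly {poly k}}) (d : {poly k}).

Definition specialize (x0 : k) : {poly {poly k}} -> {poly k} :=
  map_poly (horner_eval x0).
HB.instance Definition _ (x0 : k) :=
  GRing.RMorphism.copy (specialize x0) (map_poly (horner_eval x0)).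

Lemma specializeB x0 : {morph specialize x0 : P Q / P - Q}. Proof. exact: rmorphB. Qed.
Lemma specializeM x0 : {morph specialize x0 : P Q / P * Q}. Proof. exact: rmorphM. Qed.
Lemma specializeXn x0 n : {morph specialize x0 : P / P ^+ n}.
Proof. exact: rmorphXn. Qed.
Lemma specialize_sum x0 I (r : seq I) (p : pred I) (F : I -> {poly {poly k}}) :
  specialize x0 (\sum_(i <- r | p i) F i) = \sum_(i <- r | p i) specialize x0 (F i).
Proof. exact: rmorph_sum. Qed.

Lemma specializeC x0 d : specialize x0 d%:P = d.[x0]%:P.
Proof. by rewrite /specialize map_polyC. Qed.

(** Over an algebraically closed field a nonconstant content has a root, so this is primitivity of
    [F] as a polynomial in Y over k[X]. *)
Definition primitive2 F := forall x0, specialize x0 F != 0.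

Lemma specialize_coef x0 F i : (specialize x0 F)`_i = (F`_i).[x0].
Proof. by rewrite coef_map. Qed.

Lemma specializeZ x0 d P : specialize x0 (d *: P) = d.[x0] *: specialize x0 P.
Proof. by apply/polyP => i; rewrite coefZ !specialize_coef coefZ hornerM. Qed.

Lemma specialize_eq0 x0 Q : specialize x0 Q = 0 ->
  exists Q1, Q = ('X - x0%:P) *: Q1.
Proof.
move=> Q0; exists (\poly_(i < size Q) (Q`_i %/ ('X - x0%:P))).
apply/polyP => i; rewrite coefZ coef_poly.
case: ltnP => [_|si]; last by rewrite nth_default // mulr0.
rewrite mulrC divpK // dvdp_XsubCl rootE.
by move/polyP/(_ i): Q0; rewrite specialize_coef coef0 => ->.
Qed.

Lemma closed_root d : (1 < size d)%N -> exists x0, d.[x0] = 0.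
Proof.
move=> sd; have /closed_rootP[x /rootP] : size d != 1%N by rewrite gtn_eqF.
by exists x.
Qed.

(** Gauss's lemma, one linear factor of [d] at a time: at a root of [d] the product [Q * F]
    specializes to 0 while [F] does not, so X - x0 divides [Q] and can be cancelled. *)
Lemma primitive2_cancel F G Q d : primitive2 F -> d != 0 -> d *: G = Q * F ->
  exists Q', G = Q' * F.
Proof.
move=> pF; have [n] := ubnP (size d); elim: n => // n IH in d G Q *.
rewrite ltnS => sd d0 E; have [sd1|sd1] := leqP (size d) 1.
  move: d0 E; rewrite (size1_polyC sd1); set a := d`_0; rewrite polyC_eq0 => a0 E.
  exists ((a^-1)%:P *: Q); rewrite -scalerAl -E scalerA -polyCM mulVf // scale1r //.
have [x0 dx0] := closed_root sd1.
have /eqP : specialize x0 (Q * F) = 0 by rewrite -E specializeZ dx0 scale0r.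
rewrite specializeM mulf_eq0 (negPf (pF x0)) orbF => /eqP /specialize_eq0[Q1 EQ].
have X0 : ('X - x0%:P : {poly k}) != 0 by rewrite polyXsubC_eq0.
have /dvdpP[d1 Ed] : ('X - x0%:P) %| d by rewrite dvdp_XsubCl rootE dx0.
have d10 : d1 != 0 by apply: contraNneq d0 => d10; rewrite Ed d10 mul0r.
apply: (IH d1 G Q1) => //.
  by move: sd; rewrite Ed size_Mmonic ?monicXsubC // size_XsubC addn2.
apply: (@mulfI _ ('X - x0%:P)%:P); first by rewrite polyC_eq0.
by rewrite !mul_polyC scalerA mulrC -Ed E EQ -scalerAl.
Qed.

Lemma primitive2_part P : P != 0 ->
  exists d P', [/\ d != 0, primitive2 P' & P = d *: P'].
Proof.
have [n] := ubnP (size (lead_coef P)); elim: n => // n IH in P *.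
rewrite ltnS => sP P0.
have [[x0 Px0]|pP] := pselect (exists x0, specialize x0 P = 0); last first.
  exists 1, P; rewrite oner_neq0 scale1r; split=> // x0.
  by apply/eqP => Px0; apply: pP; exists x0.
have [P1 EP] := specialize_eq0 Px0.
have P10 : P1 != 0 by apply: contraNneq P0 => P10; rewrite EP P10 scaler0.
have [|d [P' [d0 pP' EP1]]] := IH P1 _ P10.
  move: sP; rewrite EP lead_coefZ mulrC size_Mmonic ?monicXsubC ?lead_coef_eq0 //.
  by rewrite size_XsubC addn2.
exists (('X - x0%:P) * d), P'; rewrite mulf_neq0 ?polyXsubC_eq0 //.
by split=> //; rewrite EP EP1 scalerA.
Qed.

End Content.

(** What is kept of L when it is replaced by L + b, as happens when a centre is moved to the
    origin. *)
Definition sep_poly (k : fieldType) (q : nat) (P : {poly k}) :=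
  size P = q.+1 /\ exists2 a : k, a != 0 & P^`() = a%:P.

Definition product_curve (k : fieldType) (M N : {poly k}) (c : k) :
    {poly {poly k}} :=
  map_poly polyC N * M%:P + c%:P%:P.

Lemma sep_polyD (k : fieldType) (q : nat) (P : {poly k}) (b : k) : (0 < q)%N ->
  sep_poly q P -> sep_poly q (P + b%:P).
Proof.
move=> q0 [szP [a a0 dP]]; split; last first.
  by exists a; rewrite // derivD derivC addr0.
by rewrite size_polyDl // szP ltnS (leq_trans (size_polyC_leq1 _)).
Qed.

Lemma sep_poly_roots (k : closedFieldType) (q : nat) (P : {poly k}) : sep_poly q P ->
  exists s : seq k, [/\ uniq s, size s = q & forall x, (x \in s) = (P.[x] == 0)].
Proof.
move=> [szP [a a0 dP]]; have [s [us ss rs]] := constant_deriv_roots a0 dP szP.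
by exists s; split.
Qed.

Section ProductCurve.
Context {k : closedFieldType} (M N : {poly k}) (c : k) (q : nat).
Hypotheses (q_gt1 : (1 < q)%N) (sM : sep_poly q M) (sN : sep_poly q N) (c0 : c != 0).
Let F := product_curve M N c.
Implicit Types (G H P Q : {poly {poly k}}) (d : {poly k}).

Let q_gt0 : (0 < q)%N. Proof. exact: ltnW. Qed.
Let M0 : M != 0. Proof. by rewrite -size_poly_eq0 (proj1 sM). Qed.
Let N0 : N != 0. Proof. by rewrite -size_poly_eq0 (proj1 sN). Qed.

Lemma swap_product_curve : swapXY F = product_curve N M c.
Proof.
rewrite /F /product_curve rmorphD rmorphM /= swapXY_map_polyC !swapXY_polyC.
by rewrite map_polyC mulrC.
Qed.

Lemma bieval_product_curve (R : comNzRingType) (f : {rmorphism k -> R}) x y :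
  bieval f x y F = (map_poly f M).[x] * (map_poly f N).[y] + f c.
Proof.
by rewrite bievalD bievalM bieval_map bievalCC bievalC mulrC.
Qed.

Lemma size_product_curve : size F = q.+1.
Proof.
have szN : size (map_poly polyC N * M%:P) = q.+1.
  rewrite mulrC mul_polyC size_scale // size_map_inj_poly ?(proj1 sN) //.
  exact: polyC_inj.
by rewrite size_polyDl // szN ltnS (leq_trans (size_polyC_leq1 _)).
Qed.

Lemma lead_coef_product_curve : lead_coef F = lead_coef N *: M.
Proof.
rewrite /lead_coef size_product_curve (proj1 sN) /= coefD coefMC coef_map /= mul_polyC.
by rewrite coefC gtn_eqF // addr0.
Qed.

Lemma specialize_product_curve x0 : specialize x0 F = M.[x0] *: N + c%:P.
Proof.
apply/polyP => i; rewrite specialize_coef !coefD coefMC coef_map /= mul_polyC.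
rewrite hornerD hornerZ coefZ mulrC !coefC; case: eqP => _; by rewrite ?hornerC ?horner0.
Qed.

Lemma primitive2_product_curve : primitive2 F.
Proof.
move=> x0; rewrite specialize_product_curve.
have [->|Mx0] := eqVneq M.[x0] 0; first by rewrite scale0r add0r polyC_eq0.
rewrite -size_poly_eq0 size_polyDl ?size_scale // ?(proj1 sN) //.
by rewrite ltnS (leq_trans (size_polyC_leq1 _)).
Qed.

(* At a root of M the curve has no finite point, so both factors specialize to *)
(* constants and both leading coefficients vanish there.                       *)
Lemma product_curve_irreducible P Q : F = P * Q -> (size P <= 1)%N \/ (size Q <= 1)%N.
Proof.
move=> E; have [sP|sP] := leqP (size P) 1; [by left | right].
have [//|sQ] := leqP (size Q) 1.
have [s [us szs rs]] := sep_poly_roots sM.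
have F0 : P * Q != 0 by rewrite -E -size_poly_eq0 size_product_curve.
have [P0 Q0] : P != 0 /\ Q != 0.
  by move: F0; rewrite mulf_eq0 negb_or => /andP.
have key x0 : x0 \in s -> (lead_coef P).[x0] = 0 /\ (lead_coef Q).[x0] = 0.
  rewrite rs => /eqP x0s.
  have := specialize_product_curve x0; rewrite x0s scale0r add0r E specializeM => E0.
  have /andP[PP QQ] : (size (specialize x0 P) == 1%N) && (size (specialize x0 Q) == 1%N).
    by rewrite -size_mul_eq1 E0 size_polyC c0.
  rewrite /lead_coef -!specialize_coef; split.
    by rewrite nth_default // (eqP PP) -ltnS (ltn_predK sP).
  by rewrite nth_default // (eqP QQ) -ltnS (ltn_predK sQ).
have dvd (R : {poly k}) : R != 0 -> {in s, forall x0, R.[x0] = 0} -> (q < size R)%N.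
  move=> R0 Rs; rewrite ltnNge -szs; apply: contraNN R0 => sR.
  by apply/eqP; apply: (poly_eq0_many_roots us).
have lP : (q < size (lead_coef P))%N.
  by apply: dvd; rewrite ?lead_coef_eq0 // => x /key[].
have lQ : (q < size (lead_coef Q))%N.
  by apply: dvd; rewrite ?lead_coef_eq0 // => x /key[].
(* Each leading coefficient has degree at least q in X, but their product is a multiple of M by a
   constant, of degree q. *)
have : size (lead_coef P * lead_coef Q) = q.+1.
  by rewrite -lead_coefM -E lead_coef_product_curve size_scale ?lead_coef_eq0 ?(proj1 sM).
rewrite size_mul ?lead_coef_eq0 //.
move: (size _) (size _) lP lQ => i j; clear -q_gt0; lia.
Qed.

(** Euclid's algorithm over k(X). By irreducibility the primitive part of gcd(F, G) is either F up
    to a factor in k[X], and then Gauss's lemma applies, or free of Y, and then clearing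
    denominators in a Bezout relation leaves a nonzero element of k[X]. *)
Lemma dvd_or_bezout G :
  (exists Q, G = Q * F) \/ (exists u v d, d != 0 /\ u * F + v * G = d%:P).
Proof.
have F0 : F != 0 by rewrite -size_poly_eq0 size_product_curve.
have pF := primitive2_product_curve.
have H0 : gcdp F G != 0 by rewrite gcdp_eq0 (negPf F0).
have [e [H' [e0 pH' EH]]] := primitive2_part H0.
have /Pdiv.WeakIdomain.dvdpP[[c1 Q] /= c10 E1] : H' %| F.
  have := dvdp_gcdl F G; rewrite EH dvdpZl //.
have [Q' EQ'] := primitive2_cancel pH' c10 E1.
have [sQ|sH] := product_curve_irreducible EQ'.
  left; have /Pdiv.WeakIdomain.dvdpP[[c2 Q2] /= c20 E2] : F %| G.
    apply: (dvdp_trans _ (dvdp_gcdr F G)); rewrite EH dvdpZr //.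
    rewrite EQ' (size1_polyC sQ) mul_polyC dvdpZl ?dvdpp //.
    apply: contraNneq F0 => Q00.
    by rewrite EQ' (size1_polyC sQ) Q00 mul0r.
  exact: primitive2_cancel pF c20 E2.
right; have [[u v] /= /eqpP[[c1' c2'] /= /andP[c1'0 c2'0] E3]] := Bezoutp F G.
exists (c1' *: u), (c1' *: v), (c2' * (e * H'`_0)); split.
  rewrite !mulf_neq0 //; apply: contraNneq H0 => H'0.
  by rewrite EH (size1_polyC sH) H'0 scaler0.
rewrite -!scalerAl -scalerDr E3 EH {1}(size1_polyC sH) scalerA.
by rewrite -mul_polyC -polyCM mulrA.
Qed.

(** In the Bezout case d H = u F H + v G H is a multiple of F, and primitivity cancels d. *)
Lemma product_curve_prime G H : (exists Q, G * H = Q * F) ->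
  (exists Q, G = Q * F) \/ (exists Q, H = Q * F).
Proof.
move=> [Q E]; have [|[u [v [d [d0 Ed]]]]] := dvd_or_bezout G; [by left | right].
apply: (primitive2_cancel primitive2_product_curve d0 (Q := u * H + v * Q)).
by rewrite -mul_polyC -Ed !mulrDl -!mulrA E; congr (_ + _); rewrite [F * H]mulrC.
Qed.

End ProductCurve.

(** * Integral functions on the curve M(x) N(y) + c = 0 *)

Lemma divff_cancel (F : fieldType) (u a b : F) : u != 0 -> (u * a) / (b * u) = a / b.
Proof. by move=> u0; rewrite (mulrC b) -mulf_div divff // mul1r. Qed.

Definition degXY_le (k : nzRingType) (m n : nat) (P : {poly {poly k}}) :=
  (sizeY P <= m.+1)%N && (size P <= n.+1)%N.

(** A generic point of the curve with values in E. The two polynomials are kept apart because a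
    translation adds different constants to the two copies of L, and because x and y get
    exchanged. *)
Record generic_point (k E : fieldType) (f : {rmorphism k -> E}) (M N : {poly k})
    (c : k) (q : nat) (x y : E) : Prop := GenericPoint {
  gp_gt1 : (1 < q)%N;
  gp_sepl : sep_poly q M;
  gp_sepr : sep_poly q N;
  gp_neq0 : c != 0;
  gp_transc : forall P : {poly k}, (map_poly f P).[x] = 0 -> P = 0;
  gp_curve : (map_poly f M).[x] * (map_poly f N).[y] + f c = 0 }.

Section GenericPointTheory.
Context {k : closedFieldType} {E : fieldType} (f : {rmorphism k -> E}).
Context (M N : {poly k}) (c : k) (q : nat) (x y : E).
Hypothesis pt : generic_point f M N c q x y.
Let q_gt1 := gp_gt1 pt.
Let sM := gp_sepl pt.
Let sN := gp_sepr pt.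
Let c0 := gp_neq0 pt.
Let x_transc := gp_transc pt.
Let xy_curve := gp_curve pt.
Let F := product_curve M N c.
Let q_gt0 : (0 < q)%N. Proof. exact: ltnW. Qed.
Local Notation ev := (bieval f x y).
Implicit Types (P Q : {poly {poly k}}) (D : {poly k}) (z : E).

Lemma bieval_curve0 : ev F = 0.
Proof. by rewrite bieval_product_curve. Qed.

(** Otherwise Bezout would give a nonzero d with d(x) = 0, against the transcendence of x. *)
Lemma bieval_eq0 P : ev P = 0 -> exists Q, P = Q * F.
Proof.
have [//|[u [v [d [d0 Ed]]]] P0] := dvd_or_bezout q_gt1 sM sN c0 P.
have : ev d%:P = 0.
  by rewrite -Ed bievalD !bievalM P0 bieval_curve0 !mulr0 addr0.
by rewrite bievalC => /x_transc d00; rewrite d00 eqxx in d0.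
Qed.

Lemma y_transc D : (map_poly f D).[y] = 0 -> D = 0.
Proof.
rewrite -(bieval_map f x) => /bieval_eq0[Q ED].
have sPC : sizeY (map_poly polyC D) = nat_of_bool (D != 0).
  by rewrite sizeYE swapXY_map_polyC size_polyC.
have sF : sizeY F = q.+1.
  by rewrite sizeYE swap_product_curve (size_product_curve _ q_gt1 sN sM).
apply/eqP; apply: contraT => D0; move: sPC; rewrite D0 ED.
have Q0 : Q != 0.
  by apply: contraNneq D0 => Q0; rewrite -polyC_eq0 -swapXY_map_polyC ED Q0 mul0r swapXY_eq0.
have F0 : F != 0 by rewrite -sizeY_eq0 sF.
rewrite sizeYE rmorphM /= size_mul ?swapXY_eq0 // -!sizeYE sF.
have : (0 < sizeY Q)%N by rewrite lt0n sizeY_eq0.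
by move: (sizeY Q) => i; clear -q_gt1; lia.
Qed.

Lemma specialize_finite P x0 y0 : ev P = 0 -> M.[x0] * N.[y0] + c = 0 ->
  (specialize x0 P).[y0] = 0.
Proof.
move=> /bieval_eq0[Q ->] E0; rewrite specializeM hornerM.
by rewrite specialize_product_curve !hornerE E0 mulr0.
Qed.

(** Evaluation of P / Y^n at the point (x0, inf): the leading coefficient in Y of a multiple of F is
    a multiple of that of F, hence of M. *)
Lemma specialize_infY P n x0 : ev P = 0 -> (size P <= n.+1)%N -> M.[x0] = 0 ->
  (P`_n).[x0] = 0.
Proof.
move=> /bieval_eq0[Q EP] sP Mx0.
have [sP'|sP'] := ltnP n (size P); last by rewrite nth_default ?horner0.
have -> : P`_n = lead_coef P by rewrite /lead_coef; congr (P`_ _); move: sP sP'; move: (size P); lia.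
by rewrite EP lead_coefM (lead_coef_product_curve c q_gt1 sM sN) hornerM hornerZ Mx0 !mulr0.
Qed.

Lemma bieval_small P : (size P <= q)%N -> ev P = 0 -> P = 0.
Proof.
move=> sP /bieval_eq0[Q EP]; apply/eqP; apply: contraTT sP => P0.
have Q0 : Q != 0 by apply: contraNneq P0 => Q0; rewrite EP Q0 mul0r.
have F0 : F != 0 by apply: contraNneq P0 => F0; rewrite EP F0 mulr0.
rewrite -ltnNge EP size_mul // (size_product_curve _ q_gt1 sM sN).
have : (0 < size Q)%N by rewrite size_poly_gt0.
by move: (size Q); lia.
Qed.

Lemma generic_point_swap : generic_point f N M c q y x.
Proof. by split=> //; [exact: y_transc | rewrite mulrC]. Qed.

End GenericPointTheory.

Section GenericPointSwap.
Context {k : closedFieldType} {E : fieldType} (f : {rmorphism k -> E}).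
Context (M N : {poly k}) (c : k) (q : nat) (x y : E).
Hypothesis pt : generic_point f M N c q x y.
Let q_gt1 := gp_gt1 pt.
Let sM := gp_sepl pt.
Let sN := gp_sepr pt.
Let c0 := gp_neq0 pt.
Let x_transc := gp_transc pt.
Let xy_curve := gp_curve pt.
Let F := product_curve M N c.
Let q_gt0 : (0 < q)%N. Proof. exact: ltnW. Qed.
Local Notation ev := (bieval f x y).
Implicit Types (P Q : {poly {poly k}}) (D : {poly k}) (z : E).

(* z has at most the poles of xy on the closure of the curve in P^1 x P^1. *)
Definition integral_section (z : E) := exists n (b : nat -> {poly {poly k}}),
  (forall i, (i < n)%N -> degXY_le (n - i) (n - i) (b i)) /\
  z ^+ n = \sum_(i < n) ev (b i) * z ^+ i.

(* z = P(x,y) / D(x): a zero of D away from the roots of M would be a pole of *)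
(* z at a finite point of the curve.                                          *)
Lemma integral_cancel_denominator z P D x0 : integral_section z ->
  (size P <= q)%N -> ev D%:P != 0 -> z = ev P / ev D%:P ->
  D.[x0] = 0 -> M.[x0] != 0 -> specialize x0 P = 0.
Proof.
move=> [n [b [_ zn]]] sP D0 Ez Dx0 Mx0.
have sN' : sep_poly q (N + (c / M.[x0])%:P) by apply: sep_polyD.
have [s [us ss rs]] := sep_poly_roots sN'.
apply: (poly_eq0_many_roots us); first by rewrite ss (leq_trans (size_poly _ _)).
move=> y0; rewrite rs => /eqP; rewrite hornerD hornerC => Ny0.
have C0 : M.[x0] * N.[y0] + c = 0.
  by rewrite -[N.[y0]](addrK (c / M.[x0])) Ny0 sub0r mulrN mulrCA divff // mulr1 addNr.
(* The integral equation of z multiplied by D^n; above a zero of D only P^n survives. So P(x0, Y),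
   of degree below q, vanishes at the q points above x0. *)
pose G : {poly {poly k}} := P ^+ n - \sum_(i < n) b i * P ^+ i * D%:P ^+ (n - i).
have : (specialize x0 G).[y0] = 0.
  apply: (specialize_finite pt) C0.
  rewrite bievalB bievalXn bieval_sum.
  have EP : ev P = z * ev D%:P by rewrite Ez divfK.
  rewrite EP exprMn zn mulr_suml; apply/eqP; rewrite subr_eq0; apply/eqP.
  apply: eq_bigr => i _; rewrite !bievalM !bievalXn EP exprMn -!mulrA.
  by rewrite -exprD subnKC // ltnW.
rewrite specializeB specializeXn specialize_sum hornerD hornerN horner_exp big1 ?horner0 ?subr0.
  by move/eqP; rewrite expf_eq0 => /andP[_ /eqP].
by move=> i _; rewrite !specializeM !specializeXn specializeC Dx0 expr0n subn_eq0 leqNgt ltn_ord mulr0.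
Qed.

Hypothesis xy_gen : forall z, exists P Q, ev Q != 0 /\ z = ev P / ev Q.

(** A Bezout relation with F turns the denominator into a polynomial in x, and pseudo-division of
    the numerator by F brings its degree in y below q. *)
Lemma polynomial_denominator z :
  exists P D, [/\ (size P <= q)%N, ev D%:P != 0 & z = ev P / ev D%:P].
Proof.
have [P [Q [Q0 ->]]] := xy_gen z.
have [[Q' EQ]|[u [v [d [d0 Ed]]]]] := dvd_or_bezout q_gt1 sM sN c0 Q.
  by move: Q0; rewrite EQ bievalM (bieval_curve0 pt) mulr0 eqxx.
have Ed' : ev d%:P = ev v * ev Q.
  by rewrite -Ed bievalD !bievalM (bieval_curve0 pt) mulr0 add0r.
pose l := lead_coef F ^+ scalp (P * v) F.
have F0 : F != 0 by rewrite -size_poly_eq0 (size_product_curve _ q_gt1 sM sN).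
have evC0 (D : {poly k}) : D != 0 -> ev D%:P != 0.
  by rewrite bievalC; apply: contra_neq => /x_transc.
have ld0 : l * d != 0 by rewrite mulf_neq0 // expf_neq0 // lead_coef_eq0.
exists ((P * v) %% F), (l * d); split; last 2 first.
- exact: evC0.
- have := congr1 ev (Pdiv.Idomain.divp_eq (P * v) F).
  rewrite bievalD bievalM (bieval_curve0 pt) mulr0 add0r => <-.
  rewrite bievalZ -/l -(bievalC f x y) polyCM !bievalM Ed'.
  have v0 : ev v != 0.
    by apply: contraTneq (evC0 _ d0) => v0; rewrite Ed' v0 mul0r eqxx.
  have l0 : ev l%:P != 0 by apply: evC0; rewrite expf_neq0 // lead_coef_eq0.
  by field; rewrite Q0 v0 l0.
- by rewrite -ltnS -(size_product_curve c q_gt1 sM sN) ltn_modpN0.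
Qed.

(** M(x) N(y) = - c makes every factor x - x0 of M(x) a unit of k[x, y]. *)
Lemma ev_root_unit D : D != 0 -> (forall x0, D.[x0] = 0 -> M.[x0] = 0) ->
  exists G, ev G * ev D%:P = 1.
Proof.
have [n] := ubnP (size D); elim: n => // n IH in D *; rewrite ltnS => sD D0 DM.
have [sD1|sD1] := leqP (size D) 1.
  move: D0; rewrite (size1_polyC sD1) polyC_eq0 => D0.
  exists (D`_0)^-1%:P%:P.
  by rewrite !bievalCC -rmorphM mulVf // rmorph1.
have [x0 Dx0] := closed_root sD1.
have /dvdpP[D1 ED] : ('X - x0%:P) %| D by rewrite dvdp_XsubCl rootE Dx0.
have /dvdpP[M1 EM] : ('X - x0%:P) %| M by rewrite dvdp_XsubCl rootE DM.
have D10 : D1 != 0 by apply: contraNneq D0 => D10; rewrite ED D10 mul0r.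
have [||x1 D1x1|G EG] := IH D1 => //.
- by move: sD; rewrite ED size_Mmonic ?monicXsubC // size_XsubC addn2.
- by apply: DM; rewrite ED hornerM D1x1 mul0r.
exists (G * (- (c^-1)%:P%:P * M1%:P * map_poly polyC N)).
have hm (A B : {poly k}) :
  (map_poly f (A * B)).[x] = (map_poly f A).[x] * (map_poly f B).[x].
  by rewrite rmorphM hornerM.
have fc0 : f c != 0 by rewrite fmorph_eq0.
have := xy_curve; rewrite EM ED !bievalM bievalN bievalCC bieval_map.
move: EG; rewrite !bievalC !hm => EG /eqP; rewrite addr_eq0 fmorphV.
move: (_.[y]) (map_poly f M1).[x] (map_poly f ('X - _)).[x] (map_poly f D1).[x] EG.
move=> n' m' X' d' EG /eqP E0.
rewrite (_ : _ * _ = (ev G * d') * (- (m' * X' * n') / f c)); last by ring.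
by rewrite EG E0 opprK divff ?mulr1.
Qed.

(** Zeros of the denominator away from the roots of M cancel by integrality; the remaining
    denominator is a unit. *)
Lemma integral_section_poly z : integral_section z -> exists Q, z = ev Q.
Proof.
move=> iz; have [P [D [sP D0 Ez]]] := polynomial_denominator z.
suff [P' [D' [sP' D'0 Ez' D'M]]] : exists P' D', [/\ (size P' <= q)%N, ev D'%:P != 0,
    z = ev P' / ev D'%:P & forall x0, D'.[x0] = 0 -> M.[x0] = 0].
  have nD' : D' != 0 by apply: contraNneq D'0 => ->; rewrite bieval0.
  have [G EG] := ev_root_unit nD' D'M.
  exists (P' * G); rewrite Ez' bievalM; congr (_ * _).
  by rewrite -[RHS]mulr1 -(divff D'0) mulrA EG mul1r.
have [n] := ubnP (size D); elim: n => // n IH in D P D0 sP Ez *; rewrite ltnS => sD.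
have [H|] := pselect (forall x0, D.[x0] = 0 -> M.[x0] = 0); first by exists P, D.
move=> /existsNP[x0] /not_implyP[Dx0 /eqP Mx0].
have /specialize_eq0[P1 EP] := integral_cancel_denominator iz sP D0 Ez Dx0 Mx0.
have /dvdpP[D1 ED] : ('X - x0%:P) %| D by rewrite dvdp_XsubCl rootE Dx0.
move: D0; rewrite ED polyCM bievalM mulf_eq0 negb_or => /andP[D10 X0].
have nD1 : D1 != 0 by apply: contraNneq D10 => ->; rewrite bieval0.
apply: (IH D1 P1); first exact: D10.
- by move: sP; rewrite EP -mul_polyC mul_polyC size_scale // polyXsubC_eq0.
- rewrite Ez EP ED polyCM bievalM bievalZ -(bievalC f x y).
  exact: divff_cancel.
- by move: sD; rewrite ED size_Mmonic ?monicXsubC // size_XsubC addn2.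
Qed.

(** If Q has degree at least 2 in Y, then Q^n has larger Y-degree than each b_i Q^i, where b_i adds
    only n - i. Evaluating the equation at (x0, inf) thus kills the n-th power of the leading
    coefficient. *)
Lemma integral_section_lead Q x0 : integral_section (ev Q) -> (2 < size Q)%N ->
  M.[x0] = 0 -> (lead_coef Q).[x0] = 0.
Proof.
move=> [n [b [hb En]]] sQ Mx0.
pose R := \sum_(i < n) b i * Q ^+ i.
pose d := ((size Q).-1 * n)%N.
have sR : (size R <= d)%N.
  apply: (leq_trans (size_sum _ _ _)); apply/bigmax_leqP => i _.
  apply: (leq_trans (size_polyMleq _ _)).
  have /andP[_ sb] := hb _ (ltn_ord i).
  have sQi : (size (Q ^+ i) <= ((size Q).-1 * i).+1)%N by exact: size_poly_exp_leq.
  move: sb sQi sQ; rewrite /d; move: (size (b i)) (size (Q ^+ i)) (size Q) (ltn_ord i).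
  move=> u v w; move: (nat_of_ord i) => j; nia.
have : ((Q ^+ n - R)`_d).[x0] = 0.
  apply: (specialize_infY pt _ _ Mx0).
    rewrite bievalB bievalXn bieval_sum En; apply/eqP; rewrite subr_eq0; apply/eqP.
    by apply: eq_bigr => i _; rewrite bievalM bievalXn.
  rewrite (leq_trans (size_polyD _ _)) // size_polyN geq_max (leq_trans sR) // andbT.
  exact: size_poly_exp_leq.
rewrite coefB [R`_d]nth_default // subr0.
have -> : (Q ^+ n)`_d = lead_coef Q ^+ n.
  by rewrite -lead_coef_exp /lead_coef size_exp.
by rewrite horner_exp => /eqP; rewrite expf_eq0 => /andP[_ /eqP].
Qed.

End GenericPointSwap.

Lemma size_subl_lead (R : nzRingType) (A B : {poly R}) : A != 0 ->
  size A = size B -> lead_coef A = lead_coef B -> (size (A - B)%R < size A)%N.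
Proof.
move=> A0 sAB lAB; have sA : (0 < size A)%N by rewrite size_poly_gt0.
rewrite -(prednK sA) ltnS; apply/leq_sizeP => j; rewrite leq_eqVlt => /orP[/eqP <-|sj].
  by rewrite coefB; move: lAB; rewrite /lead_coef -sAB => ->; rewrite subrr.
by rewrite coefB !nth_default ?subr0 -?sAB // -(prednK sA).
Qed.

Lemma poly_size2 (R : nzRingType) (P : {poly R}) :
  (size P <= 2)%N -> P = (P`_0)%:P + P`_1 *: 'X.
Proof.
move=> sP; apply/polyP => -[|[|i]]; rewrite coefD coefC coefZ coefX /=.
- by rewrite mulr0 addr0.
- by rewrite mulr1 add0r.
- by rewrite mulr0 addr0 nth_default // (leq_trans sP).
Qed.

Lemma bieval_bilinear (k R : comNzRingType) (f : {rmorphism k -> R}) x y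
    (Q : {poly {poly k}}) : degXY_le 1 1 Q ->
  bieval f x y Q = f Q`_0`_0 + f Q`_0`_1 * x + f Q`_1`_0 * y + f Q`_1`_1 * (x * y).
Proof.
case/andP=> sYQ sQ; have sz i : (size (Q`_i)%R <= 2)%N.
  exact: leq_trans (max_size_coefXY _ _) sYQ.
have E i : (map_poly f Q`_i).[x] = f Q`_i`_0 + f Q`_i`_1 * x.
  by rewrite {1}(poly_size2 (sz i)) rmorphD /= map_polyC map_polyZ map_polyX !hornerE.
rewrite {1}(poly_size2 sQ) bievalD bievalC bievalZ bievalX !E; ring.
Qed.

Section Bilinear.
Context {k : closedFieldType} {E : fieldType} (f : {rmorphism k -> E}).
Context (M N : {poly k}) (c : k) (q : nat).
Implicit Types (P Q : {poly {poly k}}) (x y z : E).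

Lemma integral_section_swap x y z : integral_section f x y z -> integral_section f y x z.
Proof.
move=> [n [b [hb zn]]]; exists n, (swapXY \o b); split=> [i /hb|].
  by rewrite /degXY_le /= [sizeY (swapXY _)]sizeYE swapXYK -sizeYE andbC.
by rewrite zn; apply: eq_bigr => i _; rewrite /= bieval_swap.
Qed.

(** Induction on the degree in Y. If the bidegree exceeds (1, 1), the vanishing of one leading
    coefficient at q roots makes the other degree at least q > 1, so that finally the Y-degree is at
    least q and the leading coefficient in Y is a multiple of M; subtracting a multiple of F lowers
    the degree. *)
Lemma integral_section_bilinear x y z : generic_point f M N c q x y ->
  (forall z, exists P Q, bieval f x y Q != 0 /\ z = bieval f x y P / bieval f x y Q) ->
  integral_section f x y z ->
  exists a b d e : k, z = f a + f b * x + f d * y + f e * (x * y).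
Proof.
move=> pt xy_gen iz; have [Q Ez] := integral_section_poly pt xy_gen iz.
have [q_gt1 sM sN c0 _ _] := pt; have q_gt0 := ltnW q_gt1.
have [n] := ubnP (size Q); elim: n => // n IH in Q Ez *; rewrite ltnS => sQn.
have [sQ|sQ] := boolP (degXY_le 1 1 Q).
  by exists Q`_0`_0, Q`_0`_1, Q`_1`_0, Q`_1`_1; rewrite Ez bieval_bilinear.
have [sm [usm ssm rsm]] := sep_poly_roots sM.
have [sn [usn ssn rsn]] := sep_poly_roots sN.
have lead_large (P : {poly {poly k}}) (s : seq k) : uniq s -> size s = q -> P != 0 ->
    {in s, forall x0 : k, (lead_coef P).[x0] = 0} -> (q < sizeY P)%N.
  move=> us ss P0 Ps; apply: leq_trans (max_size_lead_coefXY P).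
  rewrite ltnNge -ss; apply: contraNN P0 => sP.
  by rewrite -lead_coef_eq0; apply/eqP; apply: (poly_eq0_many_roots us).
have Q0 : Q != 0 by apply: contraNneq sQ => ->; rewrite /degXY_le sizeYE rmorph0 !size_poly0.
have leadY : (2 < size Q)%N -> {in sm, forall x0 : k, (lead_coef Q).[x0] = 0}.
  move=> sQ2 x0; rewrite rsm => /eqP Mx0.
  by apply: (integral_section_lead pt _ sQ2 Mx0); rewrite -Ez.
have leadX : (2 < sizeY Q)%N -> {in sn, forall y0 : k, (lead_coef (swapXY Q)).[y0] = 0}.
  rewrite sizeYE => sQ2 y0; rewrite rsn => /eqP Ny0.
  apply: (integral_section_lead (generic_point_swap pt) _ sQ2 Ny0).
  by rewrite bieval_swap -Ez; apply: integral_section_swap.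
have sQq : (q < size Q)%N.
  have H : (2 < sizeY Q)%N -> (q < size Q)%N.
    move=> /leadX /(lead_large _ _ usn ssn).
    by rewrite swapXY_eq0 => /(_ Q0); rewrite sizeYE swapXYK.
  move: sQ; rewrite /degXY_le negb_and -!ltnNge => /orP[/H //|sQ2].
  apply: H; apply: leq_ltn_trans q_gt1 _.
  exact: lead_large usm ssm Q0 (leadY sQ2).
have [w Ew] : exists w, lead_coef Q = w * M.
  apply: (dvdp_many_roots usm); first by rewrite ssm (proj1 sM).
    by move=> x0; rewrite rsm => /eqP.
  exact: leadY (leq_ltn_trans q_gt1 sQq).
pose F := product_curve M N c.
have lN0 : lead_coef N != 0 by rewrite lead_coef_eq0 -size_poly_eq0 (proj1 sN).
have lQ0 : lead_coef Q != 0 by rewrite lead_coef_eq0.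
have w0 : (lead_coef N)^-1 *: w != 0.
  rewrite scaler_eq0 invr_eq0 negb_or lN0.
  by apply: contraNneq lQ0 => w0; rewrite Ew w0 mul0r.
(* The multiple of F with the leading term of Q, since F has leading coefficient lead_coef(N) M and
   degree q. *)
pose T : {poly {poly k}} := ((lead_coef N)^-1 *: w) *: 'X^(size Q - q.+1) * F.
have lT : lead_coef T = lead_coef Q.
  rewrite lead_coefM lead_coefZ lead_coefXn mulr1 (lead_coef_product_curve c q_gt1 sM sN).
  by rewrite -scalerAl -scalerAr scalerA mulVf // scale1r Ew.
have sT : size T = size Q.
  have F0 : F != 0 by rewrite -size_poly_eq0 (size_product_curve _ q_gt1 sM sN).
  rewrite /T -mul_polyC size_mul ?mulf_neq0 ?polyC_eq0 ?(monic_neq0 (monicXn _ _)) //.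
  rewrite mul_polyC size_scale // size_polyXn (size_product_curve _ q_gt1 sM sN).
  by move: (size Q) sQq => s; clear; lia.
apply: (IH (Q - T)).
  by rewrite bievalB bievalM (bieval_curve0 pt) mulr0 subr0.
by rewrite (leq_trans _ sQn) // size_subl_lead.
Qed.

End Bilinear.

(** * Orbits and degrees over the field of a projection *)

Lemma eq_bieval (k R : comNzRingType) (f g : {rmorphism k -> R}) x y :
  f =1 g -> bieval f x y =1 bieval g x y.
Proof.
move=> fg P; rewrite !bieval_coef; apply: eq_bigr => i _; congr (_ * _).
by congr (_.[_]); apply: eq_map_poly.
Qed.

Notation biC k := (polyC \o polyC : {rmorphism k -> {poly {poly k}}}).

Lemma bieval_id (k : comNzRingType) (P : {poly {poly k}}) :
  bieval (biC k) 'X%:P 'X P = P.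
Proof.
rewrite bieval_coef -[RHS]coefK poly_def; apply: eq_bigr => i _.
rewrite -mul_polyC; congr (_ * _).
rewrite -[in RHS](comp_polyXr P`_i) /comp_poly -(horner_map polyC) /=.
by rewrite -map_poly_comp.
Qed.

Lemma bieval_bieval (k R : comNzRingType) (f : {rmorphism k -> R}) (x y : R)
    (U V P : {poly {poly k}}) :
  bieval f x y (bieval (biC k) U V P) = bieval f (bieval f x y U) (bieval f x y V) P.
Proof.
rewrite (rmorph_bieval (biC k) (bieval f x y)); apply: eq_bieval => a /=.
exact: bievalCC.
Qed.

Section RationalFunctions.
Context {k E : fieldType} (f : {rmorphism k -> E}) (t : E).

Definition ratfun : {pred E} := fun a => `[< exists g h : {poly k},
  (map_poly f h).[t] != 0 /\ a = (map_poly f g).[t] / (map_poly f h).[t] >].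

Lemma ratfunP a : reflect (exists g h : {poly k},
  (map_poly f h).[t] != 0 /\ a = (map_poly f g).[t] / (map_poly f h).[t]) (a \in ratfun).
Proof. exact: asboolP. Qed.

Lemma ratfun_divring_closed : divring_closed ratfun.
Proof.
split.
- by apply/ratfunP; exists 1, 1; rewrite rmorph1 hornerC oner_neq0 divr1.
- move=> _ _ /ratfunP[g [h [h0 ->]]] /ratfunP[g' [h' [h'0 ->]]].
  apply/ratfunP; exists (g * h' - g' * h), (h * h').
  rewrite rmorphB !rmorphM !hornerE mulf_neq0 //; split=> //.
  by rewrite -[in LHS]mulNr GRing.addf_div // mulNr.
- move=> _ _ /ratfunP[g [h [h0 ->]]] /ratfunP[g' [h' [h'0 ->]]].
  have [g'0|ng'] := eqVneq (map_poly f g').[t] 0.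
    by apply/ratfunP; exists 0, 1; rewrite g'0 mul0r invr0 mulr0 rmorph0 rmorph1 !hornerC mul0r oner_neq0.
  apply/ratfunP; exists (g * h'), (h * g').
  by rewrite !rmorphM !hornerM mulf_neq0 // invf_div mulf_div.
Qed.

HB.instance Definition _ := GRing.isDivringClosed.Build E ratfun ratfun_divring_closed.

Lemma ratfun_const a : f a \in ratfun.
Proof.
by apply/ratfunP; exists a%:P, 1; rewrite rmorph1 map_polyC !hornerC oner_neq0 divr1.
Qed.

Lemma ratfun_gen : t \in ratfun.
Proof.
by apply/ratfunP; exists 'X, 1; rewrite rmorph1 map_polyX hornerX hornerC oner_neq0 divr1.
Qed.

Lemma ratfun_poly (g : {poly k}) : (map_poly f g).[t] \in ratfun.
Proof. by apply/ratfunP; exists g, 1; rewrite rmorph1 hornerC oner_neq0 divr1. Qed.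

Lemma ratfun_clear_denominators (P : {poly E}) : (forall i, P`_i \in ratfun) ->
  exists (h : {poly k}) (H : {poly {poly k}}), [/\ (map_poly f h).[t] != 0,
    (size H <= size P)%N & map_poly (horner_eval t \o map_poly f) H
      = (map_poly f h).[t] *: P].
Proof.
move=> PK; suff [h [H [h0 EH]]] : exists (h : {poly k}) (H : {poly {poly k}}),
    (map_poly f h).[t] != 0 /\
    map_poly (horner_eval t \o map_poly f) H = (map_poly f h).[t] *: P.
  exists h, (\poly_(i < size P) H`_i); split=> //.
  apply/polyP => i; rewrite coef_map coef_poly.
  case: ltnP => [_|sP]; first by rewrite -EH coef_map.
  by rewrite /= rmorph0 /horner_eval horner0 coefZ nth_default ?mulr0.
elim/poly_ind: P PK => [|P a IH] PK.
  by exists 1, 0; rewrite rmorph1 hornerC oner_neq0 rmorph0 scaler0.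
have [i|h [H [h0 EH]]] := IH.
  by have := PK i.+1; rewrite coefD coefMX coefC addr0.
have := PK 0%N; rewrite coefD coefMX coefC add0r => /ratfunP[g [h' [h'0 Ea]]].
exists (h * h'), (h'%:P * H * 'X + (h * g)%:P); split.
  by rewrite rmorphM hornerM mulf_neq0.
rewrite rmorphD !rmorphM /= EH map_polyX !map_polyC /= /horner_eval.
rewrite ?rmorphM /= ?hornerM Ea -!mul_polyC mulrDr; congr (_ + _).
  by rewrite polyCM; ring.
by rewrite -!polyCM; congr _%:P; field.
Qed.

Lemma ratfun_degree (x : E) n :
  (forall H : {poly {poly k}}, H != 0 -> bieval f t x H = 0 -> (n < size H)%N) ->
  forall P : {poly E}, P != 0 -> (forall i, P`_i \in ratfun) -> P.[x] = 0 ->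
    (n < size P)%N.
Proof.
move=> Hn P P0 PK Px; have [h [H [h0 sH EH]]] := ratfun_clear_denominators PK.
apply: leq_trans sH; apply: Hn.
  by apply: contraNneq P0 => H0; move/eqP: EH; rewrite H0 rmorph0 eq_sym scaler_eq0 (negPf h0).
by rewrite /bieval /= EH /horner_eval hornerZ Px mulr0.
Qed.

End RationalFunctions.

(** The product of X - z over the orbit of x is permuted into itself by the group, so its
    coefficients lie in K and its degree is at least that of x over K. *)
Lemma orbit_size (E : fieldType) (T : finType) (s : T -> {rmorphism E -> E})
    (K : {pred E}) (x : E) n :
  (forall g h, exists l, s l =1 s g \o s h) -> (exists e, s e =1 id) ->
  (forall z, (forall g, s g z = z) -> z \in K) ->
  (forall P : {poly E}, P != 0 -> (forall i, P`_i \in K) -> P.[x] = 0 -> (n < size P)%N) ->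
  forall l : seq E, (forall g, s g x \in l) -> (n <= size l)%N.
Proof.
move=> sM [e se] sK degx l xl.
pose o : seq E := undup [seq s g x | g <- enum T].
have mo g : s g x \in o by rewrite mem_undup; apply/mapP; exists g; rewrite ?mem_enum.
apply: (@leq_trans (size o)); last first.
  apply: uniq_leq_size (undup_uniq _) _ => z; rewrite mem_undup => /mapP[g _ ->].
  exact: xl.
pose P : {poly E} := \prod_(z <- o) ('X - z%:P).
rewrite -ltnS -(size_prod_XsubC o id) -/P; apply: degx.
- by rewrite monic_neq0 // monic_prod_XsubC.
- move=> i; apply: sK => g; rewrite -coef_map; congr (_`_ _).
  rewrite rmorph_prod /=.
  under eq_bigr do rewrite rmorphB /= map_polyX map_polyC /=.
  rewrite -(big_map (s g) xpredT (fun z => 'X - z%:P)) /P /=.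
  rewrite (perm_big o) //.
  have us : uniq (map (s g) o) by rewrite map_inj_uniq ?undup_uniq //; exact: fmorph_inj.
  apply: uniq_perm (undup_uniq _) _ => //.
  apply: (uniq_min_size us _ _).2; last by rewrite size_map.
  move=> _ /mapP[z + ->]; rewrite mem_undup => /mapP[h _ ->].
  by have [j Ej] := sM g h; have := mo j; rewrite Ej.
- by apply/rootP; rewrite root_prod_XsubC; have := mo e; rewrite se.
Qed.

Section Degree.
Context {k : closedFieldType} {E : fieldType} (f : {rmorphism k -> E}).
Context (M N : {poly k}) (c : k) (q : nat) (x y : E).
Hypothesis pt : generic_point f M N c q x y.
Let q_gt1 := gp_gt1 pt.
Let sM := gp_sepl pt.
Let sN := gp_sepr pt.
Let F := product_curve M N c.

(** F restricted to a line of a pencil: x becomes the outer variable, the parameter t the inner one,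
    and y = W has degree 1 in x. *)
Lemma size_pencil (W : {poly {poly k}}) : size W = 2 ->
  size (bieval (biC k) 'X W F) = (2 * q).+1.
Proof.
move=> sW; rewrite bieval_product_curve [map_poly _ M]map_poly_comp.
rewrite [map_poly _ N]map_poly_comp -[(map_poly polyC _).['X]]/(_ \Po 'X).
rewrite -[(map_poly polyC _).[W]]/(_ \Po W) comp_polyXr.
have sC P : size (map_poly (@polyC k) P) = size P.
  by rewrite size_map_inj_poly //; exact: polyC_inj.
have sz0 (P : {poly {poly k}}) : size P = q.+1 -> P != 0.
  by rewrite -size_poly_eq0 => ->.
have sNW : size (map_poly polyC N \Po W) = q.+1.
  by rewrite size_comp_poly2 // sC (proj1 sN).
have sMN : size (map_poly polyC M * (map_poly polyC N \Po W)) = (2 * q).+1.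
  rewrite size_mul ?sz0 // ?sC ?sNW (proj1 sM) //; lia.
rewrite size_polyDl // sMN ltnS (leq_trans (size_polyC_leq1 _)) //; move: q_gt1; lia.
Qed.

(** H(y - m x, x) is a multiple of F; the inverse substitution y = t + m x makes H a multiple of
    F(x, t + m x), of degree 2q in x. *)
Lemma degree_parallel (m : k) (H : {poly {poly k}}) : m != 0 -> H != 0 ->
  bieval f (y - f m * x) x H = 0 -> (2 * q < size H)%N.
Proof.
move=> m0 H0 E0; pose P := bieval (biC k) ('X - m%:P *: 'X%:P) 'X%:P H.
have /(bieval_eq0 pt)[Q EP] : bieval f x y P = 0.
  rewrite bieval_bieval bievalB bievalX bievalZ bievalC map_polyX map_polyC !hornerE.
  exact: E0.
pose W : {poly {poly k}} := 'X%:P + m%:P *: 'X.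
have sW : size W = 2.
  rewrite /W addrC size_polyDl ?size_scale ?polyC_eq0 ?size_polyX //.
  by rewrite ltnS size_polyC_leq1.
have EH : H = bieval (biC k) 'X W Q * bieval (biC k) 'X W F.
  rewrite -bievalM -EP bieval_bieval -[LHS]bieval_id; congr bieval.
    rewrite bievalB bievalX bievalZ bievalC map_polyX map_polyC !hornerE /W.
    by rewrite mul_polyC addrK.
  by rewrite bievalC map_polyX hornerX.
have := H0; rewrite EH mulf_eq0 negb_or => /andP[Q0 F0].
rewrite size_mul // size_pencil // addnS /=.
have : (0 < size (bieval (biC k) 'X W Q))%N by rewrite size_poly_gt0.
by move: (size _); lia.
Qed.

(** As in the parallel case, except that a power x^n is needed to clear the denominators of y / x;
    it is removed afterwards because the origin is not on the curve. *)
Lemma degree_concurrent (H : {poly {poly k}}) : M.[0] * N.[0] + c != 0 -> H != 0 ->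
  bieval f (y / x) x H = 0 -> (2 * q < size H)%N.
Proof.
move=> c00 H0 E0; pose n := sizeY H.
have x0 : x != 0.
  by apply/eqP => x0; have := gp_transc pt (P := 'X); rewrite map_polyX hornerX => /(_ x0)/eqP; rewrite polyX_eq0.
pose P : {poly {poly k}} := \sum_(i < size H) \sum_(j < n)
  (H`_i`_j)%:P%:P * 'X%:P ^+ (n - j + i) * 'X ^+ j.
have /(bieval_eq0 pt)[Q EP] : bieval f x y P = 0.
  suff -> : bieval f x y P = x ^+ n * bieval f (y / x) x H by rewrite E0 mulr0.
  rewrite bieval_sum bieval_coef mulr_sumr; apply: eq_bigr => i _.
  have sHi : (size (H`_i)%R <= n)%N by exact: max_size_coefXY.
  rewrite bieval_sum (@horner_coef_wide _ n); last first.
    by rewrite (leq_trans (size_poly _ _)).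
  rewrite mulr_suml mulr_sumr; apply: eq_bigr => j _.
  rewrite !bievalM !bievalXn bievalCC bievalX bievalC map_polyX hornerX coef_map /=.
  move: (ltn_ord j); move: (nat_of_ord j) => {}j jn.
  rewrite exprD expr_div_n -[in RHS](subnK (ltnW jn)) exprD.
  by field; rewrite expf_neq0.
pose W : {poly {poly k}} := 'X *: 'X.
have sW : size W = 2 by rewrite size_scale ?polyX_eq0 // size_polyX.
have EH : 'X ^+ n * H = bieval (biC k) 'X W Q * bieval (biC k) 'X W F.
  rewrite -bievalM -EP bieval_sum -[in LHS](bieval_id H) bieval_coef mulr_sumr.
  apply: eq_bigr => i _.
  have sHi : (size (H`_i)%R <= n)%N by exact: max_size_coefXY.
  rewrite bieval_sum (@horner_coef_wide _ n); last first.
    by rewrite (leq_trans (size_poly _ _)).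
  rewrite mulr_suml mulr_sumr; apply: eq_bigr => j _.
  rewrite !bievalM !bievalXn bievalCC bievalX bievalC map_polyX hornerX coef_map /=.
  move: (ltn_ord j); move: (nat_of_ord j) => {}j jn.
  rewrite /W -mul_polyC exprMn -[in LHS](subnK (ltnW jn)) !exprD.
  ring.
(* At x = 0 the polynomial F(x, t x) takes the value M(0) N(0) + c, which is nonzero. *)
have cop : coprimep (bieval (biC k) 'X W F) ('X ^+ n).
  rewrite coprimep_expr // coprimepX rootE bieval_product_curve.
  have W0 : W.[0] = 0 by rewrite /W !hornerE.
  have ev0 (P1 : {poly k}) U : U.[0] = 0 -> (map_poly (biC k) P1).[U].[0] = (P1.[0])%:P.
    move=> U0; have := horner_map (horner_eval (0 : {poly k})) (map_poly (biC k) P1) U.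
    rewrite /= -map_poly_comp /horner_eval U0 => <-.
    rewrite (eq_map_poly (g := polyC)) -?[0 in LHS]polyC0 ?horner_map //.
    by move=> a; rewrite /= /horner_eval hornerC.
  rewrite hornerD hornerM !ev0 // ?hornerX //=.
  by rewrite hornerC -polyCM -polyCD polyC_eq0.
have : bieval (biC k) 'X W F %| H.
  by rewrite -(Gauss_dvdpr _ cop) EH dvdp_mulIr.
by move=> /(dvdp_leq H0); rewrite size_pencil.
Qed.

End Degree.

(** * Bidegrees, values at infinity, and homogenized additive polynomials *)

Section Degrees.
Context {k : comNzRingType}.
Implicit Types (P Q : {poly {poly k}}) (T U : {poly {poly {poly k}}}).

Definition bideg_le n P := degXY_le n n P.

Lemma bideg_leqP n P : reflect
  (forall i j, (n < i)%N || (n < j)%N -> P`_i`_j = 0) (bideg_le n P).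
Proof.
apply: (iffP andP) => [[sY sX] i j /orP[ni|nj]|H].
- by rewrite [P`_i]nth_default ?coef0 // (leq_trans sX).
- by rewrite nth_default // (leq_trans (max_size_coefXY _ _)) // (leq_trans sY).
split; last first.
  by apply/leq_sizeP => i ni; apply/polyP => j; rewrite coef0 H // ni.
rewrite sizeYE; apply/leq_sizeP => j nj; apply/polyP => i.
by rewrite coef_swapXY coef0 H // nj orbT.
Qed.

Lemma bideg0 n : bideg_le n (0 : {poly {poly k}}).
Proof. by apply/bideg_leqP => i j _; rewrite !coef0. Qed.

Lemma bidegW m n P : (m <= n)%N -> bideg_le m P -> bideg_le n P.
Proof.
move=> mn /bideg_leqP H; apply/bideg_leqP => i j ij; apply: H.
by case/orP: ij => ij; rewrite (leq_ltn_trans mn ij) ?orbT.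
Qed.

Lemma bidegD n P Q : bideg_le n P -> bideg_le n Q -> bideg_le n (P + Q).
Proof.
move=> /bideg_leqP HP /bideg_leqP HQ; apply/bideg_leqP => i j ij.
by rewrite !coefD HP // HQ // addr0.
Qed.

Lemma bideg_sum n I (r : seq I) (p : pred I) (F : I -> {poly {poly k}}) :
  (forall i, p i -> bideg_le n (F i)) -> bideg_le n (\sum_(i <- r | p i) F i).
Proof. by move=> H; elim/big_ind: _ => //; [exact: bideg0 | exact: bidegD]. Qed.

Lemma bidegM m n P Q : bideg_le m P -> bideg_le n Q -> bideg_le (m + n) (P * Q).
Proof.
move=> /bideg_leqP HP /bideg_leqP HQ; apply/bideg_leqP => i j ij.
rewrite coefM coef_sum big1 // => a _; rewrite coefM big1 // => b _.
have ha := ltn_ord a; have hb := ltn_ord b; rewrite !ltnS in ha hb.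
have [mab|] := boolP ((m < a)%N || (m < b)%N); first by rewrite HP ?mul0r.
rewrite negb_or -!leqNgt => /andP[am bm]; rewrite HQ ?mulr0 //.
by case/orP: ij => ij; apply/orP; [left|right]; lia.
Qed.

Lemma bidegC a : bideg_le 0 (a%:P%:P : {poly {poly k}}).
Proof.
apply/bideg_leqP => -[|i] [|j] //= _; rewrite !coefC //=; exact: coef0.
Qed.

Lemma bidegX : bideg_le 1 ('X : {poly {poly k}}).
Proof. by rewrite /bideg_le /degXY_le sizeYE swapXY_X size_polyX (leq_trans (size_polyC_leq1 _)). Qed.

Lemma bidegY : bideg_le 1 ('X%:P : {poly {poly k}}).
Proof. by rewrite /bideg_le /degXY_le sizeYE swapXY_Y size_polyX (leq_trans (size_polyC_leq1 _)). Qed.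

Lemma bidegXn m n P : bideg_le m P -> bideg_le (m * n) (P ^+ n).
Proof.
move=> H; elim: n => [|n IH]; first by rewrite muln0; exact: bidegC.
by rewrite exprS mulnS; apply: bidegM.
Qed.

(* The variable T of the outermost polynomial ring is given weight 1.          *)
Definition graded_le n T :=
  forall i, T`_i = 0 \/ (i <= n)%N /\ bideg_le (n - i) T`_i.

Lemma gradedD n T U : graded_le n T -> graded_le n U -> graded_le n (T + U).
Proof.
move=> HT HU i; rewrite coefD.
have [->|[iT bT]] := HT i; first by rewrite add0r.
have [->|[_ bU]] := HU i; first by rewrite addr0; right.
by right; split=> //; exact: bidegD.
Qed.

Lemma graded0 n : graded_le n 0.
Proof. by move=> i; left; rewrite coef0. Qed.

Lemma graded_sum n I (r : seq I) (p : pred I) (F : I -> {poly {poly {poly k}}}) :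
  (forall i, p i -> graded_le n (F i)) -> graded_le n (\sum_(i <- r | p i) F i).
Proof. by move=> H; elim/big_ind: _ => //; [exact: graded0 | exact: gradedD]. Qed.

Lemma gradedM m n T U : graded_le m T -> graded_le n U -> graded_le (m + n) (T * U).
Proof.
move=> HT HU l; rewrite coefM; have [lmn|lmn] := leqP l (m + n); last first.
  left; apply: big1 => i _; have [->|[im _]] := HT i; first by rewrite mul0r.
  have [->|[jn _]] := HU (l - i)%N; first by rewrite mulr0.
  by have := ltn_ord i; lia.
right; split=> //; apply: bideg_sum => i _.
have [->|[im bT]] := HT i; first by rewrite mul0r bideg0.
have [->|[jn bU]] := HU (l - i)%N; first by rewrite mulr0 bideg0.
apply: bidegW (bidegM bT bU); have := ltn_ord i; lia.
Qed.

Lemma gradedC n P : bideg_le n P -> graded_le n P%:P.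
Proof.
by move=> H [|i]; rewrite coefC; [right; rewrite subn0 | left].
Qed.

Lemma gradedX : graded_le 1 'X.
Proof.
move=> [|[|i]]; rewrite coefX; [by left| |by left].
by right; split=> //; exact: bidegC 1.
Qed.

Lemma gradedXn m n T : graded_le m T -> graded_le (m * n) (T ^+ n).
Proof.
move=> H; elim: n => [|n IH]; first by rewrite muln0; apply: gradedC; exact: bidegC.
by rewrite exprS mulnS; apply: gradedM.
Qed.

Lemma graded_coefM m n T U : graded_le m T -> graded_le n U ->
  (T * U)`_(m + n) = T`_m * U`_n.
Proof.
move=> HT HU; have hm : (m < (m + n).+1)%N by rewrite ltnS leq_addr.
rewrite coefM (bigD1 (Ordinal hm)) //= addKn big1 ?addr0 // => i ni.
have [->|[im _]] := HT i; first by rewrite mul0r.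
have [->|[jn _]] := HU (m + n - i)%N; first by rewrite mulr0.
case/eqP: ni; apply: val_inj => /=; have := ltn_ord i; lia.
Qed.

(* The values of a at the roots of M are those of P / Y^n at the points of the *)
(* curve with y infinite.                                                      *)
Definition topY n P (a : {poly k}) := (size P <= n.+1)%N /\ P`_n = a.

Lemma topY_eq n P a b : topY n P a -> a = b -> topY n P b.
Proof. by move=> H <-. Qed.

Lemma topYD n P Q a b : topY n P a -> topY n Q b -> topY n (P + Q) (a + b).
Proof.
move=> [sP <-] [sQ <-]; split; last by rewrite coefD.
by rewrite (leq_trans (size_polyD _ _)) // geq_max sP.
Qed.

Lemma topYM m n P Q a b : topY m P a -> topY n Q b -> topY (m + n) (P * Q) (a * b).
Proof.
move=> [sP <-] [sQ <-]; split.
  by rewrite (leq_trans (size_polyMleq _ _)) //; move: sP sQ; move: (size P) (size Q); lia.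
have hm : (m < (m + n).+1)%N by rewrite ltnS leq_addr.
rewrite coefM (bigD1 (Ordinal hm)) //= addKn big1 ?addr0 // => i ni.
have [im|im] := ltnP m i; first by rewrite nth_default ?mul0r // (leq_trans sP).
rewrite [Q`__]nth_default ?mulr0 // (leq_trans sQ) //.
have : (i != m :> nat) by apply: contraNneq ni => e; apply/eqP/val_inj.
have := ltn_ord i; move: (nat_of_ord i) im => j; lia.
Qed.

Lemma topY_sum n I (r : seq I) (F : I -> {poly {poly k}}) (a : I -> {poly k}) :
  (forall i, topY n (F i) (a i)) -> topY n (\sum_(i <- r) F i) (\sum_(i <- r) a i).
Proof.
move=> H; elim: r => [|i r IH]; last by rewrite !big_cons; apply: topYD.
by rewrite !big_nil; split; rewrite ?coef0 ?size_poly0.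
Qed.

Lemma topYC a : topY 0 a%:P a.
Proof. by split; rewrite ?coefC ?size_polyC_leq1. Qed.

Lemma topYX : topY 1 'X 1.
Proof. by split; rewrite ?coefX ?size_polyX. Qed.

Lemma topYXn m n P a : topY m P a -> topY (m * n) (P ^+ n) (a ^+ n).
Proof.
move=> H; elim: n => [|n IH]; first by rewrite muln0 !expr0; exact: topYC.
by rewrite !exprS mulnS; apply: topYM.
Qed.

Lemma topY_lt m n P a : topY m P a -> (m < n)%N -> topY n P 0.
Proof.
move=> [sP _] mn; split; first by rewrite (leq_trans sP) // ltnW // ltnS.
by rewrite nth_default // (leq_trans sP).
Qed.

End Degrees.

(** An equation of total weight n with constant leading coefficient a is an integral equation after
    division by a, the weights bounding the bidegrees of the other coefficients. *)
Lemma graded_integral_section (k : closedFieldType) (E : fieldType)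
    (f : {rmorphism k -> E}) (x y z : E) n (a : k) (T : {poly {poly {poly k}}}) :
  a != 0 -> graded_le n T -> T`_n = a%:P%:P -> (map_poly (bieval f x y) T).[z] = 0 ->
  integral_section f x y z.
Proof.
move=> a0 gT Tn Tz; exists n, (fun i => - (a^-1)%:P%:P * T`_i); split.
  move=> i lt_in; have -> : degXY_le (n - i) (n - i) (- (a^-1)%:P%:P * T`_i)
    = bideg_le (0 + (n - i)) (- (a^-1)%:P%:P * T`_i) by [].
  apply: bidegM; first by rewrite -!rmorphN; exact: bidegC.
  by have [->|[_ //]] := gT i; exact: bideg0.
have sT : (size T <= n.+1)%N.
  apply/leq_sizeP => i ni; have [//|[]] := gT i; lia.
move: Tz; rewrite (@horner_coef_wide _ n.+1) ?(leq_trans (size_poly _ _)) //.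
have cm i : (map_poly (bieval f x y) T)`_i = bieval f x y T`_i.
  by rewrite coef_map.
rewrite big_ord_recr /= cm Tn bievalCC => /eqP; rewrite addrC addr_eq0 => /eqP E0.
have fa0 : f a != 0 by rewrite fmorph_eq0.
apply: (mulfI fa0); rewrite E0 mulr_sumr -sumrN; apply: eq_bigr => i _.
rewrite cm bievalM bievalN bievalCC fmorphV; field; exact: fa0.
Qed.

Notation triC k := (polyC \o (polyC \o polyC) : {rmorphism k -> {poly {poly {poly k}}}}).

Section HomogeneousAdditive.
Context {k : closedFieldType} (p e : nat) (alpha : 'I_e.+1 -> k).
Hypotheses (hp : p \in [pchar k]) (e_gt0 : (0 < e)%N).
Hypothesis alpha_neq0 : alpha ord_max * alpha ord0 != 0.
Local Notation q := (p ^ e)%N.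
Local Notation L := (additive_poly p alpha).

(* S^q L(T / S) *)
Definition hadd (R : comNzRingType) (f : {rmorphism k -> R}) (T S : R) : R :=
  \sum_(i < e.+1) f (alpha i) * T ^+ (p ^ i) * S ^+ (q - p ^ i).

Let p_gt1 : (1 < p)%N. Proof. exact/prime_gt1/(pcharf_prime hp). Qed.
Let a0 : alpha ord0 != 0. Proof. by move: alpha_neq0; rewrite mulf_eq0 negb_or => /andP[]. Qed.
Let aq : alpha ord_max != 0. Proof. by move: alpha_neq0; rewrite mulf_eq0 negb_or => /andP[]. Qed.

Lemma leq_pexp (i : 'I_e.+1) : (p ^ i <= q)%N.
Proof. by rewrite leq_pexp2l ?(ltnW p_gt1) // -ltnS. Qed.

Lemma pexp_eq (i : 'I_e.+1) : (p ^ i == q)%N = (i == ord_max).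
Proof. by rewrite eqn_exp2l. Qed.

Lemma q_gt1 : (1 < q)%N.
Proof. by rewrite -(expn0 p) ltn_exp2l. Qed.

Lemma coef_additive_poly n :
  L`_n = \sum_(i < e.+1) alpha i * (n == p ^ i)%N%:R.
Proof.
rewrite /additive_poly coef_sum; apply: eq_bigr => i _.
by rewrite coefZ coefXn.
Qed.

Lemma coef_additive_pexp (i : 'I_e.+1) : L`_(p ^ i) = alpha i.
Proof.
rewrite coef_additive_poly (bigD1 i) //= eqxx mulr1 big1 ?addr0 // => j ji.
by rewrite eqn_exp2l // eq_sym val_eqE (negPf ji) mulr0.
Qed.

Lemma sep_additive_poly : sep_poly q L.
Proof.
split.
  apply/eqP; rewrite eqn_leq; apply/andP; split.
    apply: (leq_trans (size_sum _ _ _)); apply/bigmax_leqP => i _.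
    by rewrite (leq_trans (size_scale_leq _ _)) // size_polyXn ltnS leq_pexp.
  rewrite ltnNge; apply/negP => /leq_sizeP/(_ q (leqnn _))/eqP.
  by rewrite (coef_additive_pexp ord_max) (negPf aq).
exists (alpha ord0) => //; rewrite /additive_poly raddf_sum /= big_ord_recl /=.
rewrite derivZ expn0 expr1 derivX alg_polyC big1 ?addr0 // => i _.
rewrite derivZ derivXn -mulr_natr -polyC_natr natrX (pcharf0 hp) expr0n /= mulr0.
by rewrite scaler0.
Qed.

Lemma horner_additive (R : comNzRingType) (f : {rmorphism k -> R}) z :
  (map_poly f L).[z] = hadd f z 1.
Proof.
rewrite /additive_poly raddf_sum /= horner_sum; apply: eq_bigr => i _.
by rewrite map_polyZ map_polyXn hornerZ hornerXn expr1n mulr1.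
Qed.

Lemma rmorph_hadd (R S : comNzRingType) (f : {rmorphism k -> R})
    (h : {rmorphism R -> S}) (g : {rmorphism k -> S}) T U :
  (forall a, h (f a) = g a) -> h (hadd f T U) = hadd g (h T) (h U).
Proof.
move=> hfg; rewrite rmorph_sum; apply: eq_bigr => i _.
by rewrite !rmorphM !rmorphXn /= hfg.
Qed.

Lemma rmorph_hadd_shift (R S : comNzRingType) (f : {rmorphism k -> R})
    (h : {rmorphism R -> S}) (g : {rmorphism k -> S}) T U U' u v c n :
  (forall a, h (f a) = g a) ->
  h ((hadd f T U + f u * U ^+ n) * (hadd f T U' + f v * U' ^+ n) + f c * (U ^+ n * U' ^+ n))
  = (hadd g (h T) (h U) + g u * h U ^+ n) * (hadd g (h T) (h U') + g v * h U' ^+ n)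
    + g c * (h U ^+ n * h U' ^+ n).
Proof.
move=> hf; rewrite rmorphD !rmorphM !rmorphD !rmorphM !rmorphXn.
by rewrite !(rmorph_hadd _ _ hf) !hf.
Qed.

Lemma rmorph_hadd_mul (R S : comNzRingType) (f : {rmorphism k -> R})
    (h : {rmorphism R -> S}) (g : {rmorphism k -> S}) T U T' U' V c :
  (forall a, h (f a) = g a) ->
  h (hadd f T U * (hadd f T' U' + V) + f c)
  = hadd g (h T) (h U) * (hadd g (h T') (h U') + h V) + g c.
Proof. by move=> hf; rewrite rmorphD rmorphM rmorphD !(rmorph_hadd _ _ hf) hf. Qed.

Lemma rmorph_hadd_form (R S : comNzRingType) (f : {rmorphism k -> R})
    (h : {rmorphism R -> S}) (g : {rmorphism k -> S}) T T' U c n :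
  (forall a, h (f a) = g a) ->
  h (hadd f T U * hadd f T' U + f c * U ^+ n)
  = hadd g (h T) (h U) * hadd g (h T') (h U) + g c * h U ^+ n.
Proof.
by move=> hf; rewrite rmorphD !rmorphM rmorphXn !(rmorph_hadd _ _ hf) hf.
Qed.

Lemma haddD (R : comNzRingType) (f : {rmorphism k -> R}) T U S :
  hadd f (T + U) S = hadd f T S + hadd f U S.
Proof.
have hR := rmorph_pchar f hp.
rewrite -big_split; apply: eq_bigr => i _ /=.
rewrite exprDn_pchar; first by ring.
by rewrite pnatX (pnatE _ (pcharf_prime hp)) hR.
Qed.

Lemma haddN (R : comNzRingType) (f : {rmorphism k -> R}) T S :
  hadd f (- T) S = - hadd f T S.
Proof.
have h0 : hadd f 0 S = 0.
  by apply: big1 => i _; rewrite expr0n expn_eq0 -leqn0 leqNgt (ltnW p_gt1) mulr0 mul0r.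
by apply/eqP; rewrite -addr_eq0 -haddD addNr h0.
Qed.

Lemma hadd0l (R : comNzRingType) (f : {rmorphism k -> R}) S : hadd f 0 S = 0.
Proof.
by apply: big1 => i _; rewrite expr0n expn_eq0 -leqn0 leqNgt (ltnW p_gt1) mulr0 mul0r.
Qed.

Lemma hadd0r (R : comNzRingType) (f : {rmorphism k -> R}) T :
  hadd f T 0 = f (alpha ord_max) * T ^+ q.
Proof.
rewrite /hadd (bigD1 ord_max) //= subnn expr0 mulr1 big1 ?addr0 // => i im.
rewrite expr0n subn_eq0; case: leqP; rewrite ?mulr0 // => qi.
by case/eqP: im; apply/eqP; rewrite -pexp_eq eqn_leq qi leq_pexp.
Qed.

Lemma haddM (R : comNzRingType) (f : {rmorphism k -> R}) a T S :
  hadd f (a * T) (a * S) = a ^+ q * hadd f T S.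
Proof.
rewrite /hadd mulr_sumr; apply: eq_bigr => i _.
rewrite !exprMn -{3}(subnKC (leq_pexp i)) exprD; ring.
Qed.

Lemma hadd_div (E : fieldType) (f : {rmorphism k -> E}) T S : S != 0 ->
  hadd f T S = S ^+ q * hadd f (T / S) 1.
Proof. by move=> S0; rewrite -haddM mulrCA divff // !mulr1. Qed.

Lemma topY_hadd m T S a b : topY m T a -> topY m S b ->
  topY (m * q) (hadd (biC k) T S) (hadd polyC a b).
Proof.
move=> hT hS; apply: topY_sum => i.
have -> : (m * q)%N = (0 + m * p ^ i + m * (q - p ^ i))%N.
  by rewrite add0n -mulnDr subnKC // leq_pexp.
apply: topYM; last exact: topYXn.
by apply: topYM; [exact: topYC | exact: topYXn].
Qed.

Lemma graded_hadd T S : graded_le 1 T -> graded_le 1 S -> graded_le q (hadd (triC k) T S).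
Proof.
move=> hT hS; apply: graded_sum => i _.
rewrite [X in graded_le X _](_ : q = 0 + 1 * p ^ i + 1 * (q - p ^ i))%N; last first.
  by rewrite add0n !mul1n subnKC // leq_pexp.
apply: gradedM; last exact: gradedXn.
apply: gradedM; last exact: gradedXn.
by apply: gradedC; exact: bidegC.
Qed.

Lemma coef_graded_hadd a (S : {poly {poly k}}) :
  (hadd (triC k) (a%:P%:P%:P * 'X) S%:P)`_q = (alpha ord_max * a ^+ q)%:P%:P.
Proof.
rewrite /hadd coef_sum (bigD1 ord_max) //= subnn expr0 mulr1 big1 ?addr0.
  rewrite exprMn mulrA -!polyC_exp -!polyCM coefMXn ltnn subnn.
  by rewrite coefC.
move=> i im; rewrite exprMn mulrA -!polyC_exp -!polyCM mulrAC -polyCM coefCM coefXn.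
by rewrite [(_ == _)%N]eq_sym pexp_eq (negPf im) mulr0.
Qed.

End HomogeneousAdditive.

(** * Integrality of conjugates, and relations of bidegree at most 2 *)

Section IntegralConjugates.
Context {k : closedFieldType} (p e : nat) (alpha : 'I_e.+1 -> k).
Hypotheses (hp : p \in [pchar k]) (e_gt0 : (0 < e)%N).
Hypothesis alpha_neq0 : alpha ord_max * alpha ord0 != 0.
Local Notation q := (p ^ e)%N.
Local Notation L := (additive_poly p alpha).
Context {E : fieldType} (f : {rmorphism k -> E}) (x y : E).

Let aq : alpha ord_max != 0. Proof. by move: alpha_neq0; rewrite mulf_eq0 negb_or => /andP[]. Qed.

Lemma horner_shift (R : comNzRingType) (g : {rmorphism k -> R}) (u : k) z :
  (map_poly g (L + u%:P)).[z] = hadd p alpha g z 1 + g u.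
Proof. by rewrite rmorphD /= map_polyC hornerD hornerC horner_additive. Qed.

(** Multiplied by x^q y^q the equation becomes one of weight 2q in z, x and y, with leading
    coefficient alpha_e^2. It is applied to z = y s(x), for which z / y = s(x) and z / x = s(y). *)
Lemma integral_concurrent (u v c : k) z : x != 0 -> y != 0 ->
  (map_poly f (L + u%:P)).[z / y] * (map_poly f (L + v%:P)).[z / x] + f c = 0 ->
  integral_section f x y z.
Proof.
move=> x0 y0; rewrite !horner_shift => E0.
pose X3 : {poly {poly {poly k}}} := 'X%:P%:P.
pose Y3 : {poly {poly {poly k}}} := 'X%:P.
pose T := (hadd p alpha (triC k) 'X Y3 + triC k u * Y3 ^+ q)
  * (hadd p alpha (triC k) 'X X3 + triC k v * X3 ^+ q)
  + triC k c * (Y3 ^+ q * X3 ^+ q).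
pose h : {rmorphism {poly {poly {poly k}}} -> E} :=
  horner_eval z \o map_poly (bieval f x y).
have hC a : h (triC k a) = f a.
  by rewrite /h /= map_polyC /horner_eval hornerC /= bievalCC.
have hX3 : h X3 = x by rewrite /h /= map_polyC /horner_eval hornerC /= bievalC map_polyX hornerX.
have hY3 : h Y3 = y by rewrite /h /= map_polyC /horner_eval hornerC /= bievalX.
have hZ : h 'X = z by rewrite /h /= map_polyX /horner_eval hornerX.
have gX3 : graded_le 1 X3 by apply: gradedC; exact: bidegY.
have gY3 : graded_le 1 Y3 by apply: gradedC; exact: bidegX.
have gC a : graded_le 0 (triC k a) by apply: gradedC; exact: bidegC.
have gq (S : {poly {poly {poly k}}}) : graded_le 1 S -> graded_le q (S ^+ q).
  by move=> gS; have := gradedXn q gS; rewrite mul1n.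
have gh a (S : {poly {poly {poly k}}}) : graded_le 1 S ->
    graded_le q (hadd p alpha (triC k) 'X S + triC k a * S ^+ q).
  move=> gS; apply: gradedD; first exact: graded_hadd hp _ _ gradedX gS.
  exact: (gradedM (m := 0) (gC a) (gq _ gS)).
have ch a (S : {poly {poly k}}) :
    (hadd p alpha (triC k) 'X S%:P + triC k a * S%:P ^+ q)`_q = (alpha ord_max)%:P%:P.
  rewrite coefD /= -polyC_exp -polyCM coefC.
  rewrite expn_eq0 -leqn0 leqNgt (ltnW (prime_gt1 (pcharf_prime hp))) addr0.
  have := coef_graded_hadd alpha hp 1 S.
  by rewrite !polyC1 mul1r expr1n mulr1.
have gXY : graded_le (q + q) (triC k c * (Y3 ^+ q * X3 ^+ q)).
  exact: (gradedM (m := 0) (gC c) (gradedM (gq _ gY3) (gq _ gX3))).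
have q0 : (0 < q)%N by rewrite expn_gt0 (ltnW (prime_gt1 (pcharf_prime hp))).
apply: (@graded_integral_section _ _ _ _ _ _ (q + q) (alpha ord_max * alpha ord_max) T).
- by rewrite mulf_neq0.
- by apply: gradedD => //; apply: gradedM; exact: gh.
- rewrite coefD (graded_coefM (gh _ _ gY3) (gh _ _ gX3)).
  rewrite [X in X * _]ch [X in _ * X + _]ch -!polyCM.
  rewrite /Y3 /X3 /= -!polyC_exp -!polyCM coefC addn_eq0.
  by rewrite eqn0Ngt q0 addr0.
transitivity (h T); first by [].
rewrite (rmorph_hadd_shift p alpha _ _ _ _ _ _ _ hC) hX3 hY3 hZ.
rewrite (hadd_div alpha hp f z y0) (hadd_div alpha hp f z x0).
set P := hadd _ _ _ _ _ in E0 *; set Q := hadd _ _ _ (z / x) _ in E0 *.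
rewrite (_ : _ + _ = y ^+ q * x ^+ q * ((P + f u) * (Q + f v) + f c)); last by ring.
by rewrite E0 mulr0.
Qed.

(** By additivity L(m z + t) = L(m z) + L(t) with L(t) of bidegree at most q, so the equation has
    weight 2q and leading coefficient alpha_e^2 m^q. It is applied to z = s(x), for which s(y) = m z
    + t. *)
Lemma integral_parallel (m c : k) z : m != 0 ->
  (map_poly f L).[z] * (map_poly f L).[f m * z + (y - f m * x)] + f c = 0 ->
  integral_section f x y z.
Proof.
move=> m0; rewrite !horner_additive => E0.
pose X2 : {poly {poly k}} := 'X%:P.
pose t2 : {poly {poly k}} := 'X + (- m%:P%:P) * X2.
pose Z3 : {poly {poly {poly k}}} := 'X.
pose T := hadd p alpha (triC k) Z3 1%:P
  * (hadd p alpha (triC k) (triC k m * Z3) 1%:P + (hadd p alpha (biC k) t2 1)%:P)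
  + triC k c.
pose h : {rmorphism {poly {poly {poly k}}} -> E} :=
  horner_eval z \o map_poly (bieval f x y).
have hP P : h P%:P = bieval f x y P by rewrite /h /= map_polyC /horner_eval hornerC.
have hC a : h (triC k a) = f a by rewrite hP /= bievalCC.
have hZ : h 'X = z by rewrite /h /= map_polyX /horner_eval hornerX.
have q0 : (0 < q)%N by rewrite expn_gt0 (ltnW (prime_gt1 (pcharf_prime hp))).
have bt : bideg_le q (hadd p alpha (biC k) t2 1).
  apply: bideg_sum => i _; rewrite expr1n mulr1.
  have bt2 : bideg_le 1 t2.
    apply: bidegD; first exact: bidegX.
    rewrite -[X in bideg_le X _]add0n -!rmorphN; apply: bidegM; [exact: bidegC | exact: bidegY].
  rewrite -[X in bideg_le X _]add0n; apply: bidegM; first exact: bidegC.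
  have := bidegXn (p ^ i) bt2; rewrite mul1n; apply: bidegW.
  exact: (leq_pexp hp).
have gC a : graded_le 0 (triC k a) by apply: gradedC; exact: bidegC.
have g1 : graded_le 1 (1%:P : {poly {poly {poly k}}}).
  by apply: gradedC; apply: bidegW (bidegC 1).
have gA : graded_le q (hadd p alpha (triC k) Z3 1%:P).
  exact: graded_hadd hp _ _ gradedX g1.
have gB : graded_le q (hadd p alpha (triC k) (triC k m * Z3) 1%:P).
  apply: graded_hadd hp _ _ _ g1; rewrite -[X in graded_le X _]add0n; apply: gradedM => //.
  exact: gradedX.
have cA : (hadd p alpha (triC k) Z3 1%:P)`_q = (alpha ord_max)%:P%:P.
  by have := coef_graded_hadd alpha hp 1 1; rewrite !polyC1 mul1r expr1n mulr1.
have cB := coef_graded_hadd alpha hp m 1.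
have gBt := gradedD gB (gradedC bt).
apply: (@graded_integral_section _ _ _ _ _ _ (q + q)
  (alpha ord_max * (alpha ord_max * m ^+ q)) T).
- by rewrite !mulf_neq0 ?expf_neq0.
- apply: gradedD; first exact: gradedM.
  by apply: gradedC; apply: bidegW (bidegC c).
- have cq : (triC k c)`_(q + q) = 0 by rewrite /= coefC addn_eq0 eqn0Ngt q0.
  rewrite coefD (graded_coefM gA gBt) cA coefD cB cq (coefC (hadd _ _ _ t2 1)).
  by rewrite eqn0Ngt q0 !addr0 -!polyCM.
transitivity (h T); first by [].
have h1 : h 1%:P = 1 by rewrite hP bieval1.
have hmZ : h (triC k m * Z3) = f m * z by rewrite rmorphM hC hZ.
rewrite (rmorph_hadd_mul p alpha _ _ _ _ _ _ hC).
rewrite h1 hmZ hZ hP.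
rewrite (rmorph_hadd p alpha t2 1 (f := biC k) (h := bieval f x y) (bievalCC f x y)).
have ht : bieval f x y t2 = y - f m * x.
  by rewrite /t2 bievalD bievalM bievalN bievalCC bievalX bievalC map_polyX hornerX mulNr.
by rewrite /= ht bieval1 -haddD.
Qed.

End IntegralConjugates.

Section Evaluation.
Context {k : closedFieldType} {E : fieldType} (f : {rmorphism k -> E}).
Context (M N : {poly k}) (c : k) (q : nat) (x y : E).
Hypothesis pt : generic_point f M N c q x y.
Implicit Types (P Q : {poly {poly k}}).

Lemma bieval_finite P (x0 y0 : k) : bieval f x y P = 0 -> M.[x0] * N.[y0] + c = 0 ->
  bieval idfun x0 y0 P = 0.
Proof.
move=> /(specialize_finite pt) H /H; rewrite /bieval /= /horner_eval.
rewrite /specialize => <-; congr (_.[_]); apply: eq_map_poly => a /=.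
by rewrite map_poly_id.
Qed.

Lemma bieval_topY P n (a : {poly k}) (x0 : k) : bieval f x y P = 0 -> topY n P a ->
  M.[x0] = 0 -> a.[x0] = 0.
Proof. by move=> P0 [sP <-] Mx0; apply: (specialize_infY pt P0 sP Mx0). Qed.

Lemma gp_x_neq0 : x != 0.
Proof.
apply/eqP => x0; have := gp_transc pt (P := 'X).
by rewrite map_polyX hornerX => /(_ x0)/eqP; rewrite polyX_eq0.
Qed.

Lemma gp_x_nconst (a : k) : x <> f a.
Proof.
move=> xa; have := gp_transc pt (P := 'X - a%:P).
by rewrite rmorphB /= map_polyX map_polyC !hornerE xa subrr => /(_ erefl)/eqP; rewrite polyXsubC_eq0.
Qed.

(** A relation of degree at most 2 < q in y is trivial, y having degree q over k(x). *)
Lemma coef_eq0_deg2 (a : nat -> nat -> k) : (2 < q)%N ->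
  \sum_(i < 3) \sum_(j < 3) f (a i j) * x ^+ j * y ^+ i = 0 ->
  forall i j, (i < 3)%N -> (j < 3)%N -> a i j = 0.
Proof.
move=> q2 E0 i j i3 j3; pose P := \poly_(i < 3) \poly_(j < 3) a i j.
have : P = 0.
  apply: (bieval_small pt); first by rewrite (leq_trans (size_poly _ _)).
  rewrite -[RHS]E0 /P poly_def bieval_sum; apply: eq_bigr => i' _.
  rewrite bievalZ bievalXn bievalX poly_def rmorph_sum horner_sum mulr_suml.
  apply: eq_bigr => j' _; rewrite /= map_polyZ /= map_polyXn hornerZ hornerXn; ring.
by move/polyP/(_ i)/polyP/(_ j); rewrite !coef0 !coef_poly i3 coef_poly j3.
Qed.

End Evaluation.

Definition bilinear_form (k E : nzRingType) (f : k -> E) (x y : E) (a b d e : k) : E :=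
  f a + f b * x + f d * y + f e * (x * y).

Section BilinearForms.
Context {k : closedFieldType} {E : fieldType} (f : {rmorphism k -> E}).
Context (M N : {poly k}) (c : k) (q : nat) (x y : E).
Hypothesis (pt : generic_point f M N c q x y) (q_gt2 : (2 < q)%N).
Local Notation bil := (bilinear_form f x y).

Lemma bilinear_form_inj (a b d e a' b' d' e' : k) : bil a b d e = bil a' b' d' e' ->
  [/\ a = a', b = b', d = d' & e = e'].
Proof.
move=> E0; pose A i j := nth 0 (nth [::] [:: [:: a - a'; b - b']; [:: d - d'; e - e']] i) j.
have A0 : forall i j, (i < 3)%N -> (j < 3)%N -> A i j = 0.
  apply: (coef_eq0_deg2 pt q_gt2); rewrite !big_ord_recl !big_ord0 /= /A /=.
  rewrite !rmorphB !rmorph0 !expr0.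
  rewrite (_ : _ + _ = bil a b d e - bil a' b' d' e'); first by rewrite E0 subrr.
  by rewrite /bilinear_form; ring.
by split; apply/eqP; rewrite -subr_eq0;
  [rewrite -(A0 0 0)%N|rewrite -(A0 0 1)%N|rewrite -(A0 1 0)%N|rewrite -(A0 1 1)%N].
Qed.

(** The equality holds between polynomials in X and Y, where the only factors of X Y are monomials;
    the proof reads this off the nine coefficients. *)
Lemma bilinear_form_divides (a b d e a' b' d' e' g : k) : g != 0 ->
  bil a b d e * bil a' b' d' e' = f g * (x * y) ->
  [\/ bil a b d e = f a, bil a b d e = f b * x,
      bil a b d e = f d * y | bil a b d e = f e * (x * y)].
Proof.
(* [A i j] is the coefficient of x^j y^i in the difference of the two sides. *)
move=> g0 E0; pose A i j := nth 0 (nth [::] [::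
  [:: a * a'; a * b' + b * a'; b * b'];
  [:: a * d' + d * a'; a * e' + e * a' + b * d' + d * b' - g; b * e' + e * b'];
  [:: d * d'; d * e' + e * d'; e * e']] i) j.
have A0 : forall i j, (i < 3)%N -> (j < 3)%N -> A i j = 0.
  apply: (coef_eq0_deg2 pt q_gt2); rewrite !big_ord_recl !big_ord0 /= /A /=.
  rewrite !rmorphB !rmorphD !rmorphM !expr0.
  rewrite (_ : _ + _ = bil a b d e * bil a' b' d' e' - f g * (x * y)).
    by rewrite E0 subrr.
  by rewrite /bilinear_form /bump /=; ring.
have := A0 0%N 0%N isT isT; have := A0 0%N 1%N isT isT; have := A0 0%N 2%N isT isT.
have := A0 1%N 0%N isT isT; have := A0 1%N 1%N isT isT; have := A0 1%N 2%N isT isT.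
have := A0 2%N 0%N isT isT; have := A0 2%N 1%N isT isT; have := A0 2%N 2%N isT isT.
rewrite /A /= => {A A0 E0} h22 h21 h20 h12 /eqP h11 h10 h02 h01 h00.
move: h11; rewrite subr_eq0 => /eqP h11.
have z1 (u v w : k) : u != 0 -> u * v + w = 0 -> w = 0 -> v = 0.
  by move=> u0 + w0; rewrite w0 addr0 => /eqP; rewrite mulf_eq0 (negPf u0) => /eqP.
rewrite /bilinear_form.
have [a0|a0] := eqVneq a 0; last first.
  have a'0 : a' = 0 by apply: (z1 a _ 0) => //; rewrite addr0.
  have b'0 : b' = 0 by apply: (z1 a _ (b * a')) => //; rewrite a'0 mulr0.
  have d'0 : d' = 0 by apply: (z1 a _ (d * a')) => //; rewrite a'0 mulr0.
  move: h11 h22 h12 h21; rewrite a'0 b'0 d'0 !mulr0 !addr0 => h11 h22 h12 h21.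
  have e'0 : e' != 0 by apply: contraNneq g0 => e'0; rewrite -h11 e'0 mulr0.
  move: h22 h12 h21 => /eqP; rewrite mulf_eq0 (negPf e'0) orbF => /eqP ->.
  move=> /eqP; rewrite mulf_eq0 (negPf e'0) orbF => /eqP ->.
  move=> /eqP; rewrite mulf_eq0 (negPf e'0) orbF => /eqP ->.
  by constructor 1; rewrite !rmorph0 !mul0r !addr0.
rewrite a0 !mul0r !add0r in h01 h10 h11 *.
have [b0|b0] := eqVneq b 0; last first.
  have b'0 : b' = 0 by apply: (z1 b _ 0) => //; rewrite addr0.
  have e'0 : e' = 0 by apply: (z1 b _ (e * b')) => //; rewrite b'0 mulr0.
  have a'0 : a' = 0 by apply: (z1 b _ 0) => //; rewrite addr0.
  move: h11 h20 h21; rewrite a'0 b'0 e'0 !mulr0 !addr0 !add0r => h11 h20 h21.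
  have d'0 : d' != 0 by apply: contraNneq g0 => d'0; rewrite -h11 d'0 mulr0.
  move: h20 h21 => /eqP; rewrite mulf_eq0 (negPf d'0) orbF => /eqP ->.
  move=> /eqP; rewrite mulf_eq0 (negPf d'0) orbF => /eqP ->.
  by constructor 2; rewrite !rmorph0 !mul0r !addr0 add0r.
rewrite b0 !mul0r !add0r in h12 h02 h11 *.
have [d0|d0] := eqVneq d 0; last first.
  have d'0 : d' = 0 by apply: (z1 d _ 0) => //; rewrite addr0.
  have e'0 : e' = 0 by apply: (z1 d _ (e * d')) => //; rewrite d'0 mulr0.
  have a'0 : a' = 0 by apply: (z1 d _ 0) => //; rewrite addr0.
  move: h11; rewrite a'0 mulr0 !add0r => h11.
  have b'0 : b' != 0 by apply: contraNneq g0 => b'0; rewrite -h11 b'0 mulr0.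
  move: h12 => /eqP; rewrite mulf_eq0 (negPf b'0) orbF => /eqP ->.
  by constructor 3; rewrite !rmorph0 !mul0r !addr0 !add0r.
by constructor 4; rewrite d0 !rmorph0 !mul0r !add0r.
Qed.

End BilinearForms.

(** * Centres off the line at infinity *)

Section Concurrent.
Context {k : closedFieldType} (p e : nat) (alpha : 'I_e.+1 -> k).
Hypotheses (hp : p \in [pchar k]) (e_gt0 : (0 < e)%N).
Hypothesis alpha_neq0 : alpha ord_max * alpha ord0 != 0.
Local Notation q := (p ^ e)%N.
Local Notation L := (additive_poly p alpha).
Hypothesis q_gt2 : (2 < q)%N.

Let p_gt1 : (1 < p)%N. Proof. exact/prime_gt1/(pcharf_prime hp). Qed.
Let a0 : alpha ord0 != 0. Proof. by move: alpha_neq0; rewrite mulf_eq0 negb_or => /andP[]. Qed.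
Let aq : alpha ord_max != 0. Proof. by move: alpha_neq0; rewrite mulf_eq0 negb_or => /andP[]. Qed.

(* hadd (X * T) S / X *)
Definition hquo (R : comNzRingType) (f : {rmorphism k -> R}) (X T S : R) : R :=
  \sum_(i < e.+1) f (alpha i) * X ^+ (p ^ i).-1 * T ^+ (p ^ i) * S ^+ (q - p ^ i).

Lemma hquoE (R : comNzRingType) (f : {rmorphism k -> R}) X T S :
  X * hquo f X T S = hadd p alpha f (X * T) S.
Proof.
rewrite /hquo mulr_sumr; apply: eq_bigr => i _.
have -> : X * T = T * X by exact: mulrC.
have hX : X ^+ (p ^ i) = X * X ^+ (p ^ i).-1.
  by rewrite -exprS prednK // expn_gt0 (ltnW p_gt1).
by rewrite exprMn hX; ring.
Qed.

(** First-order behaviour of L at 0: only its linear coefficient remains. *)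
Lemma hquo0 (R : comNzRingType) (f : {rmorphism k -> R}) T S :
  hquo f 0 T S = f (alpha ord0) * T * S ^+ q.-1.
Proof.
rewrite /hquo big_ord_recl /= !expr0 mulr1 expr1 subn1 big1 ?addr0 // => i _.
have : (1 < p ^ lift ord0 i)%N by rewrite -(expn0 p) ltn_exp2l.
move=> h; rewrite expr0n (_ : _ == 0%N = false) ?mulr0 ?mul0r //.
by apply/negbTE; rewrite -lt0n -ltnS prednK // ltnW.
Qed.

Lemma bieval_hadd (R : comNzRingType) (g : {rmorphism k -> R}) x y T S :
  bieval g x y (hadd p alpha (biC k) T S)
  = hadd p alpha g (bieval g x y T) (bieval g x y S).
Proof. exact: (rmorph_hadd p alpha T S (f := biC k) (h := bieval g x y) (bievalCC g x y)). Qed.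

Lemma rmorph_hquo (R S : comNzRingType) (g : {rmorphism k -> R})
    (h : {rmorphism R -> S}) (g' : {rmorphism k -> S}) X T U :
  (forall a, h (g a) = g' a) -> h (hquo g X T U) = hquo g' (h X) (h T) (h U).
Proof.
move=> hfg; rewrite rmorph_sum; apply: eq_bigr => i _.
by rewrite !rmorphM !rmorphXn /= hfg.
Qed.

Lemma bieval_hquo (R : comNzRingType) (g : {rmorphism k -> R}) x y X T S :
  bieval g x y (hquo (biC k) X T S)
  = hquo g (bieval g x y X) (bieval g x y T) (bieval g x y S).
Proof. exact: (rmorph_hquo X T S (g := biC k) (h := bieval g x y) (bievalCC g x y)). Qed.

Lemma topY_hquo X T S a b : topY 1 T a -> topY 1 S b ->
  topY q (hquo (biC k) X%:P T S) (hquo polyC X a b).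
Proof.
move=> hT hS; apply: topY_sum => i.
rewrite [X in topY X](_ : q = 0 + 0 * (p ^ i).-1 + 1 * p ^ i + 1 * (q - p ^ i))%N; last first.
  by rewrite !mul1n !add0n subnKC // (leq_pexp hp).
apply: topYM; last exact: topYXn.
apply: topYM; last exact: topYXn.
by apply: topYM; [exact: topYC | apply: topYXn; exact: topYC].
Qed.

Context {E : fieldType} (f : {rmorphism k -> E}) (u v c : k) (x y : E).
Hypothesis pt : generic_point f (L + u%:P) (L + v%:P) c q x y.
Hypothesis origin : u * v + c != 0.
Let x0 := gp_x_neq0 pt.
Let y0 := gp_x_neq0 (generic_point_swap pt).
Let c0 := gp_neq0 pt.

Definition conjugate_by (z : E) :=
  (map_poly f (L + u%:P)).[z / y] * (map_poly f (L + v%:P)).[z / x] + f c = 0.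

Lemma horner0_shift w : (L + w%:P).[0] = w.
Proof.
have := horner_shift p alpha idfun w 0; rewrite map_poly_id // => ->.
by rewrite (hadd0l alpha hp) add0r.
Qed.

Lemma horner_shift_id w z : (L + w%:P).[z] = hadd p alpha idfun z 1 + w.
Proof. by rewrite -(horner_shift p alpha idfun w z) map_poly_id. Qed.

(** The points of the curve on x = 0; the origin is not among them. When u = 0 this axis meets the
    curve at (0, inf) instead. *)
Lemma finite_axis_points : u != 0 -> exists s : seq k, [/\ uniq s, size s = q,
  {in s, forall b, b != 0} & {in s, forall b, (L + u%:P).[0] * (L + v%:P).[b] + c = 0}].
Proof.
move=> u0; have sN : sep_poly q (L + v%:P + (c / u)%:P).
  by apply: sep_polyD (gp_sepr pt); rewrite (leq_trans _ q_gt2).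
have [s [us ss rs]] := sep_poly_roots sN; exists s; split=> // b; rewrite rs => /eqP.
  move=> Nb; apply: contraNneq origin => b0.
  move: Nb; rewrite b0 hornerD hornerC horner0_shift => /eqP; rewrite addr_eq0 => /eqP ->.
  by rewrite mulrN mulrC divfK // addNr.
move=> Nb; have /eqP : (L + v%:P).[b] + c / u = 0.
  by rewrite -[RHS]Nb [RHS]hornerD hornerC.
rewrite addr_eq0 horner0_shift => /eqP ->.
by rewrite mulrN mulrC divfK // addNr.
Qed.

Let X2 : {poly {poly k}} := 'X%:P.
Let Y2 : {poly {poly k}} := 'X.

(** If d != 0, then along x = 0 the function z / y takes the value d while z / x has a pole. The
    equation forces L(d) + u = 0, and then L(z / y) + u vanishes at x = 0 only to first order in x,
    too slowly to compensate the pole of L(z / x). *)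
Lemma conjugate_axis (b d g : k) : g != 0 ->
  conjugate_by (f b * x + f d * y + f g * (x * y)) -> d = 0.
Proof.
rewrite /conjugate_by; set z := (f b * x + _ + _) => g0 Ez.
pose Z2 := biC k b * X2 + biC k d * Y2 + biC k g * (X2 * Y2).
pose Q1 := hadd p alpha (biC k) Z2 Y2 + biC k u * Y2 ^+ q.
pose Q2 := hadd p alpha (biC k) Z2 X2 + biC k v * X2 ^+ q.
have evE (R : comNzRingType) (h : {rmorphism k -> R}) a1 a2 : [/\ bieval h a1 a2 X2 = a1,
    bieval h a1 a2 Y2 = a2 & bieval h a1 a2 Z2 = h b * a1 + h d * a2 + h g * (a1 * a2)].
  have eX : bieval h a1 a2 X2 = a1 by rewrite bievalC map_polyX hornerX.
  have eY : bieval h a1 a2 Y2 = a2 by rewrite bievalX.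
  by rewrite !bievalD !bievalM !bievalCC eX eY.
have Q1E (R : comNzRingType) (h : {rmorphism k -> R}) a1 a2 : bieval h a1 a2 Q1
    = hadd p alpha h (h b * a1 + h d * a2 + h g * (a1 * a2)) a2 + h u * a2 ^+ q.
  have [eX eY eZ] := evE _ h a1 a2.
  by rewrite bievalD bieval_hadd bievalM bievalXn bievalCC eY eZ.
have Q2E (R : comNzRingType) (h : {rmorphism k -> R}) a1 a2 : bieval h a1 a2 Q2
    = hadd p alpha h (h b * a1 + h d * a2 + h g * (a1 * a2)) a1 + h v * a1 ^+ q.
  have [eX eY eZ] := evE _ h a1 a2.
  by rewrite bievalD bieval_hadd bievalM bievalXn bievalCC eX eZ.
have q_gt0 : (0 < q)%N by rewrite (leq_trans _ q_gt2).
have zq : (0 : k) ^+ q = 0 by rewrite expr0n gtn_eqF.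
have E1 : bieval f x y (Q1 * Q2 + biC k c * (X2 ^+ q * Y2 ^+ q)) = 0.
  have [eX eY _] := evE _ f x y.
  rewrite bievalD !bievalM Q1E Q2E !bievalXn bievalCC eX eY -/z.
  rewrite (hadd_div alpha hp f z y0) (hadd_div alpha hp f z x0).
  rewrite -[RHS](mulr0 (x ^+ q * y ^+ q)) -Ez !horner_shift; ring.
have tX : topY 1 X2 0 by apply: topY_lt (topYC _) _.
have tZ : topY 1 Z2 (d%:P + g%:P * 'X).
  apply: topY_eq.
    apply: topYD; first apply: topYD.
    - by apply: topY_lt (topYM (topYC _) (topYC _)) _.
    - exact: (topYM (topYC _) topYX).
    - exact: (topYM (topYC _) (topYM (topYC _) topYX)).
  by rewrite add0r !mulr1.
have tQ2 : topY q Q2 ((alpha ord_max)%:P * (d%:P + g%:P * 'X) ^+ q).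
  apply: topY_eq.
    apply: topYD; first by have := topY_hadd alpha hp tZ tX; rewrite mul1n; apply.
    by apply: topY_lt (topYM (topYC _) (topYXn q (topYC _))) _; rewrite mul0n.
  by rewrite (hadd0r alpha hp) addr0.
have tQ1 : topY q Q1 (hadd p alpha polyC (d%:P + g%:P * 'X) 1 + u%:P).
  apply: topY_eq.
    apply: topYD; first by have := topY_hadd alpha hp tZ topYX; rewrite mul1n; apply.
    by have := topYM (topYC u%:P) (topYXn q topYX); rewrite mul1n add0n; apply.
  by rewrite expr1n mulr1.
have at_top : (d%:P + g%:P * 'X).[0] = d by rewrite !hornerE.
have hadd_top (R : {poly k}) : (hadd p alpha polyC R 1).[0] = hadd p alpha idfun R.[0] 1.
  have := @rmorph_hadd _ p _ alpha _ _ polyC (horner_eval (0 : k)) idfun R 1.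
  by rewrite /= /horner_eval hornerC; apply=> a; rewrite hornerC.
apply/eqP; apply: contraT => d0.
(* The product [Q1 * Q2] equals - c x^q y^q and so vanishes along x = 0, at the finite points (0, w)
   or, if u = 0, at (0, inf) after division by y^(2q). There [Q2] is a nonzero multiple of d^q, so
   [Q1] vanishes, and its value is L(d) + u up to a nonzero factor. *)
have Md : (L + u%:P).[d] = 0.
  suff : (L + u%:P).[d] * (alpha ord_max * d ^+ q) = 0.
    move/eqP; rewrite mulf_eq0 => /orP[/eqP //|].
    by rewrite mulf_eq0 (negPf aq) expf_eq0 (negPf d0) andbF.
  have [u0|u0] := eqVneq u 0; last first.
    have [s [us ss s0 sc]] := finite_axis_points u0.
    have : (0 < size s)%N by rewrite ss.
    rewrite -has_predT => /hasP[w ws _].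
    have := bieval_finite pt E1 (sc w ws).
    have [eX eY _] := evE _ idfun 0 w.
    rewrite bievalD !bievalM Q1E Q2E !bievalXn bievalCC eX eY /=.
    rewrite zq !mulr0 !mul0r !mulr0 !add0r !addr0.
    rewrite (hadd0r alpha hp) /= (hadd_div alpha hp _ _ (s0 w ws)) mulfK ?s0 //.
    rewrite exprMn => E2; apply/eqP.
    have wq : w ^+ q * w ^+ q != 0 by rewrite mulf_neq0 // expf_neq0 // s0.
    rewrite -(mulrI_eq0 _ (mulfI wq)) -{1}E2; apply/eqP.
    by rewrite horner_shift_id; ring.
  have tc : topY (q + q) (biC k c * (X2 ^+ q * Y2 ^+ q)) 0.
    apply: topY_lt (topYM (topYC _) (topYM (topYXn q (topYC _)) (topYXn q topYX))) _.
    by rewrite mul0n mul1n !add0n -{1}[q]addn0 ltn_add2l.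
  have := bieval_topY pt E1 (topYD (topYM tQ1 tQ2) tc) (x0 := 0).
  rewrite horner0_shift => /(_ u0).
  rewrite horner_shift_id addr0 hornerM hornerD hadd_top hornerC hornerM hornerC.
  by rewrite horner_exp at_top.
have Ld : hadd p alpha f (f d) 1 + f u = 0 by rewrite -horner_shift horner_map Md rmorph0.
(* Now L(z / y) + u = L(x (b + g y) / y); [R1] is y^q times its quotient by x. *)
pose R1 := hquo (biC k) X2 (biC k b + biC k g * Y2) Y2.
have evR1 (R : comNzRingType) (h : {rmorphism k -> R}) a1 a2 :
    bieval h a1 a2 R1 = hquo h a1 (h b + h g * a2) a2.
  have [eX eY _] := evE _ h a1 a2.
  by rewrite bieval_hquo bievalD bievalM !bievalCC eX eY.
have E2 : bieval f x y (R1 * Q2 + biC k c * (X2 ^+ q.-1 * Y2 ^+ q)) = 0.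
  apply: (mulfI x0); rewrite mulr0 -[RHS]E1.
  have [eX eY _] := evE _ f x y.
  rewrite !bievalD !bievalM !bievalXn bievalCC eX eY evR1 Q1E.
  have -> : f b * x + f d * y + f g * (x * y) = y * f d + x * (f b + f g * y) by ring.
  rewrite (haddD alpha hp) (hadd_div alpha hp _ (y * f d) y0) [y * f d]mulrC mulfK //.
  have /eqP := Ld; rewrite addr_eq0 => /eqP ->; rewrite -hquoE.
  by rewrite -[in x ^+ q](prednK q_gt0) exprS; ring.
have tR1 : topY q R1 (hquo polyC 'X (g%:P) 1).
  apply: topY_hquo topYX; apply: topY_eq.
    apply: topYD; first by apply: topY_lt (topYC _) _.
    exact: (topYM (topYC _) topYX).
  by rewrite add0r mulr1.
have [u0|u0] := eqVneq u 0; last first.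
  have [s [us ss s0 sc]] := finite_axis_points u0.
  (* At (0, w) the relation [E2] reduces to a nonzero multiple of b + g w; two different points
     contradict g != 0. *)
  have bg w : w \in s -> b + g * w = 0.
    move=> ws; have := bieval_finite pt E2 (sc w ws).
    have [eX eY _] := evE _ idfun 0 w.
    rewrite bievalD !bievalM evR1 Q2E !bievalXn bievalCC eX eY /= hquo0 /=.
    have zq1 : (0 : k) ^+ q.-1 = 0.
      by rewrite expr0n gtn_eqF // -ltnS prednK // (leq_trans _ q_gt2).
    rewrite zq zq1 !mul0r !mulr0 !add0r !addr0.
    rewrite (hadd0r alpha hp) /= => /eqP.
    rewrite !mulf_eq0 (negPf a0) (negPf aq) !expf_eq0 (negPf (s0 w ws)) !andbF !orbF /=.
    by rewrite mulf_eq0 (negPf d0) (negPf (s0 w ws)) andbF orbF => /eqP.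
  have [w1 [w2 [w1s w2s w12]]] : exists w1 w2, [/\ w1 \in s, w2 \in s & w1 != w2].
    have : (1 < size s)%N by rewrite ss (leq_trans _ q_gt2).
    case: {ss s0 sc bg} s us => [|w1 [|w2 s]] //= /andP[+ _] _.
    rewrite inE negb_or => /andP[w12 _].
    by exists w1, w2; rewrite !inE !eqxx orbT.
  case/eqP: w12; apply: (mulfI g0); apply: (addrI b).
  by rewrite !bg.
have tc : topY (q + q) (biC k c * (X2 ^+ q.-1 * Y2 ^+ q)) 0.
  apply: topY_lt (topYM (topYC _) (topYM (topYXn q.-1 (topYC _)) (topYXn q topYX))) _.
  by rewrite mul0n mul1n !add0n -{1}[q]addn0 ltn_add2l.
have := bieval_topY pt E2 (topYD (topYM tR1 tQ2) tc) (x0 := 0).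
rewrite horner0_shift => /(_ u0).
have hquo_top : (hquo polyC 'X g%:P 1).[0] = hquo idfun 0 g 1.
  have := @rmorph_hquo _ _ polyC (horner_eval (0 : k)) idfun 'X g%:P 1.
  by rewrite /= /horner_eval hornerX !hornerC; apply=> a; rewrite hornerC.
rewrite addr0 hornerM hquo_top hquo0 /= expr1n mulr1.
rewrite hornerM hornerC horner_exp at_top => /eqP.
by rewrite !mulf_eq0 (negPf a0) (negPf g0) (negPf aq) expf_eq0 (negPf d0) andbF.
Qed.

End Concurrent.

(** Both sides have the same leading term, and their difference vanishes at the q roots of M. *)
Lemma scale_roots (k : closedFieldType) (q : nat) (M : {poly k}) (d : k) :
  sep_poly q M -> d != 0 -> (forall x0, M.[x0] = 0 -> M.[d * x0] = 0) ->
  M \Po (d *: 'X) = d ^+ q *: M.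
Proof.
move=> sM d0 rM; have [s [us ss rs]] := sep_poly_roots sM.
have sdX : size (d *: 'X : {poly k}) = 2 by rewrite size_scale // size_polyX.
have sMd : size (M \Po (d *: 'X)) = q.+1 by rewrite size_comp_poly2 // (proj1 sM).
have dq0 : d ^+ q != 0 by rewrite expf_neq0.
apply/eqP; rewrite -subr_eq0; apply/eqP; apply: (poly_eq0_many_roots us).
  rewrite ss -ltnS -sMd; apply: size_subl_lead.
  - by rewrite -size_poly_eq0 sMd.
  - by rewrite sMd size_scale // (proj1 sM).
  - rewrite lead_coef_comp ?sdX // lead_coefZ lead_coefX mulr1 (proj1 sM) lead_coefZ.
    by rewrite mulrC.
move=> w; rewrite rs => /eqP Mw.
by rewrite hornerD hornerN hornerZ Mw mulr0 subr0 horner_comp hornerZ hornerX rM.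
Qed.

Section ConcurrentGroup.
Context {k : closedFieldType} (p e : nat) (alpha : 'I_e.+1 -> k).
Hypotheses (hp : p \in [pchar k]) (e_gt0 : (0 < e)%N).
Hypothesis alpha_neq0 : alpha ord_max * alpha ord0 != 0.
Local Notation q := (p ^ e)%N.
Local Notation L := (additive_poly p alpha).
Hypothesis q_gt2 : (2 < q)%N.
Context {E : fieldType} (f : {rmorphism k -> E}) (u v c : k) (x y : E).
Hypothesis pt : generic_point f (L + u%:P) (L + v%:P) c q x y.
Hypothesis origin : u * v + c != 0.
Let x0 := gp_x_neq0 pt.
Let y0 := gp_x_neq0 (generic_point_swap pt).
Let c0 := gp_neq0 pt.

(** At the point (r, inf) the second factor has a pole, so the first one must vanish. *)
Lemma homothety_roots (g : k) (N : {poly k}) (z t : E) (w : k) :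
  generic_point f N (L + w%:P) c q z t -> g != 0 ->
  (map_poly f N).[f g * z] * (map_poly f (L + w%:P)).[f g * t] + f c = 0 ->
  forall r, N.[r] = 0 -> N.[g * r] = 0.
Proof.
move=> ptz g0 E0 r Nr.
pose Q := (N \Po (g *: 'X))%:P * (hadd p alpha (biC k) (biC k g * 'X) 1 + biC k w) + biC k c.
have Q0 : bieval f z t Q = 0.
  rewrite bievalD bievalM bievalD bieval_hadd bieval1 bievalM !bievalCC bievalX.
  rewrite bievalC map_comp_poly horner_comp map_polyZ /= map_polyX !hornerE.
  by rewrite -[RHS]E0 horner_shift.
have q_gt0 : (0 < q)%N by rewrite (leq_trans _ q_gt2).
have t1 : topY 1 (1 : {poly {poly k}}) 0 by apply: topY_lt (topYC 1) _.
have tQ : topY q Q ((N \Po (g *: 'X)) * ((alpha ord_max)%:P * g%:P ^+ q)).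
  rewrite -[q]add0n; apply: topY_eq.
    apply: topYD; last by apply: topY_lt (topYC _) _.
    apply: topYM; first exact: topYC.
    apply: topYD; last by apply: topY_lt (topYC _) _.
    by have := topY_hadd alpha hp (topYM (topYC g%:P) topYX) t1; rewrite mul1n; apply.
  by rewrite !addr0 mulr1 (hadd0r alpha hp) add0n.
have := bieval_topY ptz Q0 tQ Nr.
rewrite hornerM horner_comp hornerZ hornerX hornerM hornerC horner_exp hornerC => /eqP.
rewrite mulf_eq0 => /orP[/eqP //|]; move: alpha_neq0; rewrite !mulf_eq0 negb_or.
by rewrite expf_eq0 (negPf g0) andbF => /andP[/negPf ->].
Qed.

(** Since the homothety preserves both sets of roots, it multiplies each factor by g^q. Hence g^(2q)
    = 1, and g^2 = 1 because q is a power of the characteristic. *)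
Lemma homothety_sqr (g : k) : g != 0 ->
  (map_poly f (L + u%:P)).[f g * x] * (map_poly f (L + v%:P)).[f g * y] + f c = 0 ->
  g ^+ 2 = 1.
Proof.
move=> g0 E0; have rM := homothety_roots pt g0 E0.
have rN : forall r, (L + v%:P).[r] = 0 -> (L + v%:P).[g * r] = 0.
  by apply: (homothety_roots (generic_point_swap pt) g0); rewrite mulrC.
have EM := scale_roots (gp_sepl pt) g0 rM.
have EN := scale_roots (gp_sepr pt) g0 rN.
have ev (M : {poly k}) z : (map_poly f M).[f g * z] = (map_poly f (M \Po (g *: 'X))).[z].
  by rewrite map_comp_poly horner_comp map_polyZ /= map_polyX !hornerE.
move: E0; rewrite !ev EM EN !map_polyZ /= !hornerZ => E0.
have := gp_curve pt; set P := _.[x] in E0 *; set Q := _.[y] in E0 * => PQ.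
have E1 : f (g ^+ q) ^+ 2 * f c = f c.
  move/eqP: PQ; rewrite addr_eq0 => /eqP PQ.
  move/eqP: E0; rewrite addr_eq0 => /eqP E0.
  by apply: oppr_inj; rewrite -E0 -mulrN -PQ; ring.
have gq : (g ^+ 2) ^+ q = 1.
  apply: (fmorph_inj f); rewrite rmorph1 -exprM mulnC exprM rmorphXn /=.
  by apply: (mulIf (_ : f c != 0)); rewrite ?fmorph_eq0 // E1 mul1r.
have qnat : [pchar k].-nat q by rewrite pnatX (pnatE _ (pcharf_prime hp)) hp.
have : (g ^+ 2 - 1) ^+ q = 0.
  by rewrite exprDn_pchar // exprNn_pchar // expr1n gq subrr.
by move/eqP; rewrite expf_eq0 subr_eq0 => /andP[_ /eqP].
Qed.

Hypothesis xy_gen :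
  forall z, exists P Q, bieval f x y Q != 0 /\ z = bieval f x y P / bieval f x y Q.
Context {T : finType} (s : T -> {rmorphism E -> E}).
Hypothesis sM : forall g h, exists l, s l =1 s g \o s h.
Hypothesis s1 : exists g, s g =1 id.
Hypothesis sV : forall g, exists h, s h \o s g =1 id.
Hypothesis sf : forall g a, s g (f a) = f a.
Hypothesis st : forall g, s g (y / x) = y / x.
Hypothesis s_fixed : forall z, (forall g, s g z = z) -> z \in ratfun f (y / x).
Local Notation bil := (bilinear_form f x y).

Let s_horner g (P : {poly k}) z : s g (map_poly f P).[z] = (map_poly f P).[s g z].
Proof.
by rewrite -horner_map -map_poly_comp; congr (_.[_]); apply: eq_map_poly => a /=.
Qed.

Let s_curve g : (map_poly f (L + u%:P)).[s g x] * (map_poly f (L + v%:P)).[s g y] + f c = 0.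
Proof. by rewrite -!s_horner -(sf g c) -rmorphM -rmorphD (gp_curve pt) rmorph0. Qed.

Let sy g : s g y = y / x * s g x.
Proof. by rewrite -(st g) -rmorphM divfK. Qed.

Let s_neq0 g z : z != 0 -> s g z != 0. Proof. by rewrite fmorph_eq0. Qed.

Let conj g : conjugate_by p alpha f u v c x y (y * s g x).
Proof.
rewrite /conjugate_by; have -> : y * s g x / y = s g x by field.
have -> : y * s g x / x = s g y by rewrite sy; field.
exact: s_curve.
Qed.

Let coefs : exists w : T -> (k * k) * (k * k),
  forall g, y * s g x = bil (w g).1.1 (w g).1.2 (w g).2.1 (w g).2.2.
Proof.
pose R g (w : (k * k) * (k * k)) := y * s g x = bil w.1.1 w.1.2 w.2.1 w.2.2.
have /choice[w wP] : forall g, exists w, R g w; last by exists w.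
move=> g; have := integral_concurrent hp alpha_neq0 x0 y0 (conj g).
move=> /(integral_section_bilinear pt xy_gen)[a [b [d [m Em]]]].
by exists ((a, b), (d, m)).
Qed.

Let homothety_sign g m : s g x = f m * x -> s g x = x \/ s g x = - x.
Proof.
move=> gx; have m0 : m != 0.
  by have := s_neq0 g x0; rewrite gx mulf_eq0 negb_or fmorph_eq0 => /andP[].
have : m ^+ 2 = 1.
  apply: homothety_sqr m0 _; rewrite -gx.
  have -> : f m * y = s g y by rewrite sy gx; field.
  exact: s_curve.
move/eqP; rewrite sqrf_eq1 => /orP[] /eqP m1; [left|right].
  by rewrite gx m1 rmorph1 mul1r.
by rewrite gx m1 rmorphN1 mulN1r.
Qed.

Let orbit4 (l : seq E) : (forall g, s g x \in l) -> (2 * q <= size l)%N.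
Proof.
move=> xl; apply: (orbit_size sM s1 s_fixed _ xl); apply: ratfun_degree => H.
by apply: (degree_concurrent pt); rewrite !(horner0_shift alpha hp).
Qed.

Lemma no_concurrent_group : False.
Proof.
have [w Ew] := coefs.
(* Apply s h to the bilinear expression of y (s g x), use s h y = (y / x) (s h x), and multiply by x
   y. *)
have comp g h l : s l =1 s h \o s g -> f (w g).1.1 * (x * y)
    = (y * s h x) * (y * s l x - f (w g).1.2 * x - f (w g).2.1 * y - f (w g).2.2 * (y * s h x)).
  move=> lE; have := congr1 (s h) (Ew g).
  rewrite /bilinear_form rmorphM !rmorphD !rmorphM /= !sf sy.
  have -> : s h (s g x) = s l x by rewrite lE.
  set a := f (w g).1.1; set b := f (w g).1.2; set d := f (w g).2.1; set m := f (w g).2.2.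
  move=> E1; have -> : a = y / x * s h x * s l x - b * s h x - d * (y / x * s h x)
      - m * (s h x * (y / x * s h x)) by rewrite E1; ring.
  by field.
(* If some s g0 has a nonzero coefficient on 1, comp factors xy into y (s h x)  *)
(* and another bilinear form, which leaves few possibilities for s h x.         *)
have [[g0 a0]|no_a] := pselect (exists g, (w g).1.1 != 0).
  have types h : (exists a, s h x = f a / y) \/ (exists m, s h x = f m * x).
    have [l lE] := sM h g0.
    have := comp g0 h l lE; set m := (w g0).2.2 => E1.
    have E2 : bil (w h).1.1 (w h).1.2 (w h).2.1 (w h).2.2
        * bil ((w l).1.1 - m * (w h).1.1) ((w l).1.2 - (w g0).1.2 - m * (w h).1.2)
            ((w l).2.1 - (w g0).2.1 - m * (w h).2.1) ((w l).2.2 - m * (w h).2.2)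
        = f (w g0).1.1 * (x * y).
      by rewrite E1 (Ew h) (Ew l) /bilinear_form !rmorphB !rmorphM; ring.
    have x_shx : s h x = y * s h x / y by field.
    case: (bilinear_form_divides pt q_gt2 a0 E2); rewrite -(Ew h) => E3.
    - by left; exists (w h).1.1; rewrite x_shx E3.
    - case: (gp_x_nconst (generic_point_swap pt) (a := (w h).1.2)).
      apply: (fmorph_inj (s h)); rewrite sf sy; apply: (mulIf x0).
      by rewrite -E3; field.
    - case: (gp_x_nconst pt (a := (w h).2.1)).
      apply: (fmorph_inj (s h)); rewrite sf x_shx E3; by field.
    - by right; exists (w h).2.2; rewrite x_shx E3; field.
  have signs g m : s g x = f m * x -> s g x \in [:: x; - x].
    by move=> /homothety_sign[] ->; rewrite !inE eqxx ?orbT.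
  have [[h0 [a1 h0x]]|no_h] := pselect (exists h a, s h x = f a / y); last first.
    suff /orbit4 : forall g, s g x \in [:: x; - x] by rewrite /=; move: q_gt2; lia.
    move=> g; have [[a gx]|[m /signs //]] := types g.
    by case: no_h; exists g, a.
  (* Composing x |-> a1 / y with x |-> a / y gives the homothety of ratio a1 / a, hence a = a1 or a
     = - a1. *)
  suff /orbit4 : forall g, s g x \in [:: x; - x; f a1 / y; - (f a1 / y)].
    by rewrite /=; move: q_gt2; lia.
  move=> g; have [[a gx]|[m /signs]] := types g; last first.
    by rewrite !inE => /orP[] ->; rewrite ?orbT.
  have [l lE] := sM g h0.
  have a10 : f a1 != 0.
    by have := s_neq0 h0 x0; rewrite h0x mulf_eq0 negb_or => /andP[].
  have a0' : f a != 0.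
    by have := s_neq0 g x0; rewrite gx mulf_eq0 negb_or => /andP[].
  have lx : s l x = f (a1 / a) * x.
    rewrite lE /= h0x fmorph_div sf sy gx fmorph_div.
    by field; rewrite a0' x0 y0.
  have Ea : f a / y = f a1 / y * x / (f (a1 / a) * x).
    by rewrite fmorph_div; field; rewrite a0' a10 x0 y0.
  have [lx1|lx1] := homothety_sign lx; rewrite gx Ea -lx lx1.
    by rewrite mulfK // !inE eqxx !orbT.
  by rewrite invrN mulrN mulfK // !inE eqxx !orbT.
have A0 g : (w g).1.1 = 0.
  by apply/eqP; apply: contraT => ag; case: no_a; exists g.
(* With no constant terms, [comp] for g and its inverse h compares the coefficients of x y: those of
   g and h multiply to 1. So [conjugate_axis] applies on both axes and s g is a homothety. *)
suff /orbit4 : forall g, s g x \in [:: x; - x] by rewrite /=; move: q_gt2; lia.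
move=> g; have [h hg] := sV g.
have [l lE] := sM h g.
have lx : s l x = x by rewrite lE hg.
have sx0 := s_neq0 h x0.
have g0 : (w g).2.2 != 0.
  have := comp g h l lE; rewrite A0 rmorph0 mul0r lx => /esym/eqP.
  rewrite !mulf_eq0 (negPf y0) (negPf sx0) /= => /eqP E1.
  have [] := bilinear_form_inj pt q_gt2 (a := 0) (b := 0) (d := 0) (e := 1)
      (a' := 0) (b' := (w g).1.2 + (w g).2.2 * (w h).1.2)
      (d' := (w g).2.1 + (w g).2.2 * (w h).2.1) (e' := (w g).2.2 * (w h).2.2).
    apply/eqP; rewrite -subr_eq0 -[X in _ == X]E1 (Ew h) A0 /bilinear_form.
    by rewrite !rmorph0 rmorph1 !rmorphD !rmorphM; apply/eqP; ring.
  move=> _ _ _ E2; apply/eqP => g0; move/eqP: E2; rewrite g0 mul0r.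
  by rewrite oner_eq0.
have Eg : y * s g x = f (w g).1.2 * x + f (w g).2.1 * y + f (w g).2.2 * (x * y).
  by rewrite Ew A0 /bilinear_form rmorph0 add0r.
have d0 : (w g).2.1 = 0.
  apply: (conjugate_axis hp alpha_neq0 q_gt2 pt origin g0).
  by have := conj g; rewrite Eg; apply.
have b0 : (w g).1.2 = 0.
  apply: (conjugate_axis hp alpha_neq0 q_gt2 (generic_point_swap pt) _ g0 (b := (w g).2.1)).
    by rewrite mulrC.
  have := conj g; rewrite /conjugate_by Eg mulrC [y * x]mulrC.
  by rewrite [f (w g).2.1 * y + _]addrC.
have /homothety_sign : s g x = f (w g).2.2 * x.
  by apply: (mulfI y0); rewrite Eg b0 d0 !rmorph0 !mul0r !add0r; ring.
by case=> ->; rewrite !inE eqxx ?orbT.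
Qed.

End ConcurrentGroup.

(** * Centres on the line at infinity *)

Section Parallel.
Context {k : closedFieldType} (p e : nat) (alpha : 'I_e.+1 -> k).
Hypotheses (hp : p \in [pchar k]) (e_gt0 : (0 < e)%N).
Hypothesis alpha_neq0 : alpha ord_max * alpha ord0 != 0.
Local Notation q := (p ^ e)%N.
Local Notation L := (additive_poly p alpha).
Hypothesis q_gt2 : (2 < q)%N.
Context {E : fieldType} (f : {rmorphism k -> E}) (c : k).

Let aq : alpha ord_max != 0. Proof. by move: alpha_neq0; rewrite mulf_eq0 negb_or => /andP[]. Qed.
Let q_gt0 : (0 < q)%N. Proof. by rewrite (leq_trans _ q_gt2). Qed.

Lemma horner_additive_id z : L.[z] = hadd p alpha idfun z 1.
Proof. by rewrite -(horner_additive p alpha idfun z) map_poly_id. Qed.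

Lemma additive_horner0 : L.[0] = 0.
Proof. by rewrite horner_additive_id (hadd0l alpha hp). Qed.

(** Evaluation at (0, inf), which is on the closure because L(0) = 0: the two coordinates cannot
    both have a pole, and if only the second has one then the first, whose value is a1, is a root of
    L. *)
Lemma affine_conjugate_top (x y : E) (a1 b1 d1 a2 b2 d2 : k) :
  generic_point f L L c q x y ->
  (map_poly f L).[f a1 + f b1 * x + f d1 * y]
    * (map_poly f L).[f a2 + f b2 * x + f d2 * y] + f c = 0 ->
  d1 * d2 = 0 /\ (d1 = 0 -> d2 != 0 -> L.[a1] = 0).
Proof.
rewrite !horner_additive => pt E0.
pose X2 : {poly {poly k}} := 'X%:P.
pose Z a b d : {poly {poly k}} := biC k a + biC k b * X2 + biC k d * 'X.
pose Q := hadd p alpha (biC k) (Z a1 b1 d1) 1 * hadd p alpha (biC k) (Z a2 b2 d2) 1 + biC k c.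
have Q0 : bieval f x y Q = 0.
  have eX : bieval f x y X2 = x by rewrite bievalC map_polyX hornerX.
  have eZ a b d : bieval f x y (Z a b d) = f a + f b * x + f d * y.
    by rewrite !bievalD !bievalM !bievalCC eX bievalX.
  by rewrite bievalD bievalM !bieval_hadd bieval1 !eZ bievalCC.
have t1 : topY 1 (1 : {poly {poly k}}) 0 by apply: topY_lt (topYC 1) _.
have tc n : (0 < n)%N -> topY n (biC k c) 0 by move=> n0; apply: topY_lt (topYC _) n0.
have tZ a b d : topY 1 (Z a b d) d%:P.
  apply: topY_eq.
    apply: topYD; last exact: topYM (topYC _) topYX.
    apply: topYD; first by apply: topY_lt (topYC _) _.
    by apply: topY_lt (topYM (topYC _) (topYC _)) _.
  by rewrite !add0r mulr1.
have tH a b d : topY q (hadd p alpha (biC k) (Z a b d) 1) ((alpha ord_max * d ^+ q)%:P).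
  apply: topY_eq; first by have := topY_hadd alpha hp (tZ a b d) t1; rewrite mul1n; apply.
  by rewrite (hadd0r alpha hp) polyCM polyC_exp.
split.
  have := bieval_topY pt Q0 (topYD (topYM (tH _ _ _) (tH _ _ _)) (tc _ _)) additive_horner0.
  rewrite addn_gt0 q_gt0 => /(_ isT) /eqP.
  rewrite addr0 -polyCM hornerC !mulf_eq0 (negPf aq) !expf_eq0 q_gt0 /=.
  by case/orP => /eqP ->; rewrite ?mul0r ?mulr0.
move=> d10 d20; pose R := hadd p alpha polyC (a1%:P + b1%:P * 'X) 1.
have tR : topY 0 (hadd p alpha (biC k) (Z a1 b1 d1) 1) R.
  have <- : R%:P = hadd p alpha (biC k) (Z a1 b1 d1) 1; last exact: topYC.
  have := @rmorph_hadd _ p _ alpha _ _ polyC polyC (biC k) (a1%:P + b1%:P * 'X) 1.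
  rewrite rmorph1 => -> //; congr hadd.
  by rewrite /Z d10 rmorphD rmorphM rmorph0 /= mul0r addr0.
have tQ := topYD (topYM tR (tH a2 b2 d2)) (tc _ q_gt0).
have := bieval_topY pt Q0 tQ additive_horner0.
rewrite addr0 hornerM hornerC => /eqP; rewrite !mulf_eq0 (negPf aq) expf_eq0 (negPf d20).
rewrite andbF !orbF => /eqP R0; rewrite -[RHS]R0 horner_additive_id.
have := @rmorph_hadd _ p _ alpha _ _ polyC (horner_eval (0 : k)) idfun (a1%:P + b1%:P * 'X) 1.
rewrite /= /horner_eval !hornerE => -> // a; by rewrite hornerC.
Qed.

Context (x y : E) (m : k).
Hypotheses (pt : generic_point f L L c q x y) (m0 : m != 0).
Let c0 := gp_neq0 pt.
Let fm0 : f m != 0. Proof. by rewrite fmorph_eq0. Qed.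

(** The second coordinate is m s(x) + y - m x. Looking at (0, inf) and at (inf, 0) gives d (1 + m d)
    = 0 and b (b - 1) = 0; two of the four cases make one coordinate a constant root of L, which c
    != 0 excludes. *)
Lemma affine_conjugate (a b d : k) :
  (map_poly f L).[f a + f b * x + f d * y]
    * (map_poly f L).[f (m * a) + f (m * (b - 1)) * x + f (1 + m * d) * y] + f c = 0 ->
  [/\ L.[a] = 0, L.[m * a] = 0 & (b = 1 /\ d = 0) \/ (b = 0 /\ d = - m^-1)].
Proof.
move=> E0; have fc0 : f c <> 0 by apply/eqP; rewrite fmorph_eq0.
have E0s : (map_poly f L).[f (m * a) + f (m * (b - 1)) * x + f (1 + m * d) * y]
    * (map_poly f L).[f a + f b * x + f d * y] + f c = 0 by rewrite mulrC.
have pts := generic_point_swap pt.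
have rot (a' b' d' : k) : f a' + f b' * x + f d' * y = f a' + f d' * y + f b' * x by ring.
have [Y12 Y1] := affine_conjugate_top pt E0.
have [_ Y2] := affine_conjugate_top pt E0s.
move: (E0) (E0s); rewrite !(rot a) !(rot (m * a)) => F0 F0s.
have [X12 X1] := affine_conjugate_top pts F0.
have [_ X2] := affine_conjugate_top pts F0s.
have horner_const w : L.[w] = 0 -> (map_poly f L).[f w + f 0 * x + f 0 * y] = 0.
  by move=> Lw; rewrite !rmorph0 !mul0r !addr0 horner_map Lw rmorph0.
have b01 : b = 0 \/ b = 1.
  move/eqP: X12; rewrite !mulf_eq0 (negPf m0) subr_eq0 => /orP[] /eqP; by [left|right].
have d01 : d = 0 \/ d = - m^-1.
  move/eqP: Y12; rewrite mulf_eq0 addrC addr_eq0 => /orP[] /eqP; [by left|right].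
  by apply: (mulfI m0); rewrite mulrN divff.
case: b01 d01 => b_ [] d_; rewrite b_ d_ in E0 Y1 Y2 X1 X2 *.
- have La : L.[a] = 0 by apply: Y1; rewrite // mulr0 addr0 oner_neq0.
  by case: fc0; move: E0; rewrite (horner_const _ La) mul0r add0r.
- have La : L.[a] = 0 by apply: X1; rewrite // sub0r mulrN1 oppr_eq0.
  have Lma : L.[m * a] = 0.
    by apply: Y2; rewrite ?oppr_eq0 ?invr_eq0 // mulrN divff // subrr.
  by split=> //; right.
- have La : L.[a] = 0 by apply: Y1; rewrite // mulr0 addr0 oner_neq0.
  have Lma : L.[m * a] = 0 by apply: X2; rewrite ?oner_neq0 // subrr mulr0.
  by split=> //; left.
- have Lma : L.[m * a] = 0.
    by apply: Y2; rewrite ?oppr_eq0 ?invr_eq0 // mulrN divff // subrr.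
  case: fc0; move: E0; rewrite subrr mulr0 mulrN divff // subrr.
  by rewrite (horner_const _ Lma) mulr0 add0r.
Qed.

Hypothesis xy_gen :
  forall z, exists P Q, bieval f x y Q != 0 /\ z = bieval f x y P / bieval f x y Q.
Context {T : finType} (s : T -> {rmorphism E -> E}).
Hypothesis sM : forall g h, exists l, s l =1 s g \o s h.
Hypothesis s1 : exists g, s g =1 id.
Hypothesis sf : forall g a, s g (f a) = f a.
Hypothesis st : forall g, s g (y - f m * x) = y - f m * x.
Hypothesis s_fixed : forall z, (forall g, s g z = z) -> z \in ratfun f (y - f m * x).

(** L(m X) = m^q L(X), compared coefficient by coefficient; the index 0 gives m = m^q. *)
Lemma additive_scale_coef : (forall a, L.[a] = 0 -> L.[m * a] = 0) ->
  forall i, alpha i != 0 -> m ^+ (p ^ i) = m.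
Proof.
move=> rL; have Em := scale_roots (sep_additive_poly hp alpha_neq0) m0 rL.
pose beta i := alpha i * m ^+ (p ^ i).
have EL : additive_poly p beta = m ^+ q *: L.
  rewrite -Em /additive_poly raddf_sum; apply: eq_bigr => i _ /=.
  by rewrite comp_polyZ comp_Xn_poly exprZn scalerA.
have key i : alpha i != 0 -> m ^+ (p ^ i) = m ^+ q.
  move=> ai; have := congr1 (fun P : {poly k} => P`_(p ^ i)) EL.
  rewrite coefZ !(coef_additive_pexp _ hp) /beta mulrC => /mulIf; exact.
have a00 : alpha ord0 != 0 by move: alpha_neq0; rewrite mulf_eq0 negb_or => /andP[].
by move=> i /key ->; rewrite -(key _ a00) expr1.
Qed.

Lemma parallel_group_slope : forall i, alpha i != 0 -> m ^+ (p ^ i) = m.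
Proof.
have s_horner g (P : {poly k}) z : s g (map_poly f P).[z] = (map_poly f P).[s g z].
  by rewrite -horner_map -map_poly_comp; congr (_.[_]); apply: eq_map_poly => a /=.
have s_curve g : (map_poly f L).[s g x] * (map_poly f L).[s g y] + f c = 0.
  by rewrite -!s_horner -(sf g c) -rmorphM -rmorphD (gp_curve pt) rmorph0.
have sy g : s g y = f m * s g x + (y - f m * x).
  by have := st g; rewrite rmorphB rmorphM /= sf => <-; ring.
have coefs g : exists a b d e' : k, s g x = bilinear_form f x y a b d e'.
  apply: (integral_section_bilinear pt xy_gen).
  by apply: (integral_parallel hp alpha_neq0 m0 (c := c)); rewrite -sy.
have types g : exists a, [/\ L.[a] = 0, L.[m * a] = 0 &
    s g x = x + f a \/ s g x = f a - f m^-1 * y].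
  have [a [b [d [e' Eg]]]] := coefs g.
  (* In s g (s g x) the coefficient of x^2 y^2 is m e'^3, yet the composite is again a conjugate,
     hence bilinear. *)
  have e'0 : e' = 0.
    have [l lE] := sM g g; have [al [bl [dl [el El]]]] := coefs l.
    have : s l x = s g (s g x) by rewrite lE.
    rewrite El [in RHS]Eg /bilinear_form !rmorphD !rmorphM /= !sf sy Eg => E1.
    (* A i j is the coefficient of x^j y^i in s g (s g x) - s l x. *)
    pose A i j := nth 0 (nth [::] [::
      [:: a + b * a + d * m * a + e' * m * (a * a) - al;
          b * b + d * m * b - d * m + e' * (m * (a * b + a * b) - m * a) - bl;
          e' * (m * (b * b) - m * b)];
      [:: b * d + d + d * m * d + e' * (a + m * (a * d + a * d)) - dl;
          b * e' + d * m * e' + e' * (b + m * (a * e' + a * e' + b * d + b * d) - m * d) - el;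
          e' * (m * (b * e' + b * e') - m * e')];
      [:: e' * (d + m * (d * d)); e' * (e' + m * (d * e' + d * e')); e' * (m * (e' * e'))]] i) j.
    have : A 2%N 2%N = 0.
      apply: (coef_eq0_deg2 pt q_gt2 (a := A)) => //.
      rewrite !big_ord_recl !big_ord0 /= /A /=.
      rewrite !(rmorphB, rmorphD, rmorphM) /=.
      apply/eqP; rewrite -[X in _ == X](subrr (bilinear_form f x y al bl dl el)).
      rewrite [X in _ == X - _]/bilinear_form E1 /bilinear_form /bump /=.
      by apply/eqP; ring.
    rewrite /A /= => /eqP; rewrite !mulf_eq0 (negPf m0) /=.
    by rewrite !orbb => /eqP.
  move: Eg; rewrite e'0 /bilinear_form rmorph0 mul0r addr0 => Eg.
  have := s_curve g; rewrite sy Eg.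
  have -> : f m * (f a + f b * x + f d * y) + (y - f m * x)
      = f (m * a) + f (m * (b - 1)) * x + f (1 + m * d) * y.
    by rewrite !(rmorphM, rmorphB, rmorphD, rmorph1); ring.
  move=> /affine_conjugate[La Lma bd]; exists a; split=> //.
  case: bd => -[-> ->]; [left|right].
    by rewrite rmorph1 rmorph0; ring.
  by rewrite rmorph0 rmorphN; ring.
apply: additive_scale_coef.
have [r [ur sr rr]] := sep_poly_roots (sep_additive_poly hp alpha_neq0).
(* The orbit has at most 2 [size r'] elements and at least 2q, so every root a of L satisfies L(m a)
   = 0. *)
pose r' := [seq a <- r | L.[m * a] == 0].
pose l := [seq x + f a | a <- r'] ++ [seq f a - f m^-1 * y | a <- r'].
have orb g : s g x \in l.
  have [a [La Lma Eg]] := types g.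
  have ar : a \in r' by rewrite mem_filter rr La Lma eqxx.
  by rewrite mem_cat; case: Eg => ->; apply/orP; [left|right]; apply/mapP; exists a.
have : (2 * q <= size l)%N.
  apply: (orbit_size sM s1 s_fixed _ orb); apply: ratfun_degree => H.
  exact: (degree_parallel pt m0).
rewrite size_cat !size_map addnn -mul2n.
rewrite leq_pmul2l // -sr size_filter => r'r a La.
have /allP/(_ a) : all (fun a => L.[m * a] == 0) r by rewrite all_count eqn_leq count_size.
by rewrite rr La eqxx => /(_ isT)/eqP.
Qed.

End Parallel.

(** * Slopes whose projection is Galois *)

(** The abstract field K0[X] / (P) maps onto E because x generates E; pulling back the roots [l]
    shows that it is a splitting field of the separable polynomial P. *)
Lemma splitting_galois_over (K0 E : fieldType) (iota : {rmorphism K0 -> E}) (x : E)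
    (P : {poly K0}) (l : seq E) (a : E) :
  irreducible_poly P -> uniq l -> a != 0 -> x \in l ->
  map_poly iota P = a *: \prod_(z <- l) ('X - z%:P) ->
  (forall z, exists Q R : {poly K0}, z = (map_poly iota Q).[x] / (map_poly iota R).[x]) ->
  galois_over (range iota).
Proof.
move=> irrP ul a0 xl EP surj.
have Px : root (map_poly iota P) x by rewrite EP rootZ // root_prod_XsubC.
have nzP := irredp_neq0 irrP.
pose FE := SubFieldExtType Px irrP.
pose phi : {rmorphism FE -> E} := @subfx_inj K0 E iota x P.
have phiQ (Q : {poly K0}) : phi (subfx_eval iota x P Q : FE) = (map_poly iota Q).[x].
  exact: subfx_inj_eval.
have phi_base b : phi (b%:A : FE) = iota b by exact: subfx_inj_base.
have phi_inj : injective phi by exact: fmorph_inj.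
have [psi psiK] : exists psi : E -> FE, cancel psi phi.
  have /choice[psi Hpsi] : forall z, exists u : FE, phi u = z; last by exists psi.
  move=> z; have [Q [R ->]] := surj z.
  exists ((subfx_eval iota x P Q : FE) / (subfx_eval iota x P R : FE)).
  by rewrite fmorph_div !phiQ.
have phiK : cancel phi psi by move=> u; apply: phi_inj; rewrite psiK.
pose P1 := map_poly (in_alg FE) P; pose rs := map psi l.
have mP1 : map_poly phi P1 = map_poly iota P.
  by rewrite -map_poly_comp; apply: eq_map_poly => b; exact: phi_base.
have ma : map_poly phi (\prod_(z <- rs) ('X - z%:P)) = \prod_(z <- l) ('X - z%:P).
  rewrite rmorph_prod big_map; apply: eq_bigr => z _ /=.
  by rewrite rmorphB /= map_polyX map_polyC /= psiK.
have splitP : P1 %= \prod_(z <- rs) ('X - z%:P).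
  by rewrite -(eqp_map phi) mP1 ma EP eqp_scale.
have P1K : P1 \is a polyOver 1%VS by apply/polyOver1P; exists P.
have rs_gen : <<1 & rs>>%VS = fullv :> {vspace FE}.
  apply/eqP; rewrite eqEsubv subvf /=; apply/subvP => u _.
  have [Q ->] := subfxEroot Px nzP u.
  have -> : subfx_root iota x P = psi x.
    by apply: phi_inj; rewrite psiK; exact: subfx_inj_root.
  apply: rpred_horner.
    by apply: (polyOverSv (sub1v _)); apply/polyOver1P; exists Q.
  by apply: seqv_sub_adjoin; exact: map_f.
have sfor : splittingFieldFor 1 P1 {:FE} by exists rs.
have ax : splitting_field_axiom FE by exists P1.
pose SF : splittingFieldType K0 :=
  HB.pack FE (FieldExt_isSplittingField.Build K0 FE ax).
exists K0, SF, phi; split.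
- by exists psi.
- by apply/seteqP; split=> _ [b _ <-]; exists b.
apply/splitting_galoisField; exists P1; split=> //.
rewrite (eqp_separable splitP) separable_prod_XsubC map_inj_uniq //.
exact: can_inj psiK.
Qed.

Section GaloisPoint.
Context {k : closedFieldType} (p e : nat) (alpha : 'I_e.+1 -> k).
Hypotheses (hp : p \in [pchar k]) (e_gt0 : (0 < e)%N).
Hypothesis alpha_neq0 : alpha ord_max * alpha ord0 != 0.
Local Notation q := (p ^ e)%N.
Local Notation L := (additive_poly p alpha).
Context {E : fieldType} (f : {rmorphism k -> E}) (c m : k) (x y : E).
Hypotheses (pt : generic_point f L L c q x y) (m0 : m != 0).
Hypothesis hm : forall i, alpha i != 0 -> m ^+ (p ^ i) = m.
Let c0 := gp_neq0 pt.
Let fm0 : f m != 0. Proof. by rewrite fmorph_eq0. Qed.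
Let t := y - f m * x.
Local Notation LE := (map_poly f L).

Let LED z w : LE.[z + w] = LE.[z] + LE.[w].
Proof. by rewrite !horner_additive (haddD alpha hp). Qed.

Let LEN z : LE.[- z] = - LE.[z].
Proof. by rewrite !horner_additive (haddN alpha hp). Qed.

Let LEm z : LE.[f m * z] = f m * LE.[z].
Proof.
rewrite !horner_additive /hadd mulr_sumr; apply: eq_bigr => i _.
have [->|ai] := eqVneq (alpha i) 0; first by rewrite rmorph0 !mul0r mulr0.
by rewrite exprMn -rmorphXn /= hm //; ring.
Qed.

Let LEt : LE.[t] = LE.[y] - f m * LE.[x].
Proof. by rewrite LED LEN LEm. Qed.

Lemma root_map_additive z : LE.[z] = 0 -> exists2 a, L.[a] = 0 & z = f a.
Proof.
have [l El] := closed_field_poly_normal L.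
have L0 : lead_coef L != 0.
  by rewrite lead_coef_eq0 -size_poly_eq0 (proj1 (sep_additive_poly hp alpha_neq0)).
rewrite El map_polyZ /= hornerZ => /eqP; rewrite mulf_eq0 fmorph_eq0 (negPf L0) /=.
rewrite rmorph_prod /= horner_prod prodf_seq_eq0 => /hasP[a al].
rewrite rmorphB /= map_polyX map_polyC !hornerE subr_eq0 => /eqP ->; exists a => //.
by apply/rootP; rewrite rootZ // root_prod_XsubC.
Qed.

Lemma parallel_automorphism (s : {rmorphism E -> E}) :
  (forall a, s (f a) = f a) -> s t = t ->
  exists2 a, L.[a] = 0 & (s x = x + f a /\ s y = y + f (m * a))
                      \/ (s x = f a - f m^-1 * y /\ s y = f (m * a) - f m * x).
Proof.
move=> sf st.
have s_horner (P : {poly k}) z : s (map_poly f P).[z] = (map_poly f P).[s z].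
  by rewrite -horner_map -map_poly_comp; congr (_.[_]); apply: eq_map_poly => a /=.
have s_curve : LE.[s x] * LE.[s y] + f c = 0.
  by rewrite -!s_horner -(sf c) -rmorphM -rmorphD (gp_curve pt) rmorph0.
have sy : s y = f m * s x + t.
  by have := st; rewrite /t rmorphB rmorphM /= sf => <-; ring.
(* Both L(s x) and L(x) are roots of the quadratic T (m T + L(t)) + c, and the second root is - L(y)
   / m. *)
have /eqP : (LE.[s x] - LE.[x]) * (f m * LE.[s x] + LE.[y]) = 0.
  have := s_curve; rewrite sy LED LEm LEt => E1.
  rewrite -[RHS](subrr (0 : E)) -{1}E1 -(gp_curve pt); ring.
rewrite mulf_eq0 => /orP[].
  rewrite -LEN -LED => /eqP /root_map_additive[a La Ea]; exists a => //; left.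
  have sx : s x = x + f a by rewrite -Ea; ring.
  by split=> //; rewrite sy sx /t rmorphM; ring.
rewrite -LEm -LED => /eqP /root_map_additive[a La Ea].
have La' : L.[a / m] = 0.
  apply: (fmorph_inj f); rewrite rmorph0 -horner_map; apply: (mulfI fm0).
  by rewrite mulr0 -LEm -rmorphM mulrCA divff // mulr1 horner_map La rmorph0.
exists (a / m) => //; right.
have sx : s x = f (a / m) - f m^-1 * y.
  by rewrite fmorph_div fmorphV -Ea; field.
split=> //; rewrite sy sx /t rmorphM !fmorph_div fmorphV; by field.
Qed.

Hypothesis q_gt2 : (2 < q)%N.
Hypothesis xy_gen :
  forall z, exists P Q, bieval f x y Q != 0 /\ z = bieval f x y P / bieval f x y Q.

(** The polynomial [B](z) = L(z) (m L(z) + L(t)) + c over k(t) has degree 2q and the 2q distinct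
    roots x + a and a - y / m with L(a) = 0. It is irreducible because x already has degree at least
    2q, and y = t + m x makes x a generator. *)
Lemma parallel_galois_over : galois_over [set a | a \in ratfun f t].
Proof.
pose K0 : fieldType := subfield_of (ratfun f t).
pose iota : {rmorphism K0 -> E} := (val : K0 -> E).
have iotaK a : a \in ratfun f t -> exists b : K0, iota b = a.
  by move=> Ka; exists (SubfieldOf Ka).
have rangeK : [set a | a \in ratfun f t] = range iota.
  apply/seteqP; split=> [a /= /iotaK[b <-]|_ [b _ <-]]; first by exists b.
  exact: (valP b).
have [r [ur sr rr]] := sep_poly_roots (sep_additive_poly hp alpha_neq0).
pose l := [seq x + f a | a <- r] ++ [seq f a - f m^-1 * y | a <- r].
pose B := LE * (f m *: LE + (LE.[t])%:P) + (f c)%:P.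
have sLE : size LE = q.+1 by rewrite size_map_poly (proj1 (sep_additive_poly hp alpha_neq0)).
have LE0 : LE != 0 by rewrite -size_poly_eq0 sLE.
have sl : size l = (q + q)%N by rewrite size_cat !size_map sr.
have q_gt0 : (0 < q)%N by rewrite (leq_trans _ q_gt2).
have sB : size B = (q + q).+1.
  have s2 : size (f m *: LE + (LE.[t])%:P) = q.+1.
    by rewrite size_polyDl ?size_scale // sLE ltnS (leq_trans (size_polyC_leq1 _)).
  have n2 : f m *: LE + (LE.[t])%:P != 0 by rewrite -size_poly_eq0 s2.
  have s12 : size (LE * (f m *: LE + (LE.[t])%:P)) = (q + q).+1.
    by rewrite size_mul // sLE s2 addnS addSn.
  by rewrite size_polyDl // s12 ltnS (leq_trans (size_polyC_leq1 _)) // addn_gt0 q_gt0.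
have B0 : B != 0 by rewrite -size_poly_eq0 sB.
have BK : B \is a polyOver (ratfun f t).
  have LEK : LE \is a polyOver (ratfun f t).
    by apply/polyOverP => i; rewrite coef_map ratfun_const.
  have CK a : a \in ratfun f t -> a%:P \is a polyOver (ratfun f t) by rewrite polyOverC.
  apply: rpredD; last by apply: CK; exact: ratfun_const.
  apply: rpredM => //; apply: rpredD; last by apply: CK; exact: ratfun_poly.
  by rewrite -mul_polyC; apply: rpredM => //; apply: CK; exact: ratfun_const.
have Bz z : B.[z] = LE.[z] * LE.[f m * z + t] + f c.
  by rewrite (LED (f m * z) t) LEm hornerD hornerM hornerD hornerZ !hornerC.
have Broot z : z \in l -> B.[z] = 0.
  rewrite mem_cat Bz => /orP[] /mapP[a]; rewrite rr => /eqP La ->.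
    have fa : LE.[f a] = 0 by rewrite horner_map La rmorph0.
    have -> : f m * (x + f a) + t = y + f m * f a by rewrite /t; ring.
    by rewrite !LED LEm fa mulr0 !addr0 (gp_curve pt).
  have fa : LE.[f a] = 0 by rewrite horner_map La rmorph0.
  have -> : f m * (f a - f m^-1 * y) + t = f m * f a - f m * x.
    by rewrite /t fmorphV; field.
  have -> : f a - f m^-1 * y = - (f m^-1 * y) + f a by ring.
  rewrite !LED !LEN !LEm fa mulr0 add0r addr0.
  have -> : LE.[f m^-1 * y] = (f m)^-1 * LE.[y].
    by apply: (mulfI fm0); rewrite -LEm mulrA fmorphV divff // mul1r mulVKf.
  have := gp_curve pt => /eqP; rewrite addrC addr_eq0 => /eqP ->.
  by field.
have xl : x \in l.
  rewrite mem_cat; apply/orP; left; apply/mapP; exists 0; last by rewrite rmorph0 addr0.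
  by rewrite rr (additive_horner0 alpha hp).
have ul : uniq l.
  rewrite cat_uniq !map_inj_uniq ?ur /=; last 2 first.
  - by move=> a b /addIr /fmorph_inj.
  - by move=> a b /addrI /fmorph_inj.
  rewrite andbT; apply/hasPn => _ /mapP[b br ->]; apply/negP => /mapP[a ar E1].
  have E2 : bilinear_form f x y (b - a) (-1) (- m^-1) 0 = bilinear_form f x y 0 0 0 0.
    rewrite /bilinear_form !rmorph0 !rmorphN rmorph1 rmorphB; move/eqP: E1.
    by rewrite -subr_eq0 => /eqP E1; rewrite -[RHS]addr0 -[X in _ = _ + X]E1; ring.
  have [_ /eqP + _ _] := bilinear_form_inj pt q_gt2 E2.
  by rewrite oppr_eq0 oner_eq0.
have EB : B = lead_coef B *: \prod_(z <- l) ('X - z%:P).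
  apply: all_roots_prod_XsubC; first by rewrite sB sl.
    by apply/allP => z /Broot /rootP.
  by rewrite uniq_rootsE.
have deg (P : {poly E}) : P != 0 -> (forall i, P`_i \in ratfun f t) -> P.[x] = 0 ->
    (2 * q < size P)%N.
  by apply: ratfun_degree => H; apply: (degree_parallel pt m0).
pose P := map_poly (fun a => insubd (0 : K0) a) B.
have EP : map_poly iota P = B.
  apply/polyP => i; rewrite coef_map coef_map_id0 /=.
    by rewrite insubdK //; apply: (polyOverP BK).
  by apply: val_inj; rewrite insubdK ?rpred0 ?rmorph0.
have sP : size P = (q + q).+1 by rewrite -sB -EP size_map_poly.
have irrP : irreducible_poly P.
  split=> [|Q sQ1 /dvdpP[R ER]]; first by rewrite sP ltnS addn_gt0 q_gt0.
  have P0 : P != 0 by rewrite -size_poly_eq0 sP.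
  have /andP[R0 Q0] : (R != 0) && (Q != 0) by rewrite -negb_or -mulf_eq0 -ER.
  have big (S : {poly K0}) : S != 0 -> (map_poly iota S).[x] = 0 -> (2 * q < size S)%N.
    move=> S0 Sx; rewrite -(size_map_poly iota); apply: deg => //.
      by rewrite map_poly_eq0.
    by move=> i; rewrite coef_map; exact: (valP S`_i).
  have sRQ : size P = (size R + size Q).-1 by rewrite ER size_mul.
  have : (map_poly iota R).[x] * (map_poly iota Q).[x] == 0.
    by rewrite -hornerM -rmorphM /= -ER EP Broot.
  rewrite -dvdp_size_eqp; last by apply/dvdpP; exists R.
  have sR0 : (0 < size R)%N by rewrite size_poly_gt0.
  have sQ0 : (0 < size Q)%N by rewrite size_poly_gt0.
  rewrite mulf_eq0 => /orP[] /eqP /big.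
    move=> /(_ R0); move: sQ1 sRQ sR0 sQ0; rewrite sP.
    by move: (size R) (size Q) => i j; clear; lia.
  move=> /(_ Q0); move: sQ1 sRQ sR0 sQ0; rewrite sP.
  by move: (size R) (size Q) => i j; clear; lia.
have xyK (S : {poly {poly k}}) : exists Q : {poly K0}, bieval f x y S = (map_poly iota Q).[x].
  pose H := bieval (biC k) 'X ('X%:P + m%:P%:P * 'X) S.
  have -> : bieval f x y S = bieval f t x H.
    rewrite bieval_bieval bievalX bievalD bievalM bievalCC bievalC bievalX map_polyX hornerX.
    by congr bieval; rewrite /t; ring.
  exists (map_poly (fun h => insubd (0 : K0) (map_poly f h).[t]) H).
  have -> : bieval f t x H = (map_poly (horner_eval t \o map_poly f) H).[x] by [].
  have z0 : insubd (0 : K0) (map_poly f 0).[t] = 0.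
    by apply: val_inj; rewrite rmorph0 horner0 insubdK ?rpred0 ?rmorph0.
  congr (_.[_]); apply/polyP => i; rewrite !coef_map coef_map_id0 //=.
  by rewrite insubdK //; exact: ratfun_poly.
have surj z : exists Q R : {poly K0}, z = (map_poly iota Q).[x] / (map_poly iota R).[x].
  have [S [S' [_ ->]]] := xy_gen z; have [Q ->] := xyK S; have [R ->] := xyK S'.
  by exists Q, R.
have lB : lead_coef B != 0 by rewrite lead_coef_eq0.
rewrite rangeK; apply: (splitting_galois_over irrP ul lB xl _ surj).
by rewrite EP -EB.
Qed.

End GaloisPoint.

(** * The projective curve and its function field *)

Section HomogeneousPrime.
Context {k : closedFieldType} (M N : {poly k}) (c : k) (q : nat).
Hypotheses (q_gt1 : (1 < q)%N) (sM : sep_poly q M) (sN : sep_poly q N) (c0 : c != 0).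
Let F := product_curve M N c.
Implicit Types (P Q : {poly {poly k}}) (G H : {mpoly k[3]}) (T U : {poly {poly {poly k}}}).

Definition on_product_curve P := exists Q, P = Q * F.

Lemma on_product_curve0 : on_product_curve 0.
Proof. by exists 0; rewrite mul0r. Qed.

Lemma on_product_curveD P Q :
  on_product_curve P -> on_product_curve Q -> on_product_curve (P + Q).
Proof. by move=> [A ->] [B ->]; exists (A + B); rewrite mulrDl. Qed.

Lemma on_product_curveMl P Q : on_product_curve P -> on_product_curve (P * Q).
Proof. by move=> [A ->]; exists (A * Q); rewrite mulrAC. Qed.

Lemma on_product_curveMr P Q : on_product_curve Q -> on_product_curve (P * Q).
Proof. by rewrite mulrC; exact: on_product_curveMl. Qed.

Lemma on_product_curve_sum (I : finType) (p : pred I) (A : I -> {poly {poly k}}) :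
  (forall i, p i -> on_product_curve (A i)) -> on_product_curve (\sum_(i | p i) A i).
Proof.
by move=> H; elim/big_ind: _ => //; [exact: on_product_curve0 | exact: on_product_curveD].
Qed.

Lemma on_product_curve1 : ~ on_product_curve 1.
Proof.
move=> [Q E1]; have : size (Q * F) = 1%N by rewrite -E1 size_poly1.
have F0 : F != 0 by rewrite -size_poly_eq0 (size_product_curve _ q_gt1 sM sN).
have Q0 : Q != 0 by apply: contra_eq_neq E1 => ->; rewrite mul0r oner_neq0.
rewrite size_mul // (size_product_curve _ q_gt1 sM sN).
have : (0 < size Q)%N by rewrite size_poly_gt0.
by move: (size Q); lia.
Qed.

(** Extension of a prime ideal to polynomials: take the lowest coefficients of [T] and [U] outside
    the ideal and look at their product. *)
Lemma on_product_curve_coef T U : (forall n, on_product_curve (T * U)`_n) ->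
  (forall n, on_product_curve T`_n) \/ (forall n, on_product_curve U`_n).
Proof.
move=> TU; have [HT|/existsNP[i Ti]] := pselect (forall n, on_product_curve T`_n).
  by left.
have [HU|/existsNP[j Uj]] := pselect (forall n, on_product_curve U`_n); first by right.
have minim V l : ~ on_product_curve V`_l ->
    exists2 n, ~ on_product_curve V`_n & forall i, (i < n)%N -> on_product_curve V`_i.
  move=> Vl; have ex : exists n, `[< ~ on_product_curve V`_n >] by exists l; apply/asboolP.
  case: (ex_minnP ex) => n /asboolP Vn nmin; exists n => // i' i'n.
  apply: contrapT => Vi; have /nmin : `[< ~ on_product_curve V`_i' >] by apply/asboolP.
  by rewrite leqNgt i'n.
have [a Ta amin] := minim _ _ Ti; have [b Ub bmin] := minim _ _ Uj.
suff : on_product_curve (T`_a * U`_b).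
  by move=> /(product_curve_prime q_gt1 sM sN c0)[].
have ha : (a < (a + b).+1)%N by rewrite ltnS leq_addr.
have := TU (a + b)%N; rewrite coefM (bigD1 (Ordinal ha)) //= addKn => Hab.
rewrite -[_ * _](addrK (\sum_(i < (a + b).+1 | i != Ordinal ha) T`_i * U`_(a + b - i))).
apply: on_product_curveD => //.
rewrite -mulN1r; apply: on_product_curveMr; apply: on_product_curve_sum => i' ia.
have [lt|ge] := ltnP i' a; first by apply: on_product_curveMl; apply: amin.
apply: on_product_curveMr; apply: bmin.
have : (i' != a :> nat) by apply: contraNneq ia => e; apply/eqP/val_inj.
have := ltn_ord i'; move: (nat_of_ord i') ge => n; lia.
Qed.

(* X_0 |-> X s, X_1 |-> Y s, X_2 |-> s: the coefficient of s^d is the          *)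
(* dehomogenization of the component of degree d.                              *)
Definition grading : {mpoly k[3]} -> {poly {poly {poly k}}} :=
  mmap (triC k) (fun i => [tuple 'X%:P%:P * 'X; 'X%:P * 'X; 'X]`_i).
HB.instance Definition _ := GRing.RMorphism.copy grading
  (mmap (triC k) (fun i => [tuple 'X%:P%:P * 'X; 'X%:P * 'X; 'X]`_i)).

Let i0 : 'I_3 := 0. Let i1 : 'I_3 := 1. Let i2 : 'I_3 := 2%:R.

Lemma mdeg3 (m : 'X_{1..3}) : mdeg m = (m i0 + m i1 + m i2)%N.
Proof.
rewrite mdegE !big_ord_recr big_ord0 /= add0n.
by congr (m _ + m _ + m _)%N; apply: val_inj.
Qed.

Lemma grading_monomial (m : 'X_{1..3}) :
  grading 'X_[m] = ('X%:P ^+ m i0 * 'X ^+ m i1)%:P * 'X ^+ mdeg m.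
Proof.
rewrite /grading mmapX /mmap1 !big_ord_recr big_ord0 /= mul1r mdeg3.
rewrite (_ : widen_ord _ (widen_ord _ ord_max) = i0); last exact: val_inj.
rewrite (_ : widen_ord _ ord_max = i1); last exact: val_inj.
rewrite (_ : ord_max = i2); last exact: val_inj.
have regroup (R : comNzRingType) (a b u v w : R) : (a * u) * (b * v) * w = a * b * (u * v * w).
  by ring.
by rewrite !exprMn !exprD polyCM !polyC_exp; exact: regroup.
Qed.

Lemma grading_coef G d i j : (grading G)`_d`_i`_j =
  \sum_(m <- msupp G) G@_m * ((d == mdeg m) && (i == m i1) && (j == m i0))%:R.
Proof.
rewrite {1}[G]mpolyE rmorph_sum /= !coef_sum; apply: eq_bigr => m _.
rewrite -mul_mpolyC rmorphM /= [grading _%:MP]mmapC grading_monomial /=.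
rewrite mulrA -polyCM coefCM coefXn; case: eqP => _ /=; last by rewrite mulr0 !coef0 mulr0.
rewrite mulr1 -polyC_exp mulrA -polyCM coefCM coefXn.
case: eqP => _ /=; last by rewrite mulr0 coef0 mulr0.
by rewrite mulr1 coefCM coefXn.
Qed.

Lemma grading_inj : injective grading.
Proof.
move=> G H GH; apply/mpolyP => m.
have key (G' : {mpoly k[3]}) : (grading G')`_(mdeg m)`_(m i1)`_(m i0) = G'@_m.
  rewrite grading_coef [in RHS](mpolyE G') raddf_sum /=; apply: eq_bigr => m' _.
  rewrite mcoeffZ mcoeffX; congr (_ * _%:R); congr nat_of_bool.
  apply/andP/eqP => [[/andP[/eqP d /eqP e1] /eqP e0]|->]; last by rewrite !eqxx.
  move: d; rewrite !mdeg3 e0 e1 => /addnI e2; apply/mnmP => i.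
  case: i => -[|[|[|]]] // lti.
  - by rewrite (_ : Ordinal lti = i0) ?e0 //; apply: val_inj.
  - by rewrite (_ : Ordinal lti = i1) ?e1 //; apply: val_inj.
  - by rewrite (_ : Ordinal lti = i2) ?e2 //; apply: val_inj.
by rewrite -!key GH.
Qed.

(* total degree at most n *)
Definition tdeg_le n P := forall i j, (n < i + j)%N -> P`_i`_j = 0.

Lemma grading_tdeg G d : tdeg_le d (grading G)`_d.
Proof.
move=> i j dij; rewrite grading_coef big1 // => m _.
case: eqP => [dm|_]; last by rewrite mulr0.
case: eqP => [im|_]; last by rewrite mulr0.
case: eqP => [jm|_]; last by rewrite mulr0.
by move: dij; rewrite dm im jm mdeg3; lia.
Qed.

Lemma grading_surj T : (forall d, tdeg_le d T`_d) -> exists G, grading G = T.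
Proof.
move=> hT; pose mon (j i l : nat) : 'X_{1..3} := [multinom nth 0%N [:: j; i; l] h | h < 3].
exists (\sum_(d < size T) \sum_(i < size T`_d) \sum_(j < size T`_d`_i)
  (T`_d`_i`_j *: 'X_[mon j i (d - i - j)%N])).
rewrite rmorph_sum -[RHS]coefK poly_def; apply: eq_bigr => d _.
rewrite rmorph_sum -mul_polyC -[in RHS](coefK T`_d) poly_def rmorph_sum mulr_suml.
apply: eq_bigr => i _.
rewrite rmorph_sum -mul_polyC -[in RHS](coefK T`_d`_i) poly_def !rmorph_sum mulr_suml rmorph_sum mulr_suml.
apply: eq_bigr => j _ /=.
have [dij|dij] := ltnP d (i + j); first by rewrite hT // !scale0r polyC0 mul0r polyC0 mul0r rmorph0.
rewrite -mul_mpolyC rmorphM /= [grading _%:MP]mmapC grading_monomial /=.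
have -> : mdeg (mon j i (d - i - j)%N) = d.
  by rewrite mdeg3 !mnmE /= -subnDA [(j + i)%N]addnC subnKC.
rewrite !mnmE /=.
by rewrite -!mul_polyC mulrA -polyCM mulrA -polyC_exp -polyCM.
Qed.

Lemma coef_product_curve i j :
  F`_i`_j = N`_i * M`_j + c * ((i == 0) && (j == 0))%N%:R.
Proof.
rewrite !coefD coefMC coef_map /= coefCM !coefC.
by case: eqP => _; rewrite ?coef0 ?coefC; case: eqP => _ /=; rewrite ?mulr1 ?mulr0.
Qed.

Lemma top_product_curve i j : (q + q <= i + j)%N -> F`_i`_j =
  (lead_coef M * lead_coef N) * ((i == q) && (j == q))%:R.
Proof.
move=> qij; rewrite coef_product_curve /lead_coef (proj1 sM) (proj1 sN) /=.
have -> : ((i == 0) && (j == 0))%N = false.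
  by apply/negbTE/negP => /andP[/eqP iz /eqP jz]; move: qij q_gt1; rewrite iz jz; lia.
rewrite mulr0 addr0; have [/andP[/eqP -> /eqP ->]|ij] := boolP (_ && _).
  by rewrite mulr1 mulrC.
rewrite mulr0; have [iq|iq] := ltnP q i.
  by rewrite nth_default ?mul0r // (proj1 sN).
have jq : (q < j)%N.
  rewrite ltnNge; apply: contra ij => jq; apply/andP; split; apply/eqP;
  move: iq jq qij; clear; lia.
by rewrite [M`_j]nth_default ?mulr0 // (proj1 sM).
Qed.

(** The part of F of highest total degree is one monomial, a multiple of X^q Y^q, so total degrees
    add. The induction runs down from a bound on the total degree of Q. *)
Lemma tdeg_divide n Q : tdeg_le n (Q * F) -> forall i j, (n < i + j + (q + q))%N -> Q`_i`_j = 0.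
Proof.
move=> hQF; pose B := (size Q + sizeY Q)%N.
have hB i j : (B <= i + j)%N -> Q`_i`_j = 0.
  move=> Bij; have [sQ|sQ] := leqP (size Q) i; first by rewrite [Q`_i]nth_default ?coef0.
  rewrite nth_default // (leq_trans (max_size_coefXY _ _)) //.
  by move: Bij sQ; rewrite /B; move: (size Q) (sizeY Q); lia.
suff H : forall l i j, (B <= i + j + l)%N -> (n < i + j + (q + q))%N -> Q`_i`_j = 0.
  by move=> i j; apply: (H B); rewrite leq_addl.
elim=> [|l IH] i j Bl nij; first by apply: hB; rewrite addn0 in Bl.
have := hQF (i + q)%N (j + q)%N; rewrite addnACA => /(_ nij).
rewrite coefM coef_sum.
have hi : (i < (i + q).+1)%N by rewrite ltnS leq_addr.
have hj : (j < (j + q).+1)%N by rewrite ltnS leq_addr.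
rewrite (bigD1 (Ordinal hi)) //= coefM (bigD1 (Ordinal hj)) //= !addKn.
have zero a b : (a != i)%N || (b != j)%N -> (a <= i + q)%N -> (b <= j + q)%N ->
    Q`_a`_b * F`_(i + q - a)`_(j + q - b) = 0.
  move=> ab ai bj; have [lt|ge] := ltnP (i + j) (a + b).
    by rewrite IH ?mul0r //; move: Bl nij lt; clear; lia.
  rewrite top_product_curve; last by move: ai bj ge; clear; lia.
  have [/andP[/eqP ea /eqP eb]|_] := boolP (_ && _); last by rewrite mulr0 mulr0.
  exfalso; move: ab ai bj ea eb ge; clear; lia.
rewrite big1; last first.
  move=> b bj; have := zero i b; rewrite addKn leq_addr -ltnS ltn_ord; apply=> //.
  by rewrite eqxx /=; apply: contraNneq bj => e; apply/eqP/val_inj.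
rewrite big1; last first.
  move=> a ai; rewrite coefM big1 // => b _; apply: zero; rewrite -1?ltnS ?ltn_ord //.
  by apply/orP; left; apply: contraNneq ai => e; apply/eqP/val_inj.
rewrite top_product_curve; last by lia.
rewrite !eqxx mulr1 !addr0 => /eqP; rewrite !mulf_eq0 !lead_coef_eq0.
rewrite -!size_poly_eq0 (proj1 sM) (proj1 sN) /= orbF => /eqP //.
Qed.

Context (Fh : {mpoly k[3]}).
Hypothesis gradingF : grading Fh = F%:P * 'X ^+ (q + q).

(** Divisibility by the form is tested on each graded component after dehomogenization;
    [tdeg_divide] allows the quotients to be homogenized again. Primality thus passes from F to the
    form. *)
Lemma homogenization_divides G :
  (exists H, G = H * Fh) <-> (forall d, on_product_curve (grading G)`_d).
Proof.
split=> [[H ->] d|HG].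
  rewrite rmorphM /= gradingF mulrA coefMXn; case: ifP => _; first exact: on_product_curve0.
  by rewrite coefMC; apply: on_product_curveMr; exists 1; rewrite mul1r.
have /choice[Q HQ] : forall d, exists Q, (grading G)`_d = Q * F by exact: HG.
have Qdeg d : forall i j, (d < i + j + (q + q))%N -> (Q d)`_i`_j = 0.
  by apply: tdeg_divide; rewrite -HQ; exact: grading_tdeg.
pose T := \poly_(d < size (grading G)) Q (d + (q + q))%N.
have [H EH] : exists H, grading H = T.
  apply: grading_surj => d i j dij; rewrite coef_poly; case: ifP => _; last by rewrite !coef0.
  by apply: Qdeg; rewrite ltn_add2r.
exists H; apply: grading_inj; rewrite rmorphM /= EH gradingF mulrA.
apply/polyP => d; rewrite coefMXn; case: ltnP => [dq|qd].
  rewrite HQ; have -> : Q d = 0; last by rewrite mul0r.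
  by apply/polyP => i; apply/polyP => j; rewrite !coef0 Qdeg //; move: dq; lia.
rewrite coefMC coef_poly subnK // HQ; case: ltnP => // sG.
have := HQ d; rewrite nth_default; last by apply: leq_trans sG _; rewrite leq_subr.
by move=> <-; rewrite mul0r.
Qed.

Lemma homogenization_prime : prime_idealr_closed (principal Fh).
Proof.
move=> G H; rewrite !unfold_in => /asboolP/homogenization_divides GH.
have [] := on_product_curve_coef (T := grading G) (U := grading H).
- by move=> n; rewrite -rmorphM.
- by move=> /homogenization_divides HG; apply/orP; left; apply/asboolP.
- by move=> /homogenization_divides HG; apply/orP; right; apply/asboolP.
Qed.

Lemma homogenization_proper : 1 \notin principal Fh.
Proof.
apply/negP; rewrite unfold_in => /asboolP/homogenization_divides/(_ 0%N).
by rewrite rmorph1 coefC => /on_product_curve1.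
Qed.

End HomogeneousPrime.

Lemma dhomog0C (R : comNzRingType) n (a : R) : (a%:MP : {mpoly R[n]}) \is 0.-homog.
Proof. by rewrite -[a]mulr1 mpolyCM mul_mpolyC; apply: rpredZ; exact: dhomog1. Qed.

Section ProductForm.
Context {k : closedFieldType} (p e : nat) (alpha : 'I_e.+1 -> k) (c : k).
Hypotheses (hp : p \in [pchar k]) (e_gt0 : (0 < e)%N) (c0 : c != 0).
Hypothesis alpha_neq0 : alpha ord_max * alpha ord0 != 0.
Local Notation q := (p ^ e)%N.
Local Notation L := (additive_poly p alpha).
Let q_gt1 : (1 < q)%N := q_gt1 hp e_gt0.
Let sL : sep_poly q L := sep_additive_poly hp alpha_neq0.

Notation mC n := (@mpolyC n k : {rmorphism k -> {mpoly k[n]}}).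

Lemma homog_poly_hadd (U V : {mpoly k[3]}) :
  homog_poly L U V = hadd p alpha (mC 3) U V.
Proof.
rewrite /homog_poly (proj1 sL) /=.
under eq_bigr => i _ do rewrite (coef_additive_poly p alpha) scaler_suml.
rewrite exchange_big /=; apply: eq_bigr => j _.
have jq : (p ^ j < q.+1)%N by rewrite ltnS (leq_pexp hp).
rewrite (bigD1 (Ordinal jq)) //= eqxx mulr1 big1 ?addr0.
  by rewrite -mul_mpolyC mulrA.
move=> i ij; rewrite (_ : (nat_of_ord i == p ^ j)%N = false) ?mulr0 ?scale0r //.
by apply: contraNF ij => /eqP e1; apply/eqP/val_inj.
Qed.

Lemma product_formE : product_form L L c =
  hadd p alpha (mC 3) 'X_0 'X_2%:R * hadd p alpha (mC 3) 'X_1 'X_2%:R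
  + c%:MP * 'X_2%:R ^+ (q + q).
Proof. by rewrite /product_form !homog_poly_hadd (proj1 sL) -mul_mpolyC. Qed.

Lemma rmorph_product_form (R : comNzRingType) (g : {rmorphism {mpoly k[3]} -> R})
    (h : {rmorphism k -> R}) : (forall a, g a%:MP = h a) ->
  g (product_form L L c) = hadd p alpha h (g 'X_0) (g 'X_2%:R)
    * hadd p alpha h (g 'X_1) (g 'X_2%:R) + h c * g 'X_2%:R ^+ (q + q).
Proof.
move=> gh; rewrite product_formE.
exact: (rmorph_hadd_form p alpha 'X_0 'X_1 'X_2%:R c (q + q) (f := mC 3) gh).
Qed.

Lemma additive_poly_hadd : L = hadd p alpha polyC 'X 1.
Proof. by rewrite -horner_additive -[RHS]/(L \Po 'X) comp_polyXr. Qed.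

Lemma product_curve_hadd : product_curve L L c =
  hadd p alpha (biC k) 'X%:P 1 * hadd p alpha (biC k) 'X 1 + biC k c.
Proof.
rewrite /product_curve mulrC; congr (_ * _ + _).
  rewrite {1}additive_poly_hadd (rmorph_hadd p alpha _ _ (h := polyC) (g := biC k)) //.
rewrite -horner_additive [map_poly _ _ in RHS]map_poly_comp.
by rewrite -[RHS]/(_ \Po 'X) comp_polyXr.
Qed.

Lemma grading_product_form :
  grading (product_form L L c) = (product_curve L L c)%:P * 'X ^+ (q + q).
Proof.
rewrite (rmorph_product_form (g := grading) (h := triC k)); last by move=> a; exact: mmapC.
have gX i : grading 'X_i = [tuple 'X%:P%:P * 'X; 'X%:P * 'X; 'X]`_i.
  by rewrite /grading mmapX mmap1U.
rewrite /= !gX /= product_curve_hadd polyCD polyCM.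
rewrite !(rmorph_hadd p alpha _ _ (h := polyC) (g := triC k)) //.
have sc (U : {poly {poly {poly k}}}) :
    hadd p alpha (triC k) (U * 'X) 'X = 'X ^+ q * hadd p alpha (triC k) U 1.
  by rewrite -(haddM alpha hp) mulr1 mulrC.
have factor (R : comNzRingType) (z a b d : R) :
    z * a * (z * b) + d * (z * z) = (a * b + d) * (z * z) by ring.
by rewrite !sc exprD; exact: factor.
Qed.

Lemma hadd_homog (U V : {mpoly k[3]}) : U \is 1.-homog -> V \is 1.-homog ->
  hadd p alpha (mC 3) U V \is q.-homog.
Proof.
move=> hU hV; apply: rpred_sum => i _.
have := dhomogM (dhomogM (dhomog0C 3 (alpha i)) (dhomogMn (p ^ i) hU))
  (dhomogMn (q - p ^ i) hV).
by rewrite add0n !mul1n subnKC // (leq_pexp hp).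
Qed.

Lemma product_form_homog : product_form L L c \is (q + q).-homog.
Proof.
have hX (i : 'I_3) : ('X_i : {mpoly k[3]}) \is 1.-homog by rewrite dhomogX /= mdeg1.
rewrite product_formE; apply: rpredD.
  by apply: dhomogM; apply: hadd_homog; exact: hX.
by have := dhomogM (dhomog0C 3 c) (dhomogMn (q + q) (hX 2%:R)); rewrite add0n mul1n.
Qed.

Lemma product_form_curve : exists C : plane_curve k, curve_form C = product_form L L c.
Proof.
have sD := grading_product_form.
have nz : product_form L L c != 0.
  apply/eqP => F0; have := sD; rewrite F0 rmorph0 => /esym/eqP.
  rewrite mulf_eq0 expf_eq0 polyX_eq0 andbF orbF polyC_eq0 -size_poly_eq0.
  by rewrite (size_product_curve _ q_gt1 sL sL).
have hF : exists d, product_form L L c \is d.-homog by exists (q + q)%N; exact: product_form_homog.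
by exists (PlaneCurve hF nz
  (homogenization_proper q_gt1 sL sL c0 sD) (homogenization_prime q_gt1 sL sL c0 sD)).
Qed.

End ProductForm.

Section MultivariateEvaluation.
Context {k : comNzRingType} {n : nat}.
Implicit Types (g : {mpoly k[n]}).

Lemma rmorph_mmap (R S : comNzRingType) (h : {rmorphism k -> R}) (v : 'I_n -> R)
    (phi : {rmorphism R -> S}) (h' : {rmorphism k -> S}) (v' : 'I_n -> S) g :
  (forall a, phi (h a) = h' a) -> (forall i, phi (v i) = v' i) ->
  phi (mmap h v g) = mmap h' v' g.
Proof.
move=> hh vv; rewrite rmorph_sum; apply: eq_bigr => m _ /=.
rewrite rmorphM /= hh; congr (_ * _); rewrite /mmap1 rmorph_prod.
by apply: eq_bigr => i _; rewrite rmorphXn /= vv.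
Qed.

Lemma mmap_homog (R : comNzRingType) (h : {rmorphism k -> R}) (z : R) (v : 'I_n -> R)
    d g : g \is d.-homog -> mmap h (fun i => z * v i) g = z ^+ d * mmap h v g.
Proof.
move=> hg; rewrite /mmap mulr_sumr big_seq [RHS]big_seq; apply: eq_bigr => m ms.
rewrite mulrCA; congr (_ * _).
rewrite /mmap1 (eq_bigr (fun i => z ^+ m i * v i ^+ m i)) => [|i _]; last exact: exprMn.
rewrite big_split /=; congr (_ * _); rewrite prodrXr; congr (_ ^+ _).
by rewrite -(dhomog_mf hg ms) /= mdegE.
Qed.

Lemma mmap_id g : mmap (@mpolyC n k) (fun i => 'X_i) g = g.
Proof.
rewrite -[RHS]comp_mpoly_id /comp_mpoly; apply: eq_bigr => m _; congr (_ * _).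
by apply: mmap1_eq => i; rewrite tnth_mktuple.
Qed.

End MultivariateEvaluation.

Lemma funfield_const_degree0 (k : fieldType) (C : plane_curve k) (a : k) :
  frac_residue C a%:MP \in @degree0 k C.
Proof.
apply/asboolP; exists 0%N, a%:MP, 1; rewrite dhomog0C dhomog1; split=> //.
  exact: curve_form_proper.
by rewrite /form_ratio rmorph1 divr1.
Qed.

Definition funfield_const (k : fieldType) (C : plane_curve k) (a : k) : funfield C :=
  SubfieldOf (funfield_const_degree0 C a).

Section FunctionField.
Context {k : fieldType} (C : plane_curve k).

Lemma funfield_val_inj : injective (@funfield_val k C).
Proof. exact: fmorph_inj. Qed.

Lemma funfield_const_zmod : zmod_morphism (funfield_const C).
Proof.
move=> a b; apply: funfield_val_inj; rewrite [RHS]rmorphB.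
change (frac_residue C (a - b)%:MP = frac_residue C a%:MP - frac_residue C b%:MP).
by rewrite mpolyCB rmorphB.
Qed.

Lemma funfield_const_monoid : monoid_morphism (funfield_const C).
Proof.
split=> [|a b]; apply: funfield_val_inj.
  rewrite [RHS]rmorph1; change (frac_residue C 1%:MP = 1).
  by rewrite mpolyC1 rmorph1.
rewrite [RHS]rmorphM.
change (frac_residue C (a * b)%:MP = frac_residue C a%:MP * frac_residue C b%:MP).
by rewrite mpolyCM rmorphM.
Qed.

HB.instance Definition _ := GRing.isZmodMorphism.Build k (funfield C)
  (funfield_const C) funfield_const_zmod.
HB.instance Definition _ := GRing.isMonoidMorphism.Build k (funfield C)
  (funfield_const C) funfield_const_monoid.

(* Zero when the curve is contained in the line at infinity. *)
Definition funfield_coord (i : 'I_3) : funfield C :=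
  insubd (0 : funfield C) (form_ratio C 'X_i 'X_2%:R).

Definition affine_value (G : {mpoly k[3]}) : funfield C :=
  mmap (funfield_const C) funfield_coord G.
HB.instance Definition _ := GRing.RMorphism.copy affine_value
  (mmap (funfield_const C) funfield_coord).

Lemma affine_valueC a : affine_value a%:MP = funfield_const C a.
Proof. exact: mmapC. Qed.

Lemma affine_valueX i : affine_value 'X_i = funfield_coord i.
Proof. by rewrite /affine_value mmapX mmap1U. Qed.

Hypothesis HZ : ('X_2%:R : {mpoly k[3]}) \notin curve_ideal C.
Local Notation z := (frac_residue C 'X_2%:R).

Lemma frac_residueZ_neq0 : z != 0.
Proof. by rewrite frac_residue_eq0. Qed.

Lemma funfield_coordE i : funfield_val (funfield_coord i) = frac_residue C 'X_i / z.
Proof.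
rewrite /funfield_coord /funfield_val insubdK //; apply/asboolP.
by exists 1%N, 'X_i, 'X_2%:R; rewrite !dhomogX /= !mdeg1.
Qed.

Lemma funfield_coord2 : funfield_coord 2%:R = 1.
Proof.
by apply: funfield_val_inj; rewrite funfield_coordE rmorph1 divff // frac_residueZ_neq0.
Qed.

Lemma frac_residue_lsubst n d (A : 'M[k]_(3, n)) (g : {mpoly k[n]}) : g \is d.-homog ->
  frac_residue C (lsubst A g) = z ^+ d * funfield_val (mmap (funfield_const C)
    (fun j => \sum_(i < 3) funfield_const C (A i j) * funfield_coord i) g).
Proof.
move=> hg; rewrite /lsubst /comp_mpoly.
pose ch : {rmorphism k -> {fraction coord_ring C}} := @funfield_val k C \o funfield_const C.
pose v (j : 'I_n) := funfield_val (\sum_(i < 3) funfield_const C (A i j) * funfield_coord i).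
rewrite [funfield_val _](rmorph_mmap (h' := ch) (v' := v)) // -(mmap_homog ch z v hg).
apply: (rmorph_mmap (h := @mpolyC 3 k)) => // j.
rewrite tnth_mktuple /v !rmorph_sum mulr_sumr; apply: eq_bigr => i _ /=.
rewrite -mul_mpolyC !rmorphM /= [subfield_val _]funfield_coordE.
by rewrite mulrCA; congr (_ * _); rewrite mulrCA divff ?mulr1 // frac_residueZ_neq0.
Qed.

(** Ratios of forms of equal degree lose the common factor z^d, so they can be computed with affine
    coordinates. *)
Lemma frac_residue_homog d (G : {mpoly k[3]}) : G \is d.-homog ->
  frac_residue C G = z ^+ d * funfield_val (affine_value G).
Proof.
move=> hG; pose ch : {rmorphism k -> {fraction coord_ring C}} :=
  @funfield_val k C \o funfield_const C.
rewrite [funfield_val _](rmorph_mmap (h' := ch) (v' := @funfield_val k C \o funfield_coord)) //.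
rewrite -(mmap_homog _ _ _ hG) -[in LHS](mmap_id G).
apply: (rmorph_mmap (h := @mpolyC 3 k)) => // i /=.
by rewrite [funfield_val _]funfield_coordE mulrCA divff ?mulr1 // frac_residueZ_neq0.
Qed.

Lemma curve_ideal_homog d (G : {mpoly k[3]}) : G \is d.-homog ->
  (G \in curve_ideal C) = (affine_value G == 0).
Proof.
move=> hG; rewrite -frac_residue_eq0 (frac_residue_homog hG) mulf_eq0 expf_eq0.
by rewrite (negPf frac_residueZ_neq0) andbF /= fmorph_eq0.
Qed.

Lemma form_ratio_homog d (G H : {mpoly k[3]}) : G \is d.-homog -> H \is d.-homog ->
  form_ratio C G H = funfield_val (affine_value G / affine_value H).
Proof.
move=> hG hH; rewrite /form_ratio (frac_residue_homog hG) (frac_residue_homog hH).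
by rewrite -mulf_div divff ?mul1r ?fmorph_div // expf_neq0 // frac_residueZ_neq0.
Qed.

Lemma funfield_ratio (a : funfield C) : exists d (G H : {mpoly k[3]}),
  [/\ G \is d.-homog, H \is d.-homog, affine_value H != 0
    & a = affine_value G / affine_value H].
Proof.
case: a => a Ka; have /asboolP[d [G [H [hG hH H0 Ea]]]] := Ka.
exists d, G, H; split=> //; first by rewrite -(curve_ideal_homog hH).
by apply: funfield_val_inj; rewrite -(form_ratio_homog hG hH).
Qed.

Lemma affine_value_bieval (G : {mpoly k[3]}) : exists P : {poly {poly k}},
  affine_value G = bieval (funfield_const C) (funfield_coord 0) (funfield_coord 1) P.
Proof.
exists (mmap (biC k) (fun i => [tuple 'X%:P; 'X; 1]`_i) G); apply/esym.
apply: (rmorph_mmap (h := biC k)) => [a|i]; first exact: bievalCC.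
case: i => -[|[|[|]]] // lti /=.
- by rewrite bievalC map_polyX hornerX; congr funfield_coord; apply: val_inj.
- by rewrite bievalX; congr funfield_coord; apply: val_inj.
- by rewrite bieval1 -funfield_coord2; congr funfield_coord; apply: val_inj.
Qed.

Lemma funfield_gen (a : funfield C) : exists P Q,
  bieval (funfield_const C) (funfield_coord 0) (funfield_coord 1) Q != 0 /\
  a = bieval (funfield_const C) (funfield_coord 0) (funfield_coord 1) P
    / bieval (funfield_const C) (funfield_coord 0) (funfield_coord 1) Q.
Proof.
have [d [G [H [_ _ H0 ->]]]] := funfield_ratio a.
have [P EP] := affine_value_bieval G; have [Q EQ] := affine_value_bieval H.
by exists P, Q; rewrite -EQ -EP.
Qed.

End FunctionField.

(** * Projections of the projective curve *)

Lemma galois_over_group (E : fieldType) (K : set E) : galois_over K ->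
  exists (T : finType) (s : T -> {rmorphism E -> E}),
    [/\ forall g h, exists l, s l =1 s g \o s h, exists g, s g =1 id,
        forall g, exists h, s h \o s g =1 id, forall g a, K a -> s g a = a
      & forall z, (forall g, s g z = z) -> K z].
Proof.
move=> [K0 [L [f [[f' fK f'K] <- gal]]]].
have f'zmod : zmod_morphism f' by exact: can2_zmod_morphism fK f'K.
have f'mon : monoid_morphism f' by exact: can2_monoid_morphism fK f'K.
pose f'A := GRing.isZmodMorphism.Build E L f' f'zmod.
pose f'M := GRing.isMonoidMorphism.Build E L f' f'mon.
pose g' : {rmorphism E -> L} := HB.pack f' f'A f'M.
pose s (g : gal_of {:L}) : {rmorphism E -> E} := f \o (g : {rmorphism L -> L}) \o g'.
have sE g a : s g a = f (g (f' a)) by [].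
exists (gal_of {:L}), s; split.
(* In a product of Galois automorphisms the left factor acts first. *)
- move=> g h; exists (h * g)%g => a; change (s (h * g)%g a = s g (s h a)).
  by rewrite !sE fK galM ?memvf.
- by exists 1%g => a; rewrite sE gal_id f'K.
- move=> g; exists (g^-1)%g => a; change (s (g^-1)%g (s g a) = a).
  by rewrite !sE fK -galM ?memvf // mulgV gal_id f'K.
- by move=> g _ [b _ <-]; rewrite sE /= fK linearZ /= rmorph1.
- move=> z zfix; have : f' z \in fixedField 'Gal({:L} / 1)%g.
    apply/fixedFieldP; first exact: memvf.
    by move=> g _; apply: (can_inj fK); rewrite -sE zfix f'K.
  move: gal => /galois_fixedField -> /vlineP[b Eb].
  by exists b => //; rewrite -Eb f'K.
Qed.

Definition pvec (k : fieldType) (a b c : k) : 'rV[k]_3 := \row_(i < 3) [:: a; b; c]`_i.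

Section ProjectivePoints.
Context {k : fieldType}.
Implicit Types (R : P2 k) (v w : 'rV[k]_3).

Lemma row3P v : v = pvec (v 0 0) (v 0 1) (v 0 2%:R).
Proof.
apply/rowP => i; rewrite mxE; case: i => -[|[|[|]]] // lti /=;
by congr (v _ _); apply: val_inj.
Qed.

Lemma sum3 (V : nmodType) (F : 'I_3 -> V) : \sum_i F i = F 0 + F 1 + F 2%:R.
Proof.
rewrite !big_ord_recr big_ord0 /= add0r.
by congr (F _ + F _ + F _); apply: val_inj.
Qed.

Lemma pvecE (a b c : k) : (pvec a b c 0 0 = a) * (pvec a b c 0 1 = b) * (pvec a b c 0 2%:R = c).
Proof. by rewrite !mxE. Qed.

Lemma pvecZ (t a b c : k) : t *: pvec a b c = pvec (t * a) (t * b) (t * c).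
Proof. by rewrite [LHS]row3P; rewrite !mxE. Qed.

Lemma pvec_inj (a b c a' b' c' : k) : pvec a b c = pvec a' b' c' ->
  [/\ a = a', b = b' & c = c'].
Proof.
move=> E0; have e i : pvec a b c 0 i = pvec a' b' c' 0 i by rewrite E0.
by have := (e 0, e 1, e 2%:R); rewrite !pvecE => -[[]].
Qed.

Lemma P2_line R : exists2 v, v != 0 & val R = <[v]>%VS.
Proof.
have dR := eqP (valP R); exists (vpick (val R)).
  by rewrite vpick0 -dimv_eq0 dR.
apply/eqP; rewrite eq_sym eqEdim dR dim_vline vpick0 -dimv_eq0 dR /= andbT.
exact: memv_pick.
Qed.

Lemma vlineZ (t : k) v : t != 0 -> <[t *: v]>%VS = <[v]>%VS.
Proof.
move=> t0; apply/eqP; rewrite eqEsubv -!memvE; apply/andP; split.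
  by rewrite memvZ // memv_line.
by apply/vlineP; exists t^-1; rewrite scalerA mulVf // scale1r.
Qed.

Lemma P2_cases R : [\/ exists a b, val R = <[pvec a b 1]>%VS,
  exists m, val R = <[pvec 1 m 0]>%VS | val R = <[pvec 0 1 0]>%VS].
Proof.
have [v v0 ER] := P2_line R; rewrite ER (row3P v).
set a := v 0 0; set b := v 0 1; set c := v 0 2%:R.
have dv (t u : k) : t != 0 -> t * (u / t) = u by move=> t0; rewrite mulrC divfK.
have [c0|c0] := eqVneq c 0; last first.
  constructor 1; exists (a / c), (b / c).
  by rewrite -(vlineZ (pvec (a / c) (b / c) 1) c0) pvecZ mulr1 !dv.
have [a0|a0] := eqVneq a 0; last first.
  constructor 2; exists (b / a).
  by rewrite -(vlineZ (pvec 1 (b / a) 0) a0) pvecZ mulr1 mulr0 dv // c0.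
have b0 : b != 0.
  apply: contraNneq v0 => b0; rewrite (row3P v) -/a -/b -/c a0 b0 c0.
  by apply/eqP/rowP => i; rewrite !mxE; case: i => -[|[|[|]]].
by constructor 3; rewrite -(vlineZ (pvec 0 1 0) b0) pvecZ !mulr0 mulr1 a0 c0.
Qed.

Lemma mul_pvec n (a b c : k) (M : 'M[k]_(3, n)) j :
  (pvec a b c *m M) 0 j = a * M 0 j + b * M 1 j + c * M 2%:R j.
Proof. by rewrite mxE sum3 !pvecE. Qed.

Lemma pvec_dim (a b c : k) : pvec a b c != 0 -> \dim <[pvec a b c]>%VS == 1%N.
Proof. by move=> n0; rewrite dim_vline n0. Qed.

End ProjectivePoints.

Section CurvePoints.
Context {k : closedFieldType} (p e : nat) (alpha : 'I_e.+1 -> k) (c : k).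
Hypotheses (hp : p \in [pchar k]) (e_gt0 : (0 < e)%N) (c0 : c != 0).
Hypothesis alpha_neq0 : alpha ord_max * alpha ord0 != 0.
Local Notation q := (p ^ e)%N.
Local Notation L := (additive_poly p alpha).
Let q_gt1 : (1 < q)%N := q_gt1 hp e_gt0.
Let sL : sep_poly q L := sep_additive_poly hp alpha_neq0.
Let aq : alpha ord_max != 0. Proof. by move: alpha_neq0; rewrite mulf_eq0 negb_or => /andP[]. Qed.
Context (C : plane_curve k) (hC : curve_form C = product_form L L c).
Local Notation f := (funfield_const C).
Local Notation x := (funfield_coord C 0).
Local Notation y := (funfield_coord C 1).

Lemma line_at_infinity : ('X_2%:R : {mpoly k[3]}) \notin curve_ideal C.
Proof.
apply/negP; rewrite unfold_in /curve_ideal hC => /asboolP.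
have gF := grading_product_form c hp alpha_neq0.
move=> /(homogenization_divides q_gt1 sL sL c0 gF)/(_ 1%N).
rewrite /grading mmapX mmap1U /= coefX.
exact: (on_product_curve1 q_gt1 sL sL).
Qed.
Let HZ := line_at_infinity.

(** A relation P(x) = 0, once homogenized, would make P a multiple of F, which has positive degree
    in Y. *)
Lemma curve_generic_point : generic_point f L L c q x y.
Proof.
split=> //.
  move=> P Px; pose n := size P.
  pose G : {mpoly k[3]} := \sum_(i < n) (P`_i)%:MP * ('X_0 ^+ i * 'X_2%:R ^+ (n - i)).
  have hX (i : 'I_3) : ('X_i : {mpoly k[3]}) \is 1.-homog by rewrite dhomogX /= mdeg1.
  have hG : G \is n.-homog.
    apply: rpred_sum => i _.
    have := dhomogM (dhomog0C 3 P`_i) (dhomogM (dhomogMn i (hX 0)) (dhomogMn (n - i) (hX 2%:R))).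
    by rewrite add0n !mul1n subnKC // ltnW.
  have : G \in curve_ideal C.
    rewrite (curve_ideal_homog HZ hG) -[X in _ == X]Px horner_coef size_map_poly -/n.
    rewrite rmorph_sum; apply/eqP/eq_bigr => i _ /=.
    rewrite !rmorphM !rmorphXn /= affine_valueC !affine_valueX (funfield_coord2 HZ).
    by rewrite expr1n mulr1 coef_map.
  rewrite unfold_in /curve_ideal hC => /asboolP.
  have gF := grading_product_form c hp alpha_neq0.
  move=> /(homogenization_divides q_gt1 sL sL c0 gF)/(_ n).
  have gX i : grading 'X_i = [tuple 'X%:P%:P * 'X; 'X%:P * 'X; 'X]`_i :> {poly {poly {poly k}}}.
    by rewrite /grading mmapX mmap1U.
  have -> : (grading G)`_n = P%:P.
    have -> : grading G = P%:P%:P * 'X ^+ n; last by rewrite coefMXn ltnn subnn coefC.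
    rewrite rmorph_sum -[in RHS](coefK P) poly_def !rmorph_sum mulr_suml; apply: eq_bigr => i _ /=.
    rewrite !rmorphM !rmorphXn /= !gX [grading _]mmapC /=.
    rewrite -[in RHS](subnKC (ltnW (ltn_ord i))) exprD -mul_polyC !polyCM !polyC_exp exprMn.
    by ring.
  move=> [Q EQ]; apply/eqP; apply: contraT => P0.
  have F0 : product_curve L L c != 0 by rewrite -size_poly_eq0 (size_product_curve _ q_gt1 sL sL).
  have Q0 : Q != 0 by apply: contraNneq P0 => Q0; rewrite -polyC_eq0 EQ Q0 mul0r.
  have : size (P%:P : {poly {poly k}}) = 1%N by rewrite size_polyC P0.
  rewrite EQ size_mul // (size_product_curve _ q_gt1 sL sL).
  have : (0 < size Q)%N by rewrite size_poly_gt0.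
  by move: (size Q) q_gt1; clear; lia.
have hF := product_form_homog c hp alpha_neq0.
have : product_form L L c \in curve_ideal C.
  by rewrite unfold_in /curve_ideal hC; apply/asboolP; exists 1; rewrite mul1r.
rewrite (curve_ideal_homog HZ hF) => /eqP.
rewrite (rmorph_product_form c hp alpha_neq0 (g := affine_value C) (h := f)); last first.
  exact: affine_valueC.
rewrite /= !affine_valueX (funfield_coord2 HZ) expr1n mulr1.
by rewrite !horner_additive.
Qed.

Lemma horner_eval_neq0_affine (R : P2 k) (a b : k) : val R = <[pvec a b 1]>%VS ->
  ~ on_curve C R -> L.[a] * L.[b] + c != 0.
Proof.
move=> ER nR; apply/eqP => E0; apply: nR => v; rewrite ER => /vlineP[t ->].
rewrite hC (rmorph_product_form c hp alpha_neq0 (h := idfun)); last exact: mevalC.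
rewrite /= !mevalXU !mxE /= mulr1.
have hm z : hadd p alpha idfun (t * z) t = t ^+ q * L.[z].
  by rewrite (horner_additive_id p alpha) -(haddM alpha hp) mulr1.
by rewrite !hm exprD -[RHS](mulr0 (t ^+ q * t ^+ q)) -E0; ring.
Qed.

Lemma on_curve_infinity (R : P2 k) (a b : k) : val R = <[pvec a b 0]>%VS ->
  on_curve C R <-> a * b = 0.
Proof.
move=> ER; have E0 v : v = pvec (v 0 0) (v 0 1) 0 -> (curve_form C).@[fun i => v 0 i]
    = alpha ord_max ^+ 2 * (v 0 0 * v 0 1) ^+ q.
  move=> ->; rewrite hC (rmorph_product_form c hp alpha_neq0 (h := idfun)); last exact: mevalC.
  rewrite /= !mevalXU !pvecE !(hadd0r alpha hp) expr0n addn_eq0 (gtn_eqF (ltnW q_gt1)).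
  by rewrite /= mulr0 addr0 exprMn; ring.
split=> [/(_ (pvec a b 0))|ab v].
  rewrite ER memv_line E0 ?pvecE // => /(_ isT)/eqP.
  by rewrite mulf_eq0 !expf_eq0 /= (negPf aq) /= => /andP[_ /eqP].
rewrite ER => /vlineP[t ->]; rewrite pvecZ mulr0 E0 ?pvecE //.
by rewrite mulrACA ab mulr0 expr0n (gtn_eqF (ltnW q_gt1)) mulr0.
Qed.

End CurvePoints.

(** Additivity: L(x - a) + L(a) = L(x), so moving (a, b) to the origin only adds constants to the
    factors. *)
Lemma generic_point_shift (k : closedFieldType) (E : fieldType) (f : {rmorphism k -> E})
    (p e : nat) (alpha : 'I_e.+1 -> k) (c : k) (x y : E) (a b : k) :
  p \in [pchar k] ->
  let L := additive_poly p alpha in let q := (p ^ e)%N in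
  generic_point f L L c q x y ->
  generic_point f (L + (L.[a])%:P) (L + (L.[b])%:P) c q (x - f a) (y - f b).
Proof.
move=> hp L q [q_gt1 sL _ c0 x_transc xy_curve]; have q_gt0 := ltnW q_gt1.
have shift z w : (map_poly f (L + (L.[w])%:P)).[z - f w] = (map_poly f L).[z].
  rewrite horner_shift horner_additive_id -horner_additive.
  have <- : (map_poly f L).[f w] = f (hadd p alpha idfun w 1).
    by rewrite horner_map horner_additive_id.
  by rewrite -[in RHS](subrK (f w) z) !horner_additive -(haddD alpha hp).
split; rewrite ?shift //; try exact: sep_polyD.
move=> P Px; have := x_transc (P \Po ('X - a%:P)).
rewrite map_comp_poly horner_comp rmorphB /= map_polyX map_polyC !hornerE => /(_ Px) P0.
have := congr1 (fun Q => Q \Po ('X + a%:P)) P0.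
by rewrite -comp_polyA comp_polyB comp_polyX comp_polyC addrK comp_polyXr comp_poly0.
Qed.

Lemma bieval_gen_shift (k E : fieldType) (f : {rmorphism k -> E}) (x y : E) (a b : k) :
  (forall z, exists P Q, bieval f x y Q != 0 /\ z = bieval f x y P / bieval f x y Q) ->
  forall z, exists P Q, bieval f (x - f a) (y - f b) Q != 0
    /\ z = bieval f (x - f a) (y - f b) P / bieval f (x - f a) (y - f b) Q.
Proof.
move=> gen z; have sh (P : {poly {poly k}}) : exists Q,
    bieval f x y P = bieval f (x - f a) (y - f b) Q.
  exists (bieval (biC k) ('X%:P + a%:P%:P) ('X + b%:P%:P) P).
  rewrite bieval_bieval !bievalD !bievalCC bievalC bievalX map_polyX hornerX.
  by rewrite !subrK.
have [P [Q [Q0 ->]]] := gen z; have [P' EP] := sh P; have [Q' EQ] := sh Q.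
by exists P', Q'; rewrite -EQ -EP.
Qed.

Section LinearSubstitution.
Context {k : fieldType} (C : plane_curve k).
Hypothesis HZ : ('X_2%:R : {mpoly k[3]}) \notin curve_ideal C.
Context {n : nat} (A : 'M[k]_(3, n)).
Local Notation value := (mmap (funfield_const C)
  (fun j => \sum_(i < 3) funfield_const C (A i j) * funfield_coord C i)).

Lemma curve_ideal_lsubst d (g : {mpoly k[n]}) : g \is d.-homog ->
  (lsubst A g \notin curve_ideal C) = (value g != 0).
Proof.
move=> hg; rewrite -frac_residue_eq0 (frac_residue_lsubst HZ A hg) mulf_eq0 expf_eq0.
by rewrite (negPf (frac_residueZ_neq0 HZ)) andbF /= fmorph_eq0.
Qed.

Lemma form_ratio_lsubst d (g h : {mpoly k[n]}) : g \is d.-homog -> h \is d.-homog ->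
  form_ratio C (lsubst A g) (lsubst A h) = funfield_val (value g / value h).
Proof.
move=> hg hh; rewrite /form_ratio (frac_residue_lsubst HZ A hg) (frac_residue_lsubst HZ A hh).
by rewrite -mulf_div divff ?mul1r ?fmorph_div // expf_neq0 // frac_residueZ_neq0.
Qed.

End LinearSubstitution.

Section Pencil.
Context {k E : fieldType} (f : {rmorphism k -> E}) (x y : E).

(** The homogeneous coordinates of the projection given by M, in the chart Z = 1. *)
Definition pencil (M : 'M[k]_(3, 2)) (j : 'I_2) : E :=
  f (M 0 j) * x + f (M 1 j) * y + f (M 2%:R j).

Lemma mmap_pencil (t : E) (a b : 'I_2 -> k) (g : {mpoly k[2]}) :
  exists P : {poly k}, mmap f (fun j => f (a j) + f (b j) * t) g = (map_poly f P).[t].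
Proof.
exists (mmap polyC (fun j => (a j)%:P + (b j)%:P * 'X) g); apply/esym.
pose ev : {rmorphism {poly k} -> E} := horner_eval t \o map_poly f.
apply: (rmorph_mmap (h := polyC) (phi := ev)) => [d|j].
  by rewrite /ev /= /horner_eval map_polyC hornerC.
rewrite /ev /= /horner_eval rmorphD rmorphM /= !map_polyC map_polyX.
by rewrite hornerD hornerM !hornerC hornerX.
Qed.

Lemma eq_mmap n (v w : 'I_n -> E) (g : {mpoly k[n]}) : v =1 w -> mmap f v g = mmap f w g.
Proof. by move=> vw; apply: eq_bigr => m _; congr (_ * _); apply: mmap1_eq. Qed.

Lemma pencil_affine_sub (a b : k) (M : 'M[k]_(3, 2)) d (g h : {mpoly k[2]}) : x - f a != 0 ->
  (forall j, M 2%:R j = - (a * M 0 j + b * M 1 j)) ->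
  g \is d.-homog -> h \is d.-homog -> mmap f (pencil M) h != 0 ->
  mmap f (pencil M) g / mmap f (pencil M) h \in ratfun f ((y - f b) / (x - f a)).
Proof.
move=> x0 M2 hg hh; set t := (y - f b) / (x - f a).
have lin : pencil M =1 fun j => (x - f a) * (f (M 0 j) + f (M 1 j) * t).
  by move=> j; rewrite /pencil M2 rmorphN rmorphD !rmorphM /t /=; field.
rewrite !(eq_mmap _ lin) (mmap_homog _ _ _ hg) (mmap_homog _ _ _ hh).
rewrite mulf_eq0 negb_or => /andP[n0 h0]; rewrite -mulf_div divff // mul1r.
have [P ->] := mmap_pencil t (M 0) (M 1) g; have [Q ->] := mmap_pencil t (M 0) (M 1) h.
by apply: rpred_div; exact: ratfun_poly.
Qed.

Lemma pencil_parallel_sub (m : k) (M : 'M[k]_(3, 2)) (g h : {mpoly k[2]}) :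
  (forall j, M 0 j = - (m * M 1 j)) ->
  mmap f (pencil M) g / mmap f (pencil M) h \in ratfun f (y - f m * x).
Proof.
move=> M0; set t := y - f m * x.
have lin : pencil M =1 fun j => f (M 2%:R j) + f (M 1 j) * t.
  by move=> j; rewrite /pencil M0 rmorphN rmorphM /t /=; ring.
rewrite !(eq_mmap _ lin).
have [P ->] := mmap_pencil t (M 2%:R) (M 1) g.
have [Q ->] := mmap_pencil t (M 2%:R) (M 1) h.
by apply: rpred_div; exact: ratfun_poly.
Qed.

Lemma pencil_const M (s : k) : exists d (g h : {mpoly k[2]}),
  [/\ g \is d.-homog, h \is d.-homog, mmap f (pencil M) h != 0
    & f s = mmap f (pencil M) g / mmap f (pencil M) h].
Proof.
exists 0%N, s%:MP, 1; rewrite dhomog0C dhomog1.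
by rewrite rmorph1 divr1 oner_neq0; split=> //; rewrite mmapC.
Qed.

Definition affine_projection (a b : k) : 'M[k]_(3, 2) :=
  \matrix_(i < 3, j < 2) nth 0 (nth [::] [:: [:: 1; 0]; [:: 0; 1]; [:: - a; - b]] i) j.

Lemma pencil_affine_gen (a b : k) : exists d (g h : {mpoly k[2]}),
  [/\ g \is d.-homog, h \is d.-homog, mmap f (pencil (affine_projection a b)) h = x - f a
    & mmap f (pencil (affine_projection a b)) g = y - f b].
Proof.
exists 1%N, 'X_1, 'X_0; rewrite !dhomogX /= !mdeg1 !mmapX !mmap1U.
rewrite /pencil !mxE /= rmorph1 rmorph0 !rmorphN.
by rewrite !mul1r !mul0r add0r addr0; split.
Qed.

Definition parallel_projection (m : k) : 'M[k]_(3, 2) :=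
  \matrix_(i < 3, j < 2) nth 0 (nth [::] [:: [:: - m; 0]; [:: 1; 0]; [:: 0; 1]] i) j.

(** The chosen matrix has coordinates t and 1; numerator and denominator in t are homogenized to a
    common degree n. *)
Lemma pencil_parallel_full (m : k) s : s \in ratfun f (y - f m * x) ->
  exists d (g h : {mpoly k[2]}), let M := parallel_projection m in
  [/\ g \is d.-homog, h \is d.-homog, mmap f (pencil M) h != 0
    & s = mmap f (pencil M) g / mmap f (pencil M) h].
Proof.
move=> /ratfunP[g [h [h0 ->]]].
have p0 : pencil (parallel_projection m) 0 = y - f m * x.
  by rewrite /pencil !mxE /= rmorph1 rmorph0 rmorphN mul1r mulNr addr0 addrC.
have p1 : pencil (parallel_projection m) 1 = 1.
  by rewrite /pencil !mxE /= rmorph1 rmorph0 !mul0r !add0r.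
pose n := maxn (size g) (size h).
pose hom (P : {poly k}) : {mpoly k[2]} :=
  \sum_(i < n) (P`_i)%:MP * ('X_0 ^+ i * 'X_1 ^+ (n - i)).
have hom_homog P : hom P \is n.-homog.
  have hX (i : 'I_2) : ('X_i : {mpoly k[2]}) \is 1.-homog by rewrite dhomogX /= mdeg1.
  apply: rpred_sum => i _.
  have := dhomogM (dhomog0C 2 P`_i) (dhomogM (dhomogMn i (hX 0)) (dhomogMn (n - i) (hX 1))).
  by rewrite add0n !mul1n subnKC // ltnW.
have hom_val (P : {poly k}) : (size P <= n)%N ->
    mmap f (pencil (parallel_projection m)) (hom P) = (map_poly f P).[y - f m * x].
  move=> sP; rewrite (@horner_coef_wide _ n) ?(leq_trans (size_poly _ _)) //.
  rewrite rmorph_sum; apply: eq_bigr => i _ /=.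
  by rewrite !rmorphM !rmorphXn /= mmapC !mmapX !mmap1U p0 p1 expr1n mulr1 coef_map.
by exists n, (hom g), (hom h) => /=; rewrite !hom_val ?leq_maxl ?leq_maxr.
Qed.

Lemma translation_matrix (a b : k) : exists2 A : 'M[k]_3, A \in unitmx &
  forall j, f (A 0 j) * x + f (A 1 j) * y + f (A 2%:R j)
    = nth 0 [:: x + f a; y + f b; 1] j.
Proof.
have mx3 (rows : seq (seq k)) (i j : 'I_3) :
    (\matrix_(i < 3, j < 3) nth 0 (nth [::] rows i) j) i j = nth 0 (nth [::] rows i) j.
  by rewrite mxE.
pose A (u v : k) : 'M[k]_3 := \matrix_(i < 3, j < 3)
  nth 0 (nth [::] [:: [:: 1; 0; 0]; [:: 0; 1; 0]; [:: u; v; 1]] i) j.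
have AB : A a b *m A (- a) (- b) = 1%:M.
  apply/matrixP => i j; rewrite !mxE sum3 !mx3.
  by case: i j => -[|[|[|]]] // i3 [[|[|[|]]] // j3] /=; rewrite ?eqxx /=; ring.
exists (A a b); first by case: (mulmx1_unit AB).
by move=> j; rewrite !mx3; case: j => -[|[|[|]]] // j3 /=; rewrite rmorph1 rmorph0; ring.
Qed.

Lemma exchange_matrix (a m : k) : m != 0 -> exists2 A : 'M[k]_3, A \in unitmx &
  forall j, f (A 0 j) * x + f (A 1 j) * y + f (A 2%:R j)
    = nth 0 [:: f a - f m^-1 * y; f (m * a) - f m * x; 1] j.
Proof.
move=> m0; have mx3 (rows : seq (seq k)) (i j : 'I_3) :
    (\matrix_(i < 3, j < 3) nth 0 (nth [::] rows i) j) i j = nth 0 (nth [::] rows i) j.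
  by rewrite mxE.
pose A : 'M[k]_3 := \matrix_(i < 3, j < 3)
  nth 0 (nth [::] [:: [:: 0; - m; 0]; [:: - m^-1; 0; 0]; [:: a; m * a; 1]] i) j.
have AA : A *m A = 1%:M.
  apply/matrixP => i j; rewrite !mxE sum3 !mx3.
  by case: i j => -[|[|[|]]] // i3 [[|[|[|]]] // j3] /=; rewrite ?eqxx /=; field.
exists A; first by case: (mulmx1_unit AA).
move=> j; rewrite !mx3; case: j => -[|[|[|]]] // j3 /=;
  by rewrite ?rmorphN ?rmorph1 rmorph0; ring.
Qed.

End Pencil.

(** * Classification of the outer Galois points *)

Section GaloisPoints.
Context {k : closedFieldType} (p e : nat) (alpha : 'I_e.+1 -> k) (c : k).
Hypotheses (hp : p \in [pchar k]) (e_gt0 : (0 < e)%N) (c0 : c != 0).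
Hypothesis alpha_neq0 : alpha ord_max * alpha ord0 != 0.
Local Notation q := (p ^ e)%N.
Local Notation L := (additive_poly p alpha).
Hypothesis q_gt2 : (2 < q)%N.
Context (C : plane_curve k) (hC : curve_form C = product_form L L c).
Local Notation f := (funfield_const C).
Local Notation x := (funfield_coord C 0).
Local Notation y := (funfield_coord C 1).
Let HZ := line_at_infinity hp e_gt0 c0 alpha_neq0 hC.
Let pt := curve_generic_point hp e_gt0 c0 alpha_neq0 hC.
Let gen := funfield_gen HZ.

Lemma proj_fieldP (R : P2 k) (a : funfield C) : proj_field C R a <->
  exists M : 'M[k]_(3, 2), projection_from R M /\ exists d (g h : {mpoly k[2]}),
    [/\ g \is d.-homog, h \is d.-homog, mmap f (pencil f x y M) h != 0
      & a = mmap f (pencil f x y M) g / mmap f (pencil f x y M) h].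
Proof.
have lin M (g : {mpoly k[2]}) : mmap f (pencil f x y M) g
    = mmap f (fun j => \sum_(i < 3) f (M i j) * funfield_coord C i) g.
  apply: eq_bigr => m _; congr (_ * _); apply: mmap1_eq => j.
  by rewrite sum3 (funfield_coord2 HZ) mulr1.
split=> -[M [RM [d [g [h [hg hh h0 Ea]]]]]]; exists M; split=> //; exists d, g, h.
  rewrite !lin -(curve_ideal_lsubst HZ _ hh); split=> //; apply: funfield_val_inj.
  by rewrite -(form_ratio_lsubst HZ _ hg hh).
rewrite (curve_ideal_lsubst HZ _ hh) -lin; split=> //.
by rewrite (form_ratio_lsubst HZ _ hg hh) -!lin -Ea.
Qed.

Section AffinePoint.
Context (R : P2 k) (a b : k).
Hypothesis ER : val R = <[pvec a b 1]>%VS.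
Let t := (y - f b) / (x - f a).
Let x_neq0 : x - f a != 0.
Proof. by rewrite subr_eq0; apply/eqP; exact: (gp_x_nconst pt (a := a)). Qed.

Lemma proj_field_affine_sub s : proj_field C R s -> s \in ratfun f t.
Proof.
move=> /proj_fieldP[M [RM [d [g [h [hg hh h0 ->]]]]]].
apply: (pencil_affine_sub x_neq0 _ hg hh h0) => j.
apply/eqP; rewrite -addr_eq0 addrC; apply/eqP.
have /RM/rowP/(_ j) : pvec a b 1 \in val R by rewrite ER memv_line.
by rewrite mul_pvec mxE mul1r.
Qed.

Let M0_proj : projection_from R (affine_projection a b).
Proof.
move=> v; rewrite ER; split=> [vM|/vlineP[s ->]].
  have vj j : (v *m affine_projection a b) 0 j = 0 by rewrite vM mxE.
  have := (vj 0, vj 1); rewrite {1 2}(row3P v) !mul_pvec !mxE /=.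
  rewrite !mulr1 !mulr0 !addr0 !add0r => -[e0 e1].
  apply/vlineP; exists (v 0 2%:R); rewrite [LHS]row3P pvecZ mulr1.
  by congr (pvec _ _ _); apply/eqP; rewrite -subr_eq0 -mulrN ?e0 ?e1.
apply/rowP => j; rewrite pvecZ mul_pvec !mxE mulr1.
by case: j => -[|[|]] //= _; ring.
Qed.

Lemma proj_field_affine_gen : proj_field C R t /\ forall s, proj_field C R (f s).
Proof.
split=> [|s]; apply/proj_fieldP; exists (affine_projection a b); split=> //.
  have [d [g [h [hg hh Eh Eg]]]] := pencil_affine_gen f x y a b.
  by exists d, g, h; rewrite Eh Eg.
exact: pencil_const.
Qed.

(** Translating the centre to the origin reduces this to [no_concurrent_group], its hypothesis
    [origin] saying that the centre is off the curve. *)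
Lemma affine_not_galois : ~ outer_galois_point C R.
Proof.
move=> [nR /galois_over_group[T [s [sM s1 sV sK sfix]]]].
have origin := horner_eval_neq0_affine hp alpha_neq0 hC ER nR.
have [tK fK] := proj_field_affine_gen.
apply: (no_concurrent_group hp e_gt0 alpha_neq0 q_gt2
  (generic_point_shift a b hp pt) origin (bieval_gen_shift a b gen) sM s1 sV).
- by move=> g d; apply: sK; exact: fK.
- by move=> g; apply: sK.
- by move=> z zfix; apply: proj_field_affine_sub; apply: sfix.
Qed.

End AffinePoint.

Section InfinitePoint.
Context (R : P2 k) (m : k).
Hypothesis ER : val R = <[pvec 1 m 0]>%VS.
Let t := y - f m * x.

Lemma proj_field_infinity_sub s : proj_field C R s -> s \in ratfun f t.
Proof.
move=> /proj_fieldP[M [RM [d [g [h [hg hh h0 ->]]]]]].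
apply: pencil_parallel_sub => j; apply/eqP; rewrite -addr_eq0; apply/eqP.
have /RM/rowP/(_ j) : pvec 1 m 0 \in val R by rewrite ER memv_line.
by rewrite mul_pvec mxE mul1r mul0r addr0.
Qed.

Let M0_proj : projection_from R (parallel_projection m).
Proof.
move=> v; rewrite ER; split=> [vM|/vlineP[s ->]].
  have vj j : (v *m parallel_projection m) 0 j = 0 by rewrite vM mxE.
  have := (vj 0, vj 1); rewrite {1 2}(row3P v) !mul_pvec !mxE /=.
  rewrite !mulr1 !mulr0 !addr0 !add0r => -[e0 e1].
  apply/vlineP; exists (v 0 0); rewrite [LHS]row3P pvecZ mulr1 mulr0 e1.
  by congr (pvec _ _ _); apply/eqP; rewrite -subr_eq0 -mulrN addrC e0.
apply/rowP => j; rewrite pvecZ mul_pvec !mxE mulr1 mulr0.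
by case: j => -[|[|]] //= _; ring.
Qed.

Lemma proj_field_infinity : proj_field C R = [set s | s \in ratfun f t].
Proof.
apply/seteqP; split=> [s /proj_field_infinity_sub //|s /= /pencil_parallel_full E].
by apply/proj_fieldP; exists (parallel_projection m).
Qed.

Lemma infinity_galois_slope : outer_galois_point C R ->
  m != 0 /\ forall i, alpha i != 0 -> m ^+ (p ^ i) = m.
Proof.
move=> [nR]; have m0 : m != 0.
  apply/eqP => m0; apply: nR.
  by apply: (on_curve_infinity hp e_gt0 alpha_neq0 hC ER).2; rewrite m0 mulr0.
rewrite proj_field_infinity => /galois_over_group[T [s [sM s1 sV sK sfix]]]; split=> //.
apply: (parallel_group_slope hp alpha_neq0 q_gt2 pt m0 gen sM s1).
- by move=> g d; apply: sK; exact: ratfun_const.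
- by move=> g; apply: sK; exact: ratfun_gen.
- exact: sfix.
Qed.

Hypotheses (m0 : m != 0) (hm : forall i, alpha i != 0 -> m ^+ (p ^ i) = m).

Lemma infinity_galois : outer_galois_point C R.
Proof.
split.
  move=> /(on_curve_infinity hp e_gt0 alpha_neq0 hC ER).1/eqP.
  by rewrite mul1r (negPf m0).
rewrite proj_field_infinity.
exact: (parallel_galois_over hp alpha_neq0 pt m0 hm q_gt2 gen).
Qed.

Lemma linear_on_curve_coord (s : {rmorphism funfield C -> funfield C}) (A : 'M[k]_3) :
  A \in unitmx -> (forall d, s (f d) = f d) ->
  (forall j, s (funfield_coord C j) = f (A 0 j) * x + f (A 1 j) * y + f (A 2%:R j)) ->
  linear_on_curve s.
Proof.
move=> Au sf sc; exists A => // d G H a hG hH HC Ea.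
have lin g : mmap f (fun j => \sum_(i < 3) f (A i j) * funfield_coord C i) g
    = s (affine_value C g).
  apply/esym; apply: (rmorph_mmap (h := f) (phi := s)) => // j.
  by rewrite sc sum3 (funfield_coord2 HZ) mulr1.
rewrite (curve_ideal_lsubst HZ _ hH) (form_ratio_lsubst HZ _ hG hH) !lin -fmorph_div.
rewrite fmorph_eq0 -(curve_ideal_homog HZ hH); split=> //; congr (funfield_val (s _)).
by apply: funfield_val_inj; rewrite Ea (form_ratio_homog HZ hG hH).
Qed.

(** Each automorphism over k(t) is a translation or an affine exchange of the coordinates, and both
    come from invertible 3 by 3 matrices. *)
Lemma infinity_extendable : extendable C R.
Proof.
move=> s _ sK.
have sf d : s (f d) = f d.
  by apply: sK; rewrite proj_field_infinity; exact: ratfun_const.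
have st : s t = t by apply: sK; rewrite proj_field_infinity; exact: ratfun_gen.
have coord u v : s x = u -> s y = v ->
    forall j, s (funfield_coord C j) = nth 0 [:: u; v; 1] j.
  move=> sx sy; case=> -[|[|[|]]] // j3 /=.
  rewrite -(rmorph1 s) -(funfield_coord2 HZ).
  by congr (s (funfield_coord C _)); apply: val_inj.
have [a La [[sx sy]|[sx sy]]] := parallel_automorphism hp alpha_neq0 pt m0 hm sf st.
  have [A Au EA] := translation_matrix f x y a (m * a).
  by apply: (linear_on_curve_coord Au sf) => j; rewrite EA (coord _ _ sx sy).
have [A Au EA] := exchange_matrix f x y a m0.
by apply: (linear_on_curve_coord Au sf) => j; rewrite EA (coord _ _ sx sy).
Qed.

End InfinitePoint.

Lemma outer_galois_pointP (R : P2 k) : outer_galois_point C R <->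
  exists m, [/\ m != 0, forall i, alpha i != 0 -> m ^+ (p ^ i) = m
    & val R = <[pvec 1 m 0]>%VS].
Proof.
split=> [gR|[m [m0 hm ER]]]; last exact: infinity_galois ER m0 hm.
have [[a [b ER]]|[m ER]|ER] := P2_cases R.
- by case: (affine_not_galois ER).
- by have [m0 hm] := infinity_galois_slope ER gR; exists m.
case: gR => nR _; case: nR.
by apply: (on_curve_infinity hp e_gt0 alpha_neq0 hC ER).2; rewrite mul0r.
Qed.

Lemma outer_galois_extendable (R : P2 k) :
  outer_galois_point C R -> extendable_outer_galois_point C R.
Proof.
move=> gR; split=> //; have /outer_galois_pointP[m [m0 hm ER]] := gR.
exact: infinity_extendable ER m0 hm.
Qed.

End GaloisPoints.

Lemma card_slope_points (k : fieldType) (s : seq k) : uniq s ->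
  [set R : P2 k | exists2 m, m \in s & val R = <[pvec 1 m 0]>%VS] #= `I_(size s).
Proof.
move=> us; have dim1 m : \dim <[pvec 1 m 0 : 'rV[k]_3]>%VS == 1%N.
  apply: pvec_dim; apply/eqP => /rowP/(_ 0).
  by rewrite pvecE mxE => /eqP; rewrite oner_eq0.
pose pt j : P2 k := exist (fun V : {vspace 'rV[k]_3} => \dim V == 1%N) _ (dim1 (nth 0 s j)).
rewrite (_ : [set R | _] = pt @` `I_(size s)).
  apply: inj_card_eq => i j; rewrite !inE /=.
  move=> si sj /(congr1 (fun R : P2 k => pvec 1 (nth 0 s i) 0 \in val R)).
  rewrite /= memv_line => /esym/vlineP[t]; rewrite pvecZ mulr1 => /pvec_inj[<- + _].
  by rewrite mul1r => /eqP; rewrite nth_uniq // => /eqP.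
apply/seteqP; split=> R /= [m ms ER]; last by exists (nth 0 s m); rewrite -?ER ?mem_nth.
exists (index m s); first by rewrite /= index_mem.
by apply: val_inj; rewrite /= nth_index // ER.
Qed.

(** The index 0, left out of the intersection, imposes the trivial condition m^1 = m. *)
Lemma FsubP (k : closedFieldType) (p e : nat) (alpha : 'I_e.+1 -> k) (r : nat) (m : k) :
  Fsub k p r = \bigcap_(i in [set i : 'I_e.+1 | (0 < i)%N /\ alpha i != 0]) Fsub k p i ->
  m ^+ (p ^ r) = m <-> forall i, alpha i != 0 -> m ^+ (p ^ i) = m.
Proof.
move=> Fr; split=> [mr i ai|hm].
  have : Fsub k p r m by [].
  rewrite Fr; have [i0 _|i_gt0] := posnP i; first by rewrite i0 expr1.
  by apply; split.
by suff : Fsub k p r m by []; rewrite Fr => i [_ ai]; exact: hm.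
Qed.

Theorem theorem3 (k : closedFieldType) (p : nat) (hp : p \in [pchar k])
  (e : nat) (he : (1 <= e)%N) (hpe : (2 < p ^ e)%N)
  (c : k) (hc : c != 0)
  (alpha1 alpha2 : 'I_e.+1 -> k)
  (halpha1 : alpha1 ord_max * alpha1 ord0 != 0)
  (halpha2 : alpha2 ord_max * alpha2 ord0 != 0)
  (r : nat) (hr1 : (1 <= r)%N)
  (hr : Fsub k p r =
    \bigcap_(i in [set i : 'I_e.+1 | (0 < i)%N /\ alpha1 i != 0]) Fsub k p i `&`
    \bigcap_(j in [set j : 'I_e.+1 | (0 < j)%N /\ alpha2 j != 0]) Fsub k p j)
  (hL : additive_poly p alpha1 = additive_poly p alpha2) :
  exists C : plane_curve k,
    [/\ curve_form C = product_form (additive_poly p alpha1) (additive_poly p alpha2) c,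
        [set R : P2 k | outer_galois_point C R] #= `I_(p ^ r - 1)
      & [set R : P2 k | extendable_outer_galois_point C R] #= `I_(p ^ r - 1)].
Proof.
have a12 : alpha1 = alpha2.
  by apply/funext => i; rewrite -(coef_additive_pexp alpha1 hp i) hL coef_additive_pexp.
rewrite -a12 setIid in hr; have [C hC] := product_form_curve hp he hc halpha1.
have ext R : extendable_outer_galois_point C R <-> outer_galois_point C R.
  by split=> [[]//|]; exact: (outer_galois_extendable hp he hc halpha1 hpe hC).
have q_gt1 : (1 < p ^ r)%N.
  by rewrite -(exp1n r) ltn_exp2r // prime_gt1 // (pcharf_prime hp).
(* The derivative of X^(p^r) - X is -1, so this polynomial has p^r distinct roots; removing 0 leaves
   the slopes. *)
have [] := @constant_deriv_roots k ('X^(p ^ r) - 'X) (p ^ r) (-1).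
- by rewrite oppr_eq0 oner_eq0.
- rewrite derivB derivXn derivX -mulr_natr -polyC_natr natrX (pcharf0 hp).
  by rewrite expr0n gtn_eqF // mulr0 sub0r polyCN.
- by rewrite size_polyDl ?size_polyXn // size_polyN size_polyX ltnS.
move=> s [us ss rs].
have s0 : 0 \in s by rewrite rs rootE !hornerE expr0n gtn_eqF ?subrr // ltnW.
have cardG : [set R : P2 k | outer_galois_point C R] #= `I_(p ^ r - 1).
  have -> : (p ^ r - 1 = size (rem 0%R s))%N by rewrite size_rem // ss subn1.
  rewrite (_ : [set R | _] = [set R : P2 k |
    exists2 m, m \in rem 0 s & val R = <[pvec 1 m 0]>%VS]).
    exact/card_slope_points/rem_uniq.
  have mem m : m \in rem 0 s <-> m != 0 /\ forall i, alpha1 i != 0 -> m ^+ (p ^ i) = m.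
    rewrite -(FsubP _ hr) mem_rem_uniq // inE /= rs rootE !hornerE subr_eq0.
    by split=> [/andP[-> /eqP]|[-> /eqP]].
  apply/seteqP; split=> R /=.
    move=> /(outer_galois_pointP hp he hc halpha1 hpe hC)[m [m0 hm ER]].
    by exists m => //; apply/mem.
  move=> [m /mem[m0 hm] ER].
  by apply/(outer_galois_pointP hp he hc halpha1 hpe hC); exists m.
exists C; split=> //; first by rewrite -hL.
by rewrite (_ : [set R | _] = [set R : P2 k | outer_galois_point C R]) //;
  apply/seteqP; split=> R /ext.
Qed.
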